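(* Let $G_m$ be a bounded Vilenkin group, let $f\in H_{1/(1+\alpha)}(G_m)$, where $0<\alpha<1$, and let $\{q_n:n\ge 0\}$ be a non-increasing sequence of non-negative numbers with $q_0>0$ and $Q_n:=\sum_{k=0}^{n-1}q_k\to\infty$, such that $$\frac{n^{\alpha}}{Q_n}=O(1)\quad\text{as } n\to\infty,\qquad\text{and}\qquad \frac{q_n-q_{n+1}}{n^{\alpha-2}}=O(1)\quad\text{as } n\to\infty .$$ Let $t_kf:=\frac{1}{Q_k}\sum_{j=1}^{k}q_{k-j}S_jf$ be the $k$-th Nörlund mean of $f$. Then there exists an absolute constant $c_\alpha$, depending only on $\alpha$, such that for every integer $n\ge 2$ $$\frac{1}{\log n}\sum_{k=1}^{n}\frac{\|t_kf\|_{H_{1/(1+\alpha)}}^{1/(1+\alpha)}}{k}\le c_\alpha\,\|f\|_{H_{1/(1+\alpha)}}^{1/(1+\alpha)} .$$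
   Context: $\mathbb{N}_+$ is the set of positive integers and $\mathbb{N}=\mathbb{N}_+\cup\{0\}$. Let $m=(m_0,m_1,\dots)$ be a sequence of integers $m_n\ge 2$ with $\sup_n m_n<\infty$ (bounded case). $Z_{m_n}=\{0,\dots,m_n-1\}$ is the additive group of integers modulo $m_n$. The Vilenkin group $G_m$ is the complete direct product of the $Z_{m_n}$ with the product of discrete topologies; its elements are $x=(x_0,x_1,\dots)$, $x_n\in Z_{m_n}$, and $\mu$ is the normalized Haar measure, i.e. the product of the uniform probability measures on the $Z_{m_n}$. Let $I_0(x):=G_m$ and $I_n(x):=\{y\in G_m: y_0=x_0,\dots,y_{n-1}=x_{n-1}\}$. Put $M_0:=1$, $M_{n+1}:=m_nM_n$. Every $n\in\mathbb{N}$ is uniquely $n=\sum_{k\ge 0}n_kM_k$ with $n_k\in Z_{m_k}$. Let $r_k(x):=\exp(2\pi i x_k/m_k)$; the Vilenkin system is $\psi_n(x):=\prod_{k\ge 0}r_k(x)^{n_k}$. For $0<p<\infty$, $\|f\|_p:=\left(\int_{G_m}|f|^p\,d\mu\right)^{1/p}$. Let $\mathcal F_n$ be the $\sigma$-algebra generated by $\{I_n(x):x\in G_m\}$. A martingale $f=(f^{(n)},n\in\mathbb{N})$ is taken with respect to $(\mathcal F_n)$; its maximal function is $f^*:=\sup_n|f^{(n)}|$, and $H_p(G_m)$ consists of all martingales with $\|f\|_{H_p}:=\|f^*\|_p<\infty$. An integrable function $g$ (such as $t_kf$, which is a finite linear combination of the $\psi_i$) is identified with the martingale of its conditional expectations $(E[g\mid\mathcal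 F_n])_n$. The Vilenkin–Fourier coefficients of a martingale are $\widehat f(i):=\lim_{k\to\infty}\int_{G_m}f^{(k)}\overline{\psi_i}\,d\mu$, and the partial sums are $S_nf:=\sum_{k=0}^{n-1}\widehat f(k)\psi_k$ for $n\in\mathbb{N}_+$.
   Formalization: The constant may depend on the group G_m (the sequence m) and on the weights q as well as on α, though not on f or n; a constant depending only on α, uniform over all m and q, does not exist. *)

(* Defs.v *)
From HB Require Import structures.
From mathcomp Require Import all_boot all_order all_algebra.
From mathcomp Require Import complex.
From mathcomp Require Import all_classical all_reals all_analysis.

Set Implicit Arguments.
Unset Strict Implicit.
Unset Printing Implicit Defensive.

Import Order.TTheory GRing.Theory Num.Theory.
Import numFieldNormedType.Exports.

Local Open Scope classical_set_scope.
Local Open Scope ring_scope.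

HB.instance Definition _ (n : nat) := isPointed.Build 'Z_n 0.

(* ['Z_k] is the cyclic group of order [k] only for [k >= 2], whence the first
   conjunct of [bounded_base]. *)
Definition vilenkin_group (m : nat -> nat) : Type := forall k : nat, 'Z_(m k).

Definition bounded_base (m : nat -> nat) : Prop :=
  (forall n, (2 <= m n)%N) /\ (exists B : nat, forall n, (m n <= B)%N).

Definition cylinder (m : nat -> nat) (n : nat) (x : vilenkin_group m) :
    set (vilenkin_group m) :=
  [set y | forall k, (k < n)%N -> y k = x k].

Definition filtration (m : nat -> nat) (n : nat) :
    set (set (vilenkin_group m)) :=
  <<s [set cylinder n x | x in [set: vilenkin_group m]] >>.

(* [vilenkin_group m] with the sigma-algebra generated by all the cylinders,
   which is both the product and the Borel sigma-algebra. *)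
Definition vilenkin_space (m : nat -> nat) :=
  g_sigma_algebraType
    (\bigcup_n [set cylinder n x | x in [set: vilenkin_group m]]).

Definition product_uniform (R : realType) (m : nat -> nat)
    (mu : probability (vilenkin_space m) R) : Prop :=
  forall (n : nat) (A : forall k, {set 'Z_(m k)}),
    mu [set x | forall k, (k < n)%N -> x k \in A k] =
    (\prod_(k < n) (#|A k|%:R / (m k)%:R))%:E.

Definition cintegral (R : realType) (m : nat -> nat)
    (mu : probability (vilenkin_space m) R) (A : set (vilenkin_space m))
    (g : vilenkin_space m -> R[i]) : R[i] :=
  (Rintegral mu A (fun x => complex.Re (g x)) +i*
   Rintegral mu A (fun x => complex.Im (g x)))%C.

Definition cintegrable (R : realType) (m : nat -> nat)
    (mu : probability (vilenkin_space m) R) (g : vilenkin_space m -> R[i]) :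
    Prop :=
  mu.-integrable setT (fun x => (complex.Re (g x))%:E) /\
  mu.-integrable setT (fun x => (complex.Im (g x))%:E).

Definition filtration_measurable (R : realType) (m : nat -> nat) (n : nat)
    (g : vilenkin_space m -> R[i]) : Prop :=
  forall B : set R, measurable B ->
    filtration n ((fun x => complex.Re (g x)) @^-1` B) /\
    filtration n ((fun x => complex.Im (g x)) @^-1` B).

Definition is_cond_exp (R : realType) (m : nat -> nat)
    (mu : probability (vilenkin_space m) R) (n : nat)
    (g h : vilenkin_space m -> R[i]) : Prop :=
  [/\ cintegrable mu h, filtration_measurable n h &
      forall A, filtration n A -> cintegral mu A h = cintegral mu A g].

(* For the product of the uniform measures every nonempty member of
   [filtration m n] has positive measure, so that [is_cond_exp mu n g h]
   determines [h] everywhere, and not only almost everywhere. *)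
Definition cond_exp (R : realType) (m : nat -> nat)
    (mu : probability (vilenkin_space m) R) (n : nat)
    (g : vilenkin_space m -> R[i]) : vilenkin_space m -> R[i] :=
  xget (fun=> 0) [set h | is_cond_exp mu n g h].

Definition martingale (R : realType) (m : nat -> nat)
    (mu : probability (vilenkin_space m) R)
    (f : nat -> vilenkin_space m -> R[i]) : Prop :=
  forall n, [/\ cintegrable mu (f n), filtration_measurable n (f n) &
                is_cond_exp mu n (f n.+1) (f n)].

Definition maximal_function (R : realType) (m : nat -> nat)
    (f : nat -> vilenkin_space m -> R[i]) (x : vilenkin_space m) : \bar R :=
  ereal_sup [set (Normc.normc (f n x))%:E | n in [set: nat]].

Definition hardy_norm (R : realType) (m : nat -> nat)
    (mu : probability (vilenkin_space m) R) (p : R)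
    (f : nat -> vilenkin_space m -> R[i]) : \bar R :=
  Lnorm mu p%:E (maximal_function f).

Definition hardy (R : realType) (m : nat -> nat)
    (mu : probability (vilenkin_space m) R) (p : R)
    (f : nat -> vilenkin_space m -> R[i]) : Prop :=
  martingale mu f /\ (hardy_norm mu p f < +oo)%E.

Definition martingale_of (R : realType) (m : nat -> nat)
    (mu : probability (vilenkin_space m) R) (g : vilenkin_space m -> R[i]) :
    nat -> vilenkin_space m -> R[i] :=
  fun n => cond_exp mu n g.

Definition vilenkin_base (m : nat -> nat) (n : nat) : nat :=
  (\prod_(k < n) m k)%N.

Definition vilenkin_digit (m : nat -> nat) (n k : nat) : nat :=
  ((n %/ vilenkin_base m k) %% m k)%N.

Definition rademacher (R : realType) (m : nat -> nat) (k : nat)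
    (x : vilenkin_space m) : R[i] :=
  let theta := 2 * pi * (x k : nat)%:R / (m k)%:R in
  (cos theta +i* sin theta)%C.

(* The factors of index [k >= n] of the infinite product are [1]: the digit of
   index [k] of [n] vanishes as soon as [n < 2 ^ k]. *)
Definition vilenkin_function (R : realType) (m : nat -> nat) (n : nat)
    (x : vilenkin_space m) : R[i] :=
  \prod_(k < n) rademacher R k x ^+ vilenkin_digit m n k.

Definition fourier_coef (R : realType) (m : nat -> nat)
    (mu : probability (vilenkin_space m) R)
    (f : nat -> vilenkin_space m -> R[i]) (i : nat) : R[i] :=
  [lim cintegral mu setT (fun x => f k x * (vilenkin_function R i x)^*%C)
     @[k --> \oo] in (R[i] : numFieldType)].

Definition partial_sum (R : realType) (m : nat -> nat)
    (mu : probability (vilenkin_space m) R)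
    (f : nat -> vilenkin_space m -> R[i]) (n : nat) (x : vilenkin_space m) :
    R[i] :=
  \sum_(0 <= k < n) fourier_coef mu f k * vilenkin_function R k x.

Definition weight_sum (R : realType) (q : nat -> R) (n : nat) : R :=
  \sum_(0 <= k < n) q k.

Definition norlund_mean (R : realType) (m : nat -> nat)
    (mu : probability (vilenkin_space m) R) (q : nat -> R)
    (f : nat -> vilenkin_space m -> R[i]) (k : nat) (x : vilenkin_space m) :
    R[i] :=
  ((weight_sum q k)^-1)%:C%C *
  \sum_(1 <= j < k.+1) (q (k - j)%N)%:C%C * partial_sum mu f j x.

(* Main.v *)
Require Import Defs.
From mathcomp Require Import all_boot all_order all_algebra.
From mathcomp Require Import complex.
From mathcomp Require Import all_classical all_reals all_analysis.
From mathcomp Require Import measurable_realfun.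
From mathcomp Require Import zify ring lra.
Set Implicit Arguments.
Unset Strict Implicit.
Unset Printing Implicit Defensive.
Import Order.TTheory GRing.Theory Num.Theory.
Import numFieldNormedType.Exports.
Local Open Scope classical_set_scope.
Local Open Scope ring_scope.

(* Put p = 1/(1+alpha) and let [M k] be the generalised powers. Only f_N with
   n < M N matters, so everything happens on the finite quotient of order [M N].

   The kernel of t_n at (x, y) is a sum over j < n of Q_(n-j) times the j-th
   character evaluated at x - y. If k < l are the first two coordinates in which
   x and y differ, summing over the k-th digit gains a first difference of Q, and
   summing over the l-th digit then gains a second difference. As q is
   nonincreasing these differences telescope over the consecutive blocks of length
   [M l.+1], and the kernel is O(M k * Q(M l)) / Q_n. The hypotheses on q enter
   only through Q_a / Q_n = O((a / n)^alpha) for a <= n.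

   For an atom a living on a cylinder of level h and bounded by A, this gives a
   pointwise bound of (t_n a)^* by a function measurable at level h, and for
   M s <= n < M s.+1 with h <= s it gives E[((t_n a)^* )^p] = O(A^p / M h) *
   (1 + (h+1) (M h / M s)^(alpha p)); for n <= M h one has t_n a = 0. Summing over n
   with weights 1/n yields O(N) A^p / M h, and N is comparable to log n.
   A general f is reduced to atoms by stopping it at dyadic thresholds. *)

(** * Mixed-radix digits *)

(** The exponent p = 1/(1+alpha) is an endpoint: since alpha p + p = 1, each level l <= h
    contributes the same amount to the p-th moment of the majorant of an atom of level h, and the
    estimate for a single mean loses the factor h+1. This loss comes with the geometric factor (M h
    / M s)^(alpha p), so it is paid once over all the blocks M s <= n < M s.+1 and not once per
    block. The other term costs a constant per block, because 1/n sums to at most B over a block.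
    Both add up to O(N), which is what the division by log n absorbs.

    For p <= 1 the triangle inequality is replaced by subadditivity of t -> t^p. It makes the
    weighted sum of p-th moments a subadditive functional, so that testing it on atoms suffices. The
    cancellation of an atom is used twice: it kills the means of small index, and it kills the
    conditional expectations of level below h, so that the maximal function averages only over sets
    where the majorant is constant. *)

Section Digits.
Variable m : nat -> nat.
Hypothesis m_ge2 : forall n, (2 <= m n)%N.
Local Notation M := (vilenkin_base m).
Local Notation digit := (vilenkin_digit m).

Lemma vilenkin_base0 : M 0 = 1%N.
Proof. by rewrite /vilenkin_base big_ord0. Qed.

Lemma vilenkin_baseS k : M k.+1 = (M k * m k)%N.
Proof. by rewrite /vilenkin_base big_ord_recr. Qed.

Lemma vilenkin_base_gt0 k : (0 < M k)%N.
Proof.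
elim: k => [|k IH]; first by rewrite vilenkin_base0.
by rewrite vilenkin_baseS muln_gt0 IH (leq_trans _ (m_ge2 k)).
Qed.

Lemma dvdn_vilenkin_base k n : (k <= n)%N -> (M k %| M n)%N.
Proof.
elim: n => [|n IH]; first by rewrite leqn0 => /eqP ->.
rewrite leq_eqVlt => /orP[/eqP -> //|kn].
by rewrite vilenkin_baseS dvdn_mulr // IH.
Qed.

Lemma leq_vilenkin_base k n : (k <= n)%N -> (M k <= M n)%N.
Proof. by move=> /dvdn_vilenkin_base/dvdn_leq-> //; exact: vilenkin_base_gt0. Qed.

Lemma vilenkin_base_expn k n : (2 ^ k * M n <= M (n + k))%N.
Proof.
elim: k => [|k IH]; first by rewrite mul1n addn0.
by rewrite addnS vilenkin_baseS expnSr -mulnA mulnCA mulnC leq_mul.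
Qed.

Lemma vilenkin_base_expn0 k : (2 ^ k <= M k)%N.
Proof. by have := vilenkin_base_expn k 0; rewrite vilenkin_base0 muln1. Qed.

Lemma vilenkin_digit_lt j c : (digit j c < m c)%N.
Proof. by rewrite ltn_pmod // (leq_trans _ (m_ge2 c)). Qed.

Lemma modn_vilenkin_baseS x c : (x %% M c.+1 = x %% M c + digit x c * M c)%N.
Proof.
rewrite vilenkin_baseS [LHS](divn_eq _ (M c)) [LHS]addnC modn_dvdm ?dvdn_mulr //.
by rewrite /vilenkin_digit modn_divl [(m c * _)%N]mulnC.
Qed.

Lemma digit_modn x n c : (c < n)%N -> digit (x %% M n) c = digit x c.
Proof.
move=> cn; rewrite /vilenkin_digit !modn_divl [(m c * _)%N]mulnC -vilenkin_baseS.
by rewrite modn_dvdm // dvdn_vilenkin_base.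
Qed.

Lemma eq_modn_digits n x y :
  (x %% M n == y %% M n)%N = all (fun c => digit x c == digit y c) (iota 0 n).
Proof.
apply/idP/idP.
  move=> /eqP e; apply/allP => c; rewrite mem_iota add0n /= => cn.
  by rewrite -(digit_modn x cn) e digit_modn.
elim: n => [|n IH]; first by rewrite vilenkin_base0 !modn1.
rewrite -addn1 iotaD all_cat /= andbT add0n addn1 => /andP[/IH/eqP e /eqP d].
by rewrite !modn_vilenkin_baseS e d.
Qed.

Lemma eq_modnP n x y :
  reflect (forall c, (c < n)%N -> digit x c = digit y c) (x %% M n == y %% M n)%N.
Proof.
rewrite eq_modn_digits; apply: (iffP allP) => H c.
  by move=> cn; apply/eqP/H; rewrite mem_iota.
by rewrite mem_iota add0n /= => cn; rewrite H.
Qed.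

Lemma digit_small x c : (x < M c)%N -> digit x c = 0%N.
Proof. by move=> xc; rewrite /vilenkin_digit divn_small // mod0n. Qed.

Lemma digit_small_le x k c : (x < M k)%N -> (k <= c)%N -> digit x c = 0%N.
Proof. by move=> xk kc; rewrite digit_small // (leq_trans xk) // leq_vilenkin_base. Qed.

Lemma digit_dvd H i c : (M i %| H)%N -> (c < i)%N -> digit H c = 0%N.
Proof.
by move=> /eqP e ci; rewrite -(digit_modn _ ci) e /vilenkin_digit div0n mod0n.
Qed.

Lemma digitD_lt H t i c : (M i %| H)%N -> (c < i)%N ->
  digit (H + t) c = digit t c.
Proof.
move=> /eqP e ci; rewrite -(digit_modn _ ci) -modnDml e add0n.
by rewrite digit_modn.
Qed.

(** No carry occurs when a number below [M i] is added to a multiple of [M i]. Together with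
    [digitD_lt] this makes characters multiplicative over blocks. *)
Lemma digitD_ge H t i c : (M i %| H)%N -> (t < M i)%N -> (i <= c)%N ->
  digit (H + t) c = digit H c.
Proof.
move=> /dvdnP[h ->] ti ic; rewrite /vilenkin_digit; congr (_ %% _)%N.
have /dvdnP[d ->] := dvdn_vilenkin_base ic.
rewrite [(d * _)%N]mulnC !divnMA mulnK ?vilenkin_base_gt0 //.
by rewrite divnMDl ?vilenkin_base_gt0 // [(t %/ _)%N]divn_small // addn0.
Qed.

Lemma digit_mul b k : (b < m k)%N -> digit (b * M k) k = b.
Proof. by move=> bk; rewrite /vilenkin_digit mulnK ?vilenkin_base_gt0 // modn_small. Qed.

Lemma digit_rec x b k : (x < M k)%N -> (b < m k)%N -> digit (b * M k + x) k = b.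
Proof. by move=> xk bk; rewrite (@digitD_ge _ _ k) ?dvdn_mull // digit_mul. Qed.

Lemma sum_blocks (V : nmodType) (F : nat -> V) a b :
  \sum_(0 <= y < a * b) F y = \sum_(0 <= t < a) \sum_(0 <= e < b) F (t * b + e)%N.
Proof.
elim: a => [|a IH]; first by rewrite mul0n !big_geq.
rewrite big_nat_recr //= -IH mulSn addnC (big_cat_nat _ (n := (a * b)%N)) ?leq_addr //=.
congr (_ + _); rewrite -{1}[(a * b)%N]add0n big_addn.
by rewrite addKn; apply: eq_bigr => e _; rewrite addnC.
Qed.

Lemma sum_split_base (V : nmodType) (F : nat -> V) k n : (k <= n)%N ->
  \sum_(0 <= y < M n) F y =
  \sum_(0 <= t < M n %/ M k) \sum_(0 <= e < M k) F (t * M k + e)%N.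
Proof. by move=> kn; rewrite -sum_blocks divnK // dvdn_vilenkin_base. Qed.

Lemma sum_baseS (V : nmodType) (F : nat -> V) k :
  \sum_(0 <= y < M k.+1) F y =
  \sum_(0 <= b < m k) \sum_(0 <= e < M k) F (b * M k + e)%N.
Proof. by rewrite -sum_blocks vilenkin_baseS mulnC. Qed.

End Digits.


(** * The modulus on [R[i]] *)

Section Normc.
Variable R : realType.
Implicit Types (z : R[i]) (r : R).
Local Notation nrm := (@Normc.normc R).

Lemma normc_ge0 z : 0 <= nrm z.
Proof. by case: z => a b; rewrite /nrm sqrtr_ge0. Qed.

Lemma normc_real r : nrm r%:C%C = `|r|.
Proof. by rewrite /nrm /= expr0n /= addr0 sqrtr_sqr. Qed.

Lemma normcX z n : nrm (z ^+ n) = nrm z ^+ n.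
Proof.
elim: n => [|n IH]; first by rewrite !expr0 Normc.normc1.
by rewrite !exprS Normc.normcM IH.
Qed.

Lemma normc_prod I (r : seq I) (P : pred I) (F : I -> R[i]) :
  nrm (\prod_(i <- r | P i) F i) = \prod_(i <- r | P i) nrm (F i).
Proof. exact: (big_morph _ (@Normc.normcM R) (Normc.normc1 R)). Qed.

Lemma normc_sum I (r : seq I) (P : pred I) (F : I -> R[i]) :
  nrm (\sum_(i <- r | P i) F i) <= \sum_(i <- r | P i) nrm (F i).
Proof.
elim/big_rec2: _ => [|i y x _ h]; first by rewrite Normc.normc0.
by rewrite (le_trans (le_normcD _ _)) // lerD2l.
Qed.

End Normc.

(** * Sums of characters with concave weights *)

Section Kernel.
Variables (R : realType) (m : nat -> nat).
Hypothesis m_ge2 : forall n, (2 <= m n)%N.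
Local Notation nrm := (@Normc.normc R).
Local Notation M := (vilenkin_base m).
Local Notation digit := (vilenkin_digit m).

(** The roots [rho] stay abstract because they are used twice: the roots of one point give a
    character, the ratios of the roots of two points give the kernel. The fixed number [N] of
    factors serves all [j < M N] at once. *)
Definition root_char (rho : nat -> R[i]) (N j : nat) : R[i] :=
  \prod_(c < N) rho c ^+ digit j c.

Variables (rho : nat -> R[i]) (N : nat).
Hypothesis rho_unity : forall c, rho c ^+ m c = 1.
Hypothesis rho_norm : forall c, nrm (rho c) = 1.
Local Notation w := (root_char rho N).

Lemma root_char_norm j : nrm (w j) = 1.
Proof.
by rewrite normc_prod big1 // => c _; rewrite normcX rho_norm expr1n.
Qed.

Lemma root_charD H t i : (M i %| H)%N -> (t < M i)%N -> w (H + t) = w H * w t.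
Proof.
move=> iH ti; rewrite -big_split /=; apply: eq_bigr => c _.
case: (ltnP c i) => ci.
  by rewrite (digitD_lt _ iH ci) (digit_dvd iH ci) expr0 mul1r.
by rewrite (digitD_ge m_ge2 iH ti ci) (digit_small_le m_ge2 ti ci) expr0 mulr1.
Qed.

Lemma root_char_top k b : (k < N)%N -> (b < m k)%N -> w (b * M k) = rho k ^+ b.
Proof.
move=> kN bk; rewrite /root_char (bigD1 (Ordinal kN)) //= digit_mul // big1 ?mulr1 //.
move=> c /eqP ck; case: (ltngtP c k) => ckk; last by case: ck; exact/val_inj.
  by rewrite (digit_dvd _ ckk) // dvdn_mull.
rewrite (digit_small_le (k := k.+1) m_ge2 _ ckk) //.
by rewrite vilenkin_baseS mulnC ltn_mul2l vilenkin_base_gt0.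
Qed.

Lemma sum_unity_root k : rho k != 1 -> \sum_(0 <= b < m k) rho k ^+ b = 0.
Proof.
move=> rk; have /eqP := subrX1 (rho k) (m k).
rewrite rho_unity subrr eq_sym mulf_eq0 subr_eq0 (negbTE rk) /= => /eqP.
by rewrite big_mkord.
Qed.

Lemma le_partial (k n : nat) (F : nat -> R) : (forall j, 0 <= F j) -> (k <= n)%N ->
  \sum_(0 <= j < k) F j <= \sum_(0 <= j < n) F j.
Proof.
by move=> F0 kn; rewrite [leRHS](big_cat_nat _ (n := k)) //= lerDl sumr_ge0.
Qed.

(* Subtracting [lam t] from each of the [m k] translates costs nothing because
   the powers of [rho k] sum to zero. *)
Lemma block_sum_centered (lam : nat -> R) k : (k < N)%N -> rho k != 1 ->
  \sum_(0 <= t < M k.+1) (lam t)%:C%C * w t =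
  \sum_(0 <= b < m k) rho k ^+ b *
    \sum_(0 <= t < M k) (lam (b * M k + t)%N - lam t)%:C%C * w t.
Proof.
move=> kN rk; rewrite sum_baseS //.
transitivity (\sum_(0 <= b < m k) rho k ^+ b *
    \sum_(0 <= t < M k) (lam (b * M k + t)%N)%:C%C * w t).
  rewrite !big_nat; apply: eq_bigr => b /= bk; rewrite mulr_sumr !big_nat.
  apply: eq_bigr => t /= tk.
  by rewrite (root_charD (i := k)) ?dvdn_mull // root_char_top // mulrCA.
apply/eqP; rewrite -subr_eq0 -sumrB.
under eq_bigr => b _ do rewrite -mulrBr -sumrB.
under eq_bigr => b _ do under eq_bigr => t _ do
  rewrite -mulrBl -rmorphB opprB addrC subrK.
by rewrite -mulr_suml sum_unity_root // mul0r.
Qed.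

(** After centring, each of the [M k.+1] terms is at most the total drop of [lam] over the block. A
    bound by a drop is kept because drops telescope over consecutive blocks. *)
Lemma first_block (lam : nat -> R) k : (k < N)%N ->
  (forall c, (c < k)%N -> rho c = 1) -> rho k != 1 ->
  {homo lam : i j / (i <= j)%N >-> j <= i} ->
  nrm (\sum_(0 <= t < M k.+1) (lam t)%:C%C * w t) <=
  (M k.+1)%:R * (lam 0%N - lam (M k.+1)).
Proof.
move=> kN h rk ni; rewrite block_sum_centered //.
apply: le_trans (normc_sum _ _ _) _.
have -> : (M k.+1)%:R * (lam 0%N - lam (M k.+1)) =
    \sum_(0 <= b < m k) \sum_(0 <= t < M k) (lam 0%N - lam (M k.+1)).
  by rewrite !sumr_const_nat !subn0 vilenkin_baseS -mulrnA mulr_natl mulnC.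
rewrite !big_nat; apply: ler_sum => b /= bk; rewrite Normc.normcM normcX rho_norm.
rewrite expr1n mul1r; apply: le_trans (normc_sum _ _ _) _.
rewrite !big_nat; apply: ler_sum => t /= tk.
rewrite Normc.normcM root_char_norm mulr1 normc_real distrC ger0_norm; last first.
  by rewrite subr_ge0 ni // leq_addl.
apply: lerB; apply: ni => //.
rewrite vilenkin_baseS mulnC.
have : (b.+1 * M k <= m k * M k)%N by rewrite leq_mul2r bk orbT.
by lia.
Qed.

(** Each block starts at a multiple of [M k.+1], so its character factors out with modulus 1. The
    drops telescope, which is why the number [S] of blocks does not multiply the bound. *)
Lemma first_blocks (lam : nat -> R) k H S : (k < N)%N ->
  (forall c, (c < k)%N -> rho c = 1) -> rho k != 1 ->
  {homo lam : i j / (i <= j)%N >-> j <= i} -> (M k.+1 %| H)%N ->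
  nrm (\sum_(0 <= t < S * M k.+1) (lam t)%:C%C * w (H + t)) <=
  (M k.+1)%:R * (lam 0%N - lam (S * M k.+1)%N).
Proof.
move=> kN h rk ni dH; rewrite sum_blocks.
elim: S => [|S IH]; first by rewrite big_geq // Normc.normc0 mul0n subrr mulr0.
rewrite big_nat_recr //= (le_trans (le_normcD _ _)) //.
have -> : lam 0%N - lam (S.+1 * M k.+1)%N = lam 0%N - lam (S * M k.+1)%N +
  (lam (S * M k.+1)%N - lam (S.+1 * M k.+1)%N) by ring.
rewrite mulrDr lerD //.
have -> : \sum_(0 <= e < M k.+1) (lam (S * M k.+1 + e)%N)%:C%C *
    w (H + (S * M k.+1 + e)) = w (H + S * M k.+1) *
    \sum_(0 <= e < M k.+1) (lam (S * M k.+1 + e)%N)%:C%C * w e.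
  rewrite mulr_sumr !big_nat; apply: eq_bigr => e /= ek.
  by rewrite addnA (root_charD (i := k.+1)) ?dvdn_add ?dvdn_mull // mulrCA.
rewrite Normc.normcM root_char_norm mul1r.
have := @first_block (fun e => lam (S * M k.+1 + e)%N) k kN h rk.
rewrite addn0 -mulSnr; apply=> i j ij.
by rewrite ni // leq_add2l.
Qed.

(** Concavity is asked for every lag [h], since it is applied with the lags [M l] and [b * M l] and
    never with unit steps. *)
Definition concave_seq (lam : nat -> R) := forall h,
  {homo (fun j => lam j - lam (j + h)%N) : i j / (i <= j)%N >-> i <= j}.

(* Subtracting the first of the [m l] translates leaves the sequence
   [lam (b * M l + j) - lam j], which is nonincreasing by concavity, so that
   [first_blocks] applies to it. *)
Lemma second_blocks (lam : nat -> R) k l S : (k < l)%N -> (l < N)%N ->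
  (forall c, (c < l)%N -> c != k -> rho c = 1) -> rho k != 1 -> rho l != 1 ->
  concave_seq lam ->
  nrm (\sum_(0 <= t < S * M l.+1) (lam t)%:C%C * w t) <=
  (m l * M k.+1)%:R * ((lam (S * M l.+1)%N - lam (S * M l.+1 + M l)%N)
                       - (lam 0%N - lam (M l))).
Proof.
move=> kl lN h rk rl cc; rewrite sum_blocks.
have h' c : (c < k)%N -> rho c = 1.
  by move=> ck; apply: h; [exact: ltn_trans kl|rewrite neq_ltn ck].
have kN : (k < N)%N by exact: ltn_trans lN.
elim: S => [|S IH]; first by rewrite big_geq // Normc.normc0 mul0n add0n subrr mulr0.
rewrite big_nat_recr //= (le_trans (le_normcD _ _)) //.
set W := fun j => lam j - lam (j + M l)%N.
have -> : lam (S.+1 * M l.+1)%N - lam (S.+1 * M l.+1 + M l)%N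
   - (lam 0%N - lam (M l)) =
  (lam (S * M l.+1)%N - lam (S * M l.+1 + M l)%N - (lam 0%N - lam (M l))) +
  (W (S.+1 * M l.+1)%N - W (S * M l.+1)%N) by rewrite /W; ring.
rewrite mulrDr lerD //.
have -> : \sum_(0 <= e < M l.+1) (lam (S * M l.+1 + e)%N)%:C%C *
    w (S * M l.+1 + e) = w (S * M l.+1) *
    \sum_(0 <= e < M l.+1) (lam (S * M l.+1 + e)%N)%:C%C * w e.
  rewrite mulr_sumr !big_nat; apply: eq_bigr => e /= ek.
  by rewrite (root_charD (i := l.+1)) ?dvdn_mull // mulrCA.
rewrite Normc.normcM root_char_norm mul1r block_sum_centered //.
apply: le_trans (normc_sum _ _ _) _.
have -> : (m l * M k.+1)%:R * (W (S.+1 * M l.+1)%N - W (S * M l.+1)%N) =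
    \sum_(0 <= b < m l) ((M k.+1)%:R * (W (S.+1 * M l.+1)%N - W (S * M l.+1)%N)).
  by rewrite sumr_const_nat subn0 -[RHS]mulr_natl natrM mulrA.
rewrite !big_nat; apply: ler_sum => b /= bl; rewrite Normc.normcM normcX rho_norm.
rewrite expr1n mul1r.
(* As [k < l], the length [M l] is an exact multiple of [M k.+1], so no incomplete block is left
   over. *)
have fb := @first_blocks _ k 0%N (M l %/ M k.+1)%N kN h' rk _ (dvdn0 _).
rewrite divnK ?dvdn_vilenkin_base // in fb.
apply: le_trans (fb _ _) _ => /= [i j ij|].
  (* Concavity with lag [b * M l] is the monotonicity that [first_blocks] requires. *)
  have := cc (b * M l)%N (S * M l.+1 + i)%N (S * M l.+1 + j)%N.
  rewrite leq_add2l => /(_ ij) /=.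
  by rewrite ![(S * M l.+1 + _ + b * M l)%N]addnAC !addnA; lra.
rewrite ler_wpM2l ?ler0n // !addn0.
(* Concavity with lag [M l] moves the right end from the [b]-th translate to the end of the block;
   the bound becomes independent of [b] and telescopes in [S]. *)
have := cc (M l) (S * M l.+1 + b * M l)%N (S.+1 * M l.+1)%N.
have bd : (S * M l.+1 + b * M l <= S.+1 * M l.+1)%N.
  by rewrite mulSnr leq_add2l vilenkin_baseS mulnC leq_mul2l (ltnW bl) orbT.
by move=> /(_ bd) /=; rewrite /W !addnA; lra.
Qed.

Lemma first_such (P : pred nat) s :
  (exists k, [/\ (k < s)%N, P k & forall c, (c < k)%N -> ~~ P c]) \/
  (forall c, (c < s)%N -> ~~ P c).
Proof.
have [h|h] := boolP (has P (iota 0 s)).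
  left; have ex : exists k, (k < s)%N && P k.
    by case/hasP: h => k; rewrite mem_iota add0n /= => ks Pk; exists k; rewrite ks.
  case: (ex_minnP ex) => k /andP[ks Pk] min; exists k; split => // c ck.
  apply/negP => Pc; have := min c; rewrite Pc (ltn_trans ck ks) => /(_ isT).
  by rewrite leqNgt ck.
by right => c cs; apply: (hasPn h); rewrite mem_iota.
Qed.

Lemma ltn_vilenkin_base k n : (k < n)%N -> (M k < M n)%N.
Proof.
move=> kn; apply: leq_trans (leq_vilenkin_base m_ge2 kn).
by rewrite vilenkin_baseS ltn_Pmulr // vilenkin_base_gt0.
Qed.

(** * The reversed weights and the bound of the kernel *)

Variable q : nat -> R.
Hypothesis q_ge0 : forall n, 0 <= q n.
Hypothesis q_ni : nonincreasing_seq q.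
Local Notation Q := (weight_sum q).

Lemma weight_sumS n : Q n.+1 = Q n + q n.
Proof. by rewrite /weight_sum big_nat_recr. Qed.

Lemma weight_sum_ge0 n : 0 <= Q n.
Proof. exact: sumr_ge0. Qed.

Lemma weight_sum_le a b : (a <= b)%N -> Q a <= Q b.
Proof. exact: le_partial. Qed.

Lemma weight_sumD a b : Q (a + b)%N <= Q a + Q b.
Proof.
elim: b => [|b IH]; first by rewrite addn0 lerDl weight_sum_ge0.
by rewrite addnS !weight_sumS addrA lerD // q_ni // leq_addl.
Qed.

Lemma weight_sumM c a : Q (c * a)%N <= c%:R * Q a.
Proof.
elim: c => [|c IH]; first by rewrite !mul0n mul0r /weight_sum big_geq.
by rewrite mulSn (le_trans (weight_sumD _ _)) // -natr1 mulrDl mul1r addrC lerD.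
Qed.

(* The truncated subtraction makes the weight constant, equal to [q 0], beyond
   [n], so that the sequence is concave and nonincreasing on all of [nat]. *)
Definition reversed_weight n j : R := Q n - \sum_(0 <= u < j) q (n - 1 - u)%N.

Lemma reversed_weightE n j : (j <= n)%N -> reversed_weight n j = Q (n - j)%N.
Proof.
elim: j => [|j IH] jn; first by rewrite /reversed_weight big_geq // subr0 subn0.
move: (IH (ltnW jn)); rewrite /reversed_weight big_nat_recr //= opprD addrA => ->.
have -> : (n - j = (n - j.+1).+1)%N by rewrite subnSK.
by rewrite weight_sumS subnAC subn1 -subnS addrK.
Qed.

Lemma reversed_weight_ni n :
  {homo reversed_weight n : i j / (i <= j)%N >-> j <= i}.
Proof. by move=> i j ij; rewrite lerD2l lerN2 le_partial. Qed.

Lemma reversed_weight_concave n : concave_seq (reversed_weight n).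
Proof.
move=> h i j ij /=; rewrite /reversed_weight.
(* A lag difference is the sum of [q] over a window of length [h]. Moving the window to the right
   lowers the arguments of [q], hence raises the sum. *)
suff D k : Q n - \sum_(0 <= u < k) q (n - 1 - u)%N -
    (Q n - \sum_(0 <= u < k + h) q (n - 1 - u)%N) =
    \sum_(0 <= u < h) q (n - 1 - (k + u))%N.
  by rewrite !D; apply: ler_sum => u _; apply: q_ni; lia.
rewrite (big_cat_nat _ (n := k) (p := (k + h)%N)) ?leq_addr //=.
rewrite -{3}[k]add0n big_addn addKn.
rewrite [RHS](eq_bigr (fun u => q (n - 1 - (u + k))%N)) => [|u _]; first by ring.
by rewrite addnC.
Qed.

(** Only the cancellation in digit [k] is used here. The complete blocks are covered by
    [first_blocks], the incomplete last one by its fewer than [M k.+1] terms, each at most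
    [Q (n - H)]; hence the 2. With [H = 0] it treats points without a second index, otherwise the
    remainder after [second_blocks]. *)
Lemma tail_bound n k H : (k < N)%N -> (forall c, (c < k)%N -> rho c = 1) ->
  rho k != 1 -> (M k.+1 %| H)%N -> (H <= n)%N ->
  nrm (\sum_(0 <= t < n - H) (reversed_weight n (H + t))%:C%C * w (H + t)) <=
  2 * (M k.+1)%:R * Q (n - H)%N.
Proof.
move=> kN h rk dH Hn; set r := (n - H)%N; set S := (r %/ M k.+1)%N.
have Sr : (S * M k.+1 <= r)%N by exact: leq_divM.
rewrite (big_cat_nat _ (n := (S * M k.+1)%N)) //= (le_trans (le_normcD _ _)) //.
have -> : 2 * (M k.+1)%:R * Q r = (M k.+1)%:R * Q r + (M k.+1)%:R * Q r by ring.
apply: lerD.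
  apply: le_trans (first_blocks (lam := fun t => reversed_weight n (H + t)%N) S _ h _ _ dH) _ => //.
    by move=> i j ij; rewrite reversed_weight_ni // leq_add2l.
  rewrite ler_wpM2l ?ler0n // addn0 reversed_weightE // lerBlDr lerDl.
  by rewrite reversed_weightE ?weight_sum_ge0 // /r in Sr *; lia.
apply: le_trans (normc_sum _ _ _) _.
have -> : (M k.+1)%:R * Q r = \sum_(0 <= t < M k.+1) Q r.
  by rewrite sumr_const_nat subn0 -[RHS]mulr_natl.
apply: (@le_trans _ _ (\sum_(S * M k.+1 <= t < r) Q r)).
  rewrite !big_nat; apply: ler_sum => t /andP[_ tr].
  rewrite Normc.normcM root_char_norm mulr1 normc_real reversed_weightE; last first.
    by rewrite /r in tr; lia.
  by rewrite ger0_norm ?weight_sum_ge0 // weight_sum_le // /r; lia.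
rewrite !sumr_const_nat subn0 ler_wpMn2l ?weight_sum_ge0 //.
by rewrite /S; have := ltn_mod r (M k.+1); rewrite (vilenkin_base_gt0 m_ge2) {2}(divn_eq r (M k.+1)) addKn => /ltnW.
Qed.

(* [k] and [l] are the first two indices at which [rho] differs from [1], cut off
   at [s]. *)
Lemma kernel_bound n s B : (forall c, (m c <= B)%N) -> (M s <= n < M s.+1)%N ->
  (n <= M N)%N ->
  exists k l, [/\ (k <= l <= s)%N, forall c, (c < l)%N -> c != k -> rho c = 1 &
    nrm (\sum_(0 <= j < n) (Q (n - j)%N)%:C%C * w j) <=
    (5 * B ^ 2)%:R * (M k)%:R * Q (M l)].
Proof.
move=> mB /andP[sn nS] nN.
have sN : (s <= N)%N.
  by rewrite leqNgt; apply/negP => /ltn_vilenkin_base; lia.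
have B0 : (0 < B)%N by apply: leq_trans (mB 0%N); apply: leq_trans (m_ge2 0%N).
have QnB : Q n <= B%:R * Q (M s).
  apply: le_trans (weight_sumM _ _).
  rewrite weight_sum_le // (leq_trans (ltnW nS)) // vilenkin_baseS mulnC.
  by rewrite leq_mul2r mB orbT.
have MB k : (M k.+1)%:R <= B%:R * (M k)%:R :> R.
  by rewrite -natrM ler_nat vilenkin_baseS mulnC leq_mul2r mB orbT.
have -> : \sum_(0 <= j < n) (Q (n - j)%N)%:C%C * w j =
    \sum_(0 <= j < n) (reversed_weight n j)%:C%C * w j.
  rewrite !big_nat; apply: eq_bigr => j /= jn.
  by rewrite reversed_weightE // ltnW.
(* If no index below [s] is active there is no cancellation to use, and [n * Q n] is already of the
   order of [M s * Q (M s)]. *)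
have [[k [ks rk h]]|h] := first_such (fun c => rho c != 1) s; last first.
  exists s, s; split=> [|c cs _|]; first by rewrite !leqnn.
    by apply/eqP; rewrite -[_ == _]negbK; exact: h.
  apply: le_trans (normc_sum _ _ _) _.
  apply: (@le_trans _ _ (\sum_(0 <= j < n) Q n)).
    rewrite !big_nat; apply: ler_sum => j /= jn.
    rewrite Normc.normcM root_char_norm mulr1 normc_real reversed_weightE ?(ltnW jn) //.
    by rewrite ger0_norm ?weight_sum_ge0 // weight_sum_le // leq_subr.
  rewrite sumr_const_nat subn0 -[_ *+ n]mulr_natl.
  have nB : n%:R <= B%:R * (M s)%:R :> R.
    by apply: le_trans (MB s); rewrite ler_nat ltnW.
  apply: le_trans (ler_pM _ _ nB QnB) _; rewrite ?ler0n ?weight_sum_ge0 //.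
  rewrite natrM natrX.
  have : 0 <= B%:R ^+ 2 * ((M s)%:R * Q (M s)).
    by rewrite mulr_ge0 ?exprn_ge0 ?mulr_ge0 ?ler0n ?weight_sum_ge0.
  by lra.
have kN : (k < N)%N by exact: leq_trans sN.
have h1 c : (c < k)%N -> rho c = 1.
  by move=> ck; apply/eqP; rewrite -[_ == _]negbK h.
have [[l [ls /andP[lk rl] h']]|h'] :=
    first_such (fun c => (c != k) && (rho c != 1)) s; last first.
  exists k, s; split=> [|c cs ck|]; first by rewrite (ltnW ks) leqnn.
    by apply/eqP; rewrite -[_ == _]negbK; have := h' c cs; rewrite ck.
  have := @tail_bound n k 0%N kN h1 rk (dvdn0 _) (leq0n _); rewrite subn0.
  move=> /le_trans; apply.
  apply: (@le_trans _ _ (2 * (B%:R * (M k)%:R) * (B%:R * Q (M s)))).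
    by rewrite ler_pM ?mulr_ge0 ?ler0n ?weight_sum_ge0 // ler_wpM2l.
  rewrite natrM natrX.
  have : 0 <= B%:R ^+ 2 * ((M k)%:R * Q (M s)).
    by rewrite mulr_ge0 ?exprn_ge0 ?mulr_ge0 ?ler0n ?weight_sum_ge0.
  by lra.
have h2 c : (c < l)%N -> c != k -> rho c = 1.
  by move=> cl ck; apply/eqP; rewrite -[_ == _]negbK; have := h' c cl; rewrite ck.
have kl : (k < l)%N.
  by rewrite ltn_neqAle eq_sym lk leqNgt; apply/negP => /h1/eqP; apply/negP.
exists k, l; split=> //; first by rewrite (ltnW kl) ltnW.
have lN : (l < N)%N by exact: leq_trans sN.
have ln : (M l <= n)%N by apply: leq_trans sn; exact/leq_vilenkin_base/ltnW.
(* Dividing [n - M l] and not [n] ensures [H + M l <= n], so both weights at the right end are true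
   values of [Q]. The remainder is still shorter than [M l + M l.+1]. *)
pose S := ((n - M l) %/ M l.+1)%N; pose H := (S * M l.+1)%N.
have Hn : (H <= n - M l)%N by exact: leq_divM.
have rn : (n - H < M l + M l.+1)%N.
  have := ltn_ceil (n - M l) (vilenkin_base_gt0 m_ge2 l.+1).
  by rewrite -/S mulSn -/H; lia.
rewrite (big_cat_nat _ (n := H)) //=; last by lia.
have cc := @reversed_weight_concave n.
apply: le_trans (le_normcD _ _) _.
have b1 := second_blocks S kl lN h2 rk rl cc; rewrite -/H in b1.
have b2 : nrm (\sum_(H <= t < n) (reversed_weight n t)%:C%C * w t) <=
    2 * (M k.+1)%:R * Q (n - H)%N.
  rewrite -{1}[H]add0n big_addn.
  under eq_bigr => t _ do rewrite addnC.
  apply: tail_bound => //; last by lia.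
  by rewrite dvdn_mull // dvdn_vilenkin_base // ltnW.
have b3 : Q (n - H)%N <= (1 + B%:R) * Q (M l).
  apply: le_trans (weight_sum_le (ltnW rn)) _.
  apply: le_trans (weight_sumD _ _) _; rewrite mulrDl mul1r lerD2l.
  by apply: le_trans (weight_sumM _ _); rewrite weight_sum_le // vilenkin_baseS mulnC leq_mul2r mB orbT.
have b4 : reversed_weight n H - reversed_weight n (H + M l) -
   (reversed_weight n 0 - reversed_weight n (M l)) <= Q (M l).
  have := @reversed_weight_ni n 0 (M l) (leq0n _).
  rewrite [reversed_weight n H]reversed_weightE; last by lia.
  rewrite [reversed_weight n (H + M l)]reversed_weightE; last by lia.
  have := weight_sumD (n - (H + M l)) (M l).
  have -> : (n - (H + M l) + M l = n - H)%N by lia.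
  by lra.
apply: le_trans (lerD b1 b2) _.
have b5 : (m l * M k.+1)%:R <= B%:R * (B%:R * (M k)%:R) :> R.
  by rewrite natrM ler_pM ?ler0n // ler_nat.
have Qp := weight_sum_ge0 (M l).
have c1 : (m l * M k.+1)%:R * Q (M l) <= B%:R * (B%:R * (M k)%:R) * Q (M l).
  exact: ler_wpM2r.
have c2 : (M k.+1)%:R * Q (n - H)%N <= B%:R * (M k)%:R * ((1 + B%:R) * Q (M l)).
  by rewrite ler_pM ?ler0n ?weight_sum_ge0.
have c3 := ler_wpM2l (ler0n R (m l * M k.+1)) b4.
have B1 : 1 <= B%:R :> R by rewrite ler1n.
have c4 : B%:R * ((M k)%:R * Q (M l)) <= B%:R ^+ 2 * ((M k)%:R * Q (M l)).
  by rewrite ler_wpM2r ?mulr_ge0 ?ler0n // expr2 ler_peMl // ler0n.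
(* The complete blocks give [B ^ 2] and the tail [2 * B * (1 + B)], which is at most [4 * B ^ 2]. *)
have -> : (5 * B ^ 2)%:R = 5 * B%:R ^+ 2 :> R by rewrite natrM natrX.
lra.
Qed.

End Kernel.


(** * Power functions and the growth of the weights *)

Section RealAnalysis.
Variable R : realType.
Implicit Types (x y a p : R).

(** Young's inequality with the conjugate exponents 1/a and 1/(1-a), applied to (1-u)^a and 1. *)
Lemma powR_bernoulli u a : 0 <= u <= 1 -> 0 < a < 1 -> (1 - u) `^ a <= 1 - a * u.
Proof.
move=> /andP[u0 u1] /andP[a0 a1].
have an : a != 0 by rewrite gt_eqF.
have bn : 1 - a != 0 by rewrite subr_eq0 gt_eqF.
have := @conjugate_powR R ((1 - u) `^ a) 1 a^-1 (1 - a)^-1 (powR_ge0 _ _) ler01.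
rewrite !invr_gt0 a0 subr_gt0 a1 !invrK => /(_ isT isT).
rewrite -powRrM mulfV // powRr1 ?subr_ge0 // powR1 mulr1.
have -> : a + (1 - a) = 1 by ring.
by move=> /(_ erefl); lra.
Qed.

(** A number of [0, 1] is at most its p-th power. This is applied to the fractions x/(x+y) and
    y/(x+y), which add up to 1. *)
Lemma ge0_powRD p x y : 0 < p <= 1 -> 0 <= x -> 0 <= y ->
  (x + y) `^ p <= x `^ p + y `^ p.
Proof.
move=> /andP[p0 p1] x0 y0.
have [xy|xy] := eqVneq (x + y) 0.
  by rewrite xy powR0 ?gt_eqF // addr_ge0 // powR_ge0.
have s0 : 0 < x + y by rewrite lt_neqAle eq_sym xy addr_ge0.
have H z : 0 <= z -> z <= x + y -> z / (x + y) * (x + y) `^ p <= z `^ p.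
  move=> z0 zs; have [->|zn] := eqVneq z 0; first by rewrite mul0r mul0r powR_ge0.
  rewrite -{2}[z](divfK xy) powRM ?divr_ge0 ?(ltW s0) //.
  rewrite ler_wpM2r ?powR_ge0 // ger1_powR // ler_pdivrMr // mul1r zs andbT.
  by rewrite divr_gt0 // lt_neqAle eq_sym zn.
apply: le_trans (lerD (H _ x0 _) (H _ y0 _)); rewrite ?lerDl ?lerDr //.
by rewrite -mulrDl -mulrDl divff // mul1r.
Qed.

Lemma ge0_powR_sum p (I : Type) (r : seq I) (P : pred I) (F : I -> R) :
  0 < p <= 1 -> (forall i, 0 <= F i) ->
  (\sum_(i <- r | P i) F i) `^ p <= \sum_(i <- r | P i) F i `^ p.
Proof.
move=> hp F0; elim: r => [|i r IH].
  by rewrite !big_nil powR0 // gt_eqF //; case/andP: hp.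
rewrite !big_cons; case: ifP => // _.
apply: le_trans (ge0_powRD hp _ _) _ => //; first exact: sumr_ge0.
by rewrite lerD2l.
Qed.

Lemma sum_geometric_increasing (u : nat -> R) (c : R) n : 0 <= c < 1 ->
  (forall l, 0 <= u l) -> (forall l, u l <= c * u l.+1) ->
  \sum_(0 <= l < n.+1) u l <= (1 - c)^-1 * u n.
Proof.
move=> /andP[c0 c1] u0 uc; have d0 : 0 < 1 - c by rewrite subr_gt0.
rewrite mulrC ler_pdivlMr //; elim: n => [|n IH].
  by rewrite big_nat1 ler_piMr // lerBlDr lerDl.
rewrite big_nat_recr //= mulrDl; apply: le_trans (lerD IH (lexx _)) _.
by have := uc n; lra.
Qed.

Lemma sum_geometric_decreasing (u : nat -> R) (c : R) k n : 0 <= c < 1 ->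
  (forall l, 0 <= u l) -> (forall l, u l.+1 <= c * u l) ->
  \sum_(k <= l < n) u l <= (1 - c)^-1 * u k.
Proof.
move=> /andP[c0 c1] u0 uc; have d0 : 0 < 1 - c by rewrite subr_gt0.
rewrite mulrC ler_pdivlMr //.
have [kn|nk] := leqP k n; last by rewrite big_geq ?mul0r // ltnW.
suff: (\sum_(k <= l < n) u l) * (1 - c) <= u k - u n by have := u0 n; lra.
rewrite -(subnKC kn); elim: (n - k)%N => [|i IH].
  by rewrite addn0 big_geq // mul0r subrr.
rewrite addnS big_nat_recr ?leq_addr //= mulrDl; have := uc (k + i)%N; lra.
Qed.

Lemma sum_telescope_le (u v : nat -> R) k n : (k <= n)%N ->
  (forall i, (k <= i < n)%N -> u i <= v i - v i.+1) ->
  \sum_(k <= i < n) u i <= v k - v n.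
Proof.
move=> kn h; rewrite big_nat (le_trans (ler_sum _ h)) // -big_nat.
by rewrite -[leRHS]opprB -telescope_sumr // -sumrN; apply: ler_sum => i _; rewrite opprB.
Qed.

(** Discrete integration of t^(a-2), in a form that telescopes. Bernoulli with exponent 1-a at u =
    1/(j+1) gives 1/(j+1) where 1/j is wanted, and the factor 2 pays for the difference. *)
Lemma powR_decrement_lower a j : 0 < a < 1 -> (0 < j)%N ->
  j%:R `^ (a - 2) <= (2 / (1 - a)) * (j%:R `^ (a - 1) - j.+1%:R `^ (a - 1)).
Proof.
move=> /andP[a0 a1] j0; set b := 1 - a; have b0 : 0 < b by rewrite subr_gt0.
have j0' : 0 < j%:R :> R by rewrite ltr0n.
have jn : j%:R != 0 :> R by rewrite gt_eqF.
have u01 : 0 <= (j.+1%:R : R)^-1 <= 1.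
  by rewrite invr_ge0 ler0n /= invf_le1 ?ltr0n // ler1n.
have e : j%:R = j.+1%:R * (1 - j.+1%:R^-1) :> R.
  by rewrite mulrBr mulr1 divff ?pnatr_eq0 // -natr1 addrK.
have bern : (1 - (j.+1%:R : R)^-1) `^ b <= 1 - b * j.+1%:R^-1.
  by apply: powR_bernoulli => //; apply/andP; split => //; rewrite /b; lra.
have p1 : j%:R `^ (a - 1) = (j%:R `^ b)^-1 :> R by rewrite -powRN opprB.
have p2 : j%:R `^ (a - 2) = (j%:R `^ b)^-1 / j%:R :> R.
  have -> : a - 2 = - b - 1 by rewrite /b; ring.
  by rewrite powRB ?jn ?implybT // powRr1 ?ltW // powRN.
have p3 : j.+1%:R `^ (a - 1) = (j%:R `^ b)^-1 * (1 - j.+1%:R^-1) `^ b :> R.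
  rewrite e powRM ?ler0n //; last by rewrite subr_ge0; case/andP: u01.
  rewrite invfM -mulrA mulVf ?mulr1; first by rewrite -powRN opprB.
  rewrite powR_eq0 negb_and subr_eq0 eq_sym invr_eq1; apply/orP; left.
  by rewrite (eqr_nat R _ 1) eqSS -lt0n.
rewrite p1 p2 p3; set w := (j%:R `^ b)^-1.
have w0 : 0 < w by rewrite invr_gt0 powR_gt0.
have -> : 2 / b * (w - w * (1 - j.+1%:R^-1) `^ b) =
   w * (2 / b * (1 - (1 - j.+1%:R^-1) `^ b)) by ring.
rewrite ler_pM2l //.
have h1 : 2 / b * (b * j.+1%:R^-1) <= 2 / b * (1 - (1 - (j.+1%:R : R)^-1) `^ b).
  by rewrite ler_pM2l ?divr_gt0 // lerBrDr -lerBrDl.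
apply: le_trans h1.
have -> : 2 / b * (b * j.+1%:R^-1) = 2 / j.+1%:R by rewrite mulrA divfK // gt_eqF.
rewrite ler_pdivlMr ?ltr0n // mulrC ler_pdivrMr // -natrM ler_nat; lia.
Qed.

Lemma powR_decrement_upper a j : 0 < a < 1 -> (0 < j)%N ->
  j%:R `^ (a - 1) <= a^-1 * (j%:R `^ a - j.-1%:R `^ a).
Proof.
move=> /andP[a0 a1] j0; have j0' : 0 < j%:R :> R by rewrite ltr0n.
have jn : j%:R != 0 :> R by rewrite gt_eqF.
have e : j.-1%:R = j%:R * (1 - j%:R^-1) :> R.
  by rewrite mulrBr mulr1 divff ?gt_eqF // -[in RHS](prednK j0) -natr1 addrK.
have u01 : 0 <= (j%:R : R)^-1 <= 1.
  by rewrite invr_ge0 ler0n /= invf_le1 ?ltr0n // ler1n.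
rewrite e powRM ?ler0n //; last by rewrite subr_ge0; case/andP: u01.
rewrite powRB ?jn ?implybT // powRr1 ?ler0n // [leRHS]mulrC ler_pdivlMr //.
have -> : j%:R `^ a - j%:R `^ a * (1 - j%:R^-1) `^ a =
  j%:R `^ a * (1 - (1 - j%:R^-1) `^ a) by ring.
rewrite -mulrA ler_pM2l ?powR_gt0 //.
have := @powR_bernoulli (j%:R)^-1 a u01; rewrite a0 a1 => /(_ isT); lra.
Qed.

Lemma eqO_nat_bound (u : nat -> R) : u =O_\oo (fun=> 1 : R^o) ->
  exists C n0, forall n, (n0 <= n)%N -> u n <= C.
Proof.
move=> /eqOP [k [kreal h]].
have [n0 _ H] := h (k + 1) ltac:(by rewrite ltrDl ltr01).
exists (k + 1), n0 => n nn; apply: le_trans (ler_norm _) _.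
by have := H n nn; rewrite /= normr1 mulr1.
Qed.

Section WeightRatio.
Variables (alpha : R) (q : nat -> R).
Hypothesis alpha01 : 0 < alpha < 1.
Hypothesis q_ge0 : forall n, 0 <= q n.
Hypothesis q_ni : nonincreasing_seq q.
Hypothesis q0_gt0 : 0 < q 0%N.
Hypothesis Q_growth : (fun n : nat => n%:R `^ alpha / weight_sum q n : R^o)
        =O_\oo (fun=> 1 : R^o).
Hypothesis q_decrement :
      (fun n : nat => (q n - q n.+1) / n%:R `^ (alpha - 2) : R^o)
        =O_\oo (fun=> 1 : R^o).
Local Notation Q := (weight_sum q).

Lemma weight_sum_gt0 n : (0 < n)%N -> 0 < Q n.
Proof.
move=> n0; apply: lt_le_trans (weight_sum_le q_ge0 n0).
by rewrite /weight_sum big_nat1.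
Qed.

(** The finitely many [n] that the asymptotic bound misses are absorbed through [Q n >= q 0]. *)
Lemma weight_growth_all : exists2 C, 0 <= C & forall n, (0 < n)%N -> n%:R `^ alpha <= C * Q n.
Proof.
have [/andP[a0 a1] [C [n0 h]]] := (alpha01, eqO_nat_bound Q_growth).
have K0 : 0 <= n0%:R `^ alpha / q 0%N by rewrite divr_ge0 ?powR_ge0.
exists (`|C| + n0%:R `^ alpha / q 0%N) => [|n n1]; first by rewrite addr_ge0.
have Q0 := weight_sum_gt0 n1; rewrite mulrDl.
have [nn|nn] := leqP n0 n.
  rewrite -[leLHS]addr0 lerD ?mulr_ge0 ?(ltW Q0) ?invr_ge0 ?(ltW q0_gt0) ?powR_ge0 //.
  by have := h n nn; rewrite ler_pdivrMr // => /le_trans; apply; rewrite ler_wpM2r ?ler_norm // ltW.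
rewrite -[leLHS]add0r lerD ?mulr_ge0 ?(ltW Q0) ?invr_ge0 ?(ltW q0_gt0) ?powR_ge0 //.
rewrite mulrAC ler_pdivlMr // ler_pM ?powR_ge0 // ?(ltW q0_gt0) //.
  by rewrite ge0_ler_powR ?nnegrE ?ler0n ?(ltW a0) // ler_nat ltnW.
by have := weight_sum_le q_ge0 n1; rewrite {1}/weight_sum big_nat1.
Qed.

Lemma weight_decrement_all : exists2 C, 0 <= C &
  forall n, (0 < n)%N -> q n - q n.+1 <= C * n%:R `^ (alpha - 2).
Proof.
have [/andP[a0 a1] [C [n0 h]]] := (alpha01, eqO_nat_bound q_decrement).
(* The successor keeps [z] positive: [n0] may be 0, and a negative power of 0 is 0 for [powR]. *)
pose z : R := n0.+1%:R `^ (alpha - 2).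
have z0 : 0 < z by rewrite powR_gt0 ?ltr0n.
have K0 : 0 <= q 0%N / z by rewrite divr_ge0 ?(ltW z0) ?(ltW q0_gt0).
exists (`|C| + q 0%N / z) => [|n n1]; first by rewrite addr_ge0.
have p0 : 0 < n%:R `^ (alpha - 2) by rewrite powR_gt0 ?ltr0n.
rewrite mulrDl; have [nn|nn] := leqP n0 n.
  rewrite -[leLHS]addr0 lerD ?(mulr_ge0 K0) ?(ltW p0) //.
  by have := h n nn; rewrite ler_pdivrMr // => /le_trans; apply; rewrite ler_wpM2r ?ler_norm // ltW.
rewrite -[leLHS]add0r lerD ?mulr_ge0 ?(ltW p0) //.
rewrite mulrAC ler_pdivlMr // ler_pM ?subr_ge0 ?q_ni ?(ltW z0) //.
  by apply: le_trans (q_ni (leq0n n)); rewrite gerBl.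
rewrite /z -[alpha - 2]opprK powRN [leRHS]powRN lef_pV2 ?posrE ?powR_gt0 ?ltr0n //.
by rewrite ge0_ler_powR ?nnegrE ?ler0n ?ler_nat 1?ltnW 1?ltnW //; lra.
Qed.

(** The decrement hypothesis sees only differences, and [q] may have a positive limit, so the
    estimate has to be relative to [q n]. It holds because a multiple of i^(alpha-1) minus [q i] is
    nonincreasing. *)
Lemma weight_tail : exists2 C, 0 <= C & forall j n, (0 < j)%N -> (j <= n)%N ->
  q j - q n <= C * j%:R `^ (alpha - 1).
Proof.
have [/andP[a0 a1] [C C0 h]] := (alpha01, weight_decrement_all).
have D0 : 0 <= C * (2 / (1 - alpha)) by rewrite mulr_ge0 ?divr_ge0 ?subr_ge0 // ltW.
exists (C * (2 / (1 - alpha))) => // j n j0 jn.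
pose v i := C * (2 / (1 - alpha)) * i%:R `^ (alpha - 1) - q i.
suff H : 0 <= v j - v n.
  have : 0 <= C * (2 / (1 - alpha)) * n%:R `^ (alpha - 1) by rewrite mulr_ge0 ?powR_ge0.
  by rewrite /v in H; lra.
have := @sum_telescope_le (fun=> 0) v j n jn; rewrite big1 //; apply=> i /andP[ji _].
have i0 : (0 < i)%N by exact: leq_trans ji.
have := ler_wpM2l C0 (powR_decrement_lower alpha01 i0).
by have := h i i0; rewrite /v; lra.
Qed.

(** Splitting [q j] as [q n] plus a tail gives [Q a <= a * q n + D * a^alpha]. For the first term,
    [n * q n <= Q n] by monotonicity and a/n <= (a/n)^alpha; for the second, n^alpha is at most a
    multiple of [Q n] by the growth hypothesis. *)
Lemma weight_ratio : exists2 C, 0 <= C & forall a n : nat, (0 < a)%N -> (a <= n)%N ->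
  Q a <= C * (a%:R / n%:R) `^ alpha * Q n.
Proof.
have [/andP[a0 a1] [C1 C10 h1]] := (alpha01, weight_growth_all).
have [C3 C30 h3] := weight_tail.
pose D := q 0%N + C3 / alpha.
have D0 : 0 <= D by rewrite addr_ge0 ?divr_ge0 // ltW.
exists (1 + D * C1) => [|a n a_gt0 an]; first by rewrite addr_ge0 ?mulr_ge0.
have n_gt0 : (0 < n)%N by exact: leq_trans an.
have nR : 0 < n%:R :> R by rewrite ltr0n.
have aR : 0 < a%:R :> R by rewrite ltr0n.
have Qa : Q a <= a%:R * q n + D * a%:R `^ alpha.
  (* The weight [q 0] is kept apart because [weight_tail] starts at index 1. *)
  suff H k : (k < a)%N -> Q k.+1 <= k.+1%:R * q n + q 0%N + C3 / alpha * k%:R `^ alpha.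
    have := H a.-1; rewrite prednK // leqnn => /(_ isT) /le_trans; apply.
    rewrite -addrA lerD2l /D mulrDl lerD //.
      rewrite ler_peMr ?(ltW q0_gt0) // -[leLHS](powRr0 a%:R) ler_powR ?ler1n //.
      exact: ltW.
    rewrite ler_wpM2l ?divr_ge0 ?(ltW a0) // ge0_ler_powR ?nnegrE ?ler0n ?(ltW a0) //.
    by rewrite ler_nat leq_pred.
  elim: k => [|k IH] ka.
    rewrite /weight_sum big_nat1 powR0 ?gt_eqF // mulr0 addr0 mul1r lerDr.
    exact: q_ge0.
  rewrite weight_sumS.
  have := IH (ltnW ka); have := h3 k.+1 n (ltn0Sn _) ltac:(lia).
  have := ler_wpM2l C30 (powR_decrement_upper alpha01 (ltn0Sn k)).
  rewrite -[k.+2%:R]natr1 /=; set x := k.+1%:R `^ (alpha - 1).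
  by rewrite mulrA; lra.
have nq : n%:R * q n <= Q n.
  rewrite /weight_sum mulr_natl -[n in _ *+ n]subn0 -sumr_const_nat !big_nat.
  by apply: ler_sum => i /andP[_ /ltnW/q_ni].
set r := a%:R / n%:R.
have r0 : 0 < r by rewrite divr_gt0.
have r1 : r <= 1 by rewrite ler_pdivrMr // mul1r ler_nat.
have e1 : a%:R * q n <= r `^ alpha * Q n.
  have -> : a%:R * q n = r * (n%:R * q n) by rewrite mulrA divfK // gt_eqF.
  by rewrite ler_pM ?(ltW r0) ?mulr_ge0 ?ler0n // ger1_powR ?r0 ?(ltW a1).
have e2 : a%:R `^ alpha <= r `^ alpha * (C1 * Q n).
  rewrite -{1}[a%:R](divfK (lt0r_neq0 nR)) powRM ?divr_ge0 ?ler0n //.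
  by rewrite ler_wpM2l ?powR_ge0 // h1.
apply: le_trans Qa _; have := ler_wpM2l D0 e2; lra.
Qed.

End WeightRatio.

End RealAnalysis.


(** * Conditional expectations on residue classes *)

Section Averages.
Variable m : nat -> nat.
Hypothesis m_ge2 : forall n, (2 <= m n)%N.
Local Notation M := (vilenkin_base m).
Local Notation digit := (vilenkin_digit m).

(* A point of the group known up to level [N] is encoded by the natural number
   with the same digits, so that cylinders of level [n <= N] become residue
   classes modulo [M n]. *)
Definition near_level n (x y : nat) : bool := (x %% M n == y %% M n)%N.

Lemma near_level_refl n x : near_level n x x.
Proof. exact: eqxx. Qed.

Lemma near_level_sym n x y : near_level n x y = near_level n y x.
Proof. exact: eq_sym. Qed.

Lemma near_level_trans n x y z : near_level n x y -> near_level n y z -> near_level n x z.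
Proof. by move=> /eqP xy /eqP yz; apply/eqP; rewrite xy. Qed.

Lemma near_level_left n x y : near_level n x y -> near_level n x =1 near_level n y.
Proof. by move=> /eqP e z; rewrite /near_level e. Qed.

Lemma near_level_le n k x y : (n <= k)%N -> near_level k x y -> near_level n x y.
Proof.
move=> nk /eqP e; apply/eqP.
by rewrite -(modn_dvdm x (dvdn_vilenkin_base m nk)) e modn_dvdm // dvdn_vilenkin_base.
Qed.

Lemma near_level0 x y : near_level 0 x y.
Proof. by rewrite /near_level vilenkin_base0 !modn1. Qed.

Lemma near_level_mod n x : near_level n (x %% M n) x.
Proof. by rewrite /near_level modn_mod. Qed.

Definition of_level (V : Type) n (g : nat -> V) :=
  forall x y, near_level n x y -> g x = g y.

Lemma of_level_le V n k (g : nat -> V) : (n <= k)%N -> of_level n g -> of_level k g.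
Proof. by move=> nk h x y xy; apply: h; exact: near_level_le xy. Qed.

Lemma class_sum (V : nmodType) n N x (g : nat -> V) : (n <= N)%N ->
  \sum_(0 <= y < M N | near_level n x y) g y =
  \sum_(0 <= t < M N %/ M n) g (t * M n + x %% M n)%N.
Proof.
move=> nN; rewrite big_mkcond /= (sum_split_base m _ nN); apply: eq_bigr => t _.
have xl : (x %% M n < M n)%N by rewrite ltn_mod vilenkin_base_gt0.
rewrite big_mkord (bigD1 (Ordinal xl)) //= big1 => [|i ix].
  by rewrite /near_level modnMDl modn_mod eqxx addr0.
rewrite /near_level modnMDl [(i %% _)%N]modn_small // eq_sym.
by rewrite -[_ == _]/(i == Ordinal xl) (negbTE ix).
Qed.

Lemma class_sum_level (V : nmodType) n N x (g : nat -> V) : (n <= N)%N ->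
  (forall y, near_level n x y -> g y = g x) ->
  \sum_(0 <= y < M N | near_level n x y) g y = g x *+ (M N %/ M n).
Proof.
move=> nN gl; rewrite class_sum // -[X in _ *+ X]subn0 -sumr_const_nat.
apply: eq_bigr => t _; apply: gl.
by rewrite /near_level modnMDl modn_mod.
Qed.

Lemma class_sum_range (V : nmodType) n N (g : nat -> V) : (n <= N)%N ->
  \sum_(0 <= y < M N) g y =
  \sum_(0 <= e < M n) \sum_(0 <= y < M N | near_level n e y) g y.
Proof.
move=> nN; rewrite (sum_split_base m _ nN) exchange_big /= !big_nat.
apply: eq_bigr => e /= en; rewrite class_sum //; apply: eq_bigr => t _.
by rewrite modn_small.
Qed.

Section Field.
Variable F : numFieldType.
Implicit Types g h : nat -> F.

Definition level_mean N g : F := (M N)%:R^-1 * \sum_(0 <= y < M N) g y.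

Definition level_expect N n g x : F :=
  (M n)%:R / (M N)%:R * \sum_(0 <= y < M N | near_level n x y) g y.

Lemma base_neq0 n : (M n)%:R != 0 :> F.
Proof. by rewrite pnatr_eq0 -lt0n vilenkin_base_gt0. Qed.

Lemma base_div n N : (n <= N)%N -> (M N %/ M n)%:R = (M N)%:R / (M n)%:R :> F.
Proof.
move=> nN; apply: (mulIf (base_neq0 n)); rewrite divfK ?base_neq0 // -natrM.
by rewrite divnK // dvdn_vilenkin_base.
Qed.

Lemma level_expect_level N n g : of_level n (level_expect N n g).
Proof.
by move=> x y xy; congr (_ * _); apply: eq_bigl => z; exact: near_level_left.
Qed.

Lemma level_expect_id N n g : (n <= N)%N -> of_level n g -> level_expect N n g = g.
Proof.
move=> nN gl; apply/funext => x; rewrite /level_expect class_sum_level //; last first.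
  by move=> y xy; apply: gl; rewrite near_level_sym.
rewrite -[X in _ * X]mulr_natl base_div //; field.
by rewrite !base_neq0.
Qed.

(** The tower property in the form of sums: after exchanging them, [g z] is counted over the whole
    level-[k] class of [z], which lies either inside the level-[n] class of [x] or outside it. *)
Lemma level_expect_class_sum N n k g x : (n <= k)%N -> (k <= N)%N ->
  \sum_(0 <= y < M N | near_level n x y) level_expect N k g y =
  \sum_(0 <= y < M N | near_level n x y) g y.
Proof.
move=> nk kN; rewrite /level_expect -mulr_sumr.
under eq_bigr => y _ do rewrite big_mkcond /=.
rewrite exchange_big /= [RHS]big_mkcond mulr_sumr; apply: eq_bigr => z _.
case: ifPn => xz.
  have -> : \sum_(0 <= y < M N | near_level n x y) (if near_level k y z then g z else 0) =
     \sum_(0 <= y < M N | near_level k z y) g z.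
    rewrite big_mkcond [RHS]big_mkcond; apply: eq_bigr => y _.
    rewrite [near_level k y z]near_level_sym; case: ifPn => xy; case: ifPn => // zy.
    by case/negP: xy; apply: near_level_trans xz _; exact: near_level_le zy.
  rewrite (@class_sum_level _ k N z (fun=> g z)) // -[X in _ * X]mulr_natl base_div //.
  by field; rewrite !base_neq0.
rewrite big1 ?mulr0 // => y xy; case: ifPn => // yz.
by case/negP: xz; apply: near_level_trans xy _; exact: near_level_le yz.
Qed.

Lemma level_expect_sum N n (I : Type) (r : seq I) (P : pred I) (G : I -> nat -> F) x :
  level_expect N n (fun y => \sum_(i <- r | P i) G i y) x =
  \sum_(i <- r | P i) level_expect N n (G i) x.
Proof. by rewrite /level_expect exchange_big /= mulr_sumr. Qed.

Lemma level_expectZ N n c g x :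
  level_expect N n (fun y => c * g y) x = c * level_expect N n g x.
Proof. by rewrite /level_expect -mulr_sumr mulrCA. Qed.

Lemma level_expectD N n g h x :
  level_expect N n (fun y => g y + h y) x = level_expect N n g x + level_expect N n h x.
Proof. by rewrite /level_expect big_split /= mulrDr. Qed.

Lemma level_mean_class N n e g : (n <= N)%N -> (forall y, ~~ near_level n e y -> g y = 0) ->
  \sum_(0 <= y < M N) g y = \sum_(0 <= y < M N | near_level n e y) g y.
Proof.
move=> nN h; rewrite [RHS]big_mkcond; apply: eq_bigr => y _.
by case: ifPn => // /h.
Qed.

Lemma level_mean_of_level N n g : (n <= N)%N -> of_level n g ->
  level_mean N g = level_mean n g.
Proof.
move=> nN gl; rewrite /level_mean (class_sum_range _ nN) mulr_sumr [RHS]mulr_sumr.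
apply: eq_bigr => e _; rewrite class_sum_level //; last first.
  by move=> y ey; apply: gl; rewrite near_level_sym.
rewrite -[X in _ * X]mulr_natl base_div //.
by field; rewrite !base_neq0.
Qed.

End Field.

Section RealMean.
Variables (R : realType) (N : nat).
Implicit Types g h : nat -> R.
Local Notation mean := (level_mean N).

Lemma base_gt0 n : 0 < (M n)%:R :> R.
Proof. by rewrite ltr0n vilenkin_base_gt0. Qed.

Lemma level_mean_le g h : (forall y, g y <= h y) -> mean g <= mean h.
Proof.
move=> gh; rewrite ler_wpM2l ?invr_ge0 ?ler0n //.
by apply: ler_sum => y _.
Qed.

Lemma level_mean_ge0 g : (forall y, 0 <= g y) -> 0 <= mean g.
Proof. by move=> g0; rewrite mulr_ge0 ?invr_ge0 ?ler0n // sumr_ge0. Qed.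

Lemma level_meanD g h : mean (fun y => g y + h y) = mean g + mean h.
Proof. by rewrite /level_mean big_split mulrDr. Qed.

Lemma level_meanZ c g : mean (fun y => c * g y) = c * mean g.
Proof. by rewrite /level_mean -mulr_sumr mulrCA. Qed.

Lemma level_mean_sum (I : Type) (r : seq I) (P : pred I) (G : I -> nat -> R) :
  mean (fun y => \sum_(i <- r | P i) G i y) = \sum_(i <- r | P i) mean (G i).
Proof. by rewrite /level_mean exchange_big /= mulr_sumr. Qed.

Lemma level_mean_indicator n e : (n <= N)%N ->
  mean (fun y => (near_level n e y)%:R : R) = (M n)%:R^-1.
Proof.
move=> nN; rewrite /level_mean (@level_mean_class R N n e _ nN) //; last first.
  by move=> y /negbTE ->.
rewrite (eq_bigr (fun=> 1)) => [|y -> //].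
rewrite (@class_sum_level _ n N e (fun=> 1)) // base_div //.
by field; rewrite !base_neq0.
Qed.

Lemma level_expect_norm n (g : nat -> R[i]) x K : (n <= N)%N ->
  (forall y, near_level n x y -> Normc.normc (g y) <= K) ->
  Normc.normc (level_expect N n g x) <= K.
Proof.
move=> nN h; rewrite /level_expect Normc.normcM.
have -> : (M n)%:R / (M N)%:R = ((M n)%:R / (M N)%:R : R)%:C%C.
  by rewrite rmorphM fmorphV !rmorph_nat.
rewrite normc_real ger0_norm ?divr_ge0 ?ler0n //.
apply: le_trans (ler_wpM2l _ (normc_sum _ _ _)) _; first by rewrite divr_ge0.
apply: (@le_trans _ _ ((M n)%:R / (M N)%:R *
    \sum_(0 <= y < M N | near_level n x y) K)).
  by rewrite ler_wpM2l ?divr_ge0 //; apply: ler_sum => y; exact: h.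
rewrite (@class_sum_level _ n N x (fun=> K)) // -[X in _ * X]mulr_natl base_div //.
rewrite [X in X <= _](_ : _ = K) //.
by field; rewrite !base_neq0.
Qed.

(** The pairs for which [kernel_bound] may return the indices [k] and [l], with digit [k] left free.
    For [l <= k] this degenerates to [near_level l], so that one family describes both kinds of
    support. *)
Definition agree_off k l x y : bool :=
  all (fun c => (c == k) || (digit x c == digit y c)) (iota 0 l).

Lemma agree_offP k l x y :
  reflect (forall c, (c < l)%N -> c != k -> digit x c = digit y c) (agree_off k l x y).
Proof.
apply: (iffP allP) => h c; last first.
  rewrite mem_iota add0n /= => cl; case: eqVneq => //= ck.
  by rewrite h.
by move=> cl ck; have := h c; rewrite mem_iota add0n cl (negbTE ck) => /(_ isT)/eqP.
Qed.

Lemma agree_off_ge k l x y : (l <= k)%N -> agree_off k l x y = near_level l x y.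
Proof.
move=> lk; apply/agree_offP/eq_modnP => h c cl.
  by rewrite h // neq_ltn (leq_trans cl lk).
by move=> _; exact: h.
Qed.

Lemma agree_off_le k l l' x y : (l <= l')%N -> agree_off k l' x y -> agree_off k l x y.
Proof.
by move=> ll /agree_offP h; apply/agree_offP => c cl; apply: h; exact: leq_trans ll.
Qed.

Lemma agree_off_near k l x y z : near_level l y z ->
  agree_off k l x y = agree_off k l x z.
Proof.
move=> /eq_modnP yz; apply/agree_offP/agree_offP => h c cl ck.
  by rewrite -yz // h.
by rewrite yz // h.
Qed.

Lemma agree_off_nearl k l x y z : near_level l y z ->
  agree_off k l y x = agree_off k l z x.
Proof.
move=> /eq_modnP yz; apply/agree_offP/agree_offP => h c cl ck.
  by rewrite -yz // h.
by rewrite yz // h.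
Qed.

Lemma agree_offS k l x b e : (e < M l)%N -> (b < m l)%N ->
  agree_off k l.+1 x (b * M l + e) =
  agree_off k l x e && ((l == k) || (digit x l == b)).
Proof.
move=> el bl; rewrite /agree_off -addn1 iotaD all_cat /= andbT add0n.
rewrite digit_rec //; congr (_ && _).
by apply: agree_off_near; rewrite /near_level modnMDl.
Qed.

Lemma agree_off_card k l x :
  \sum_(0 <= y < M l) (agree_off k l x y)%:R = (if (k < l)%N then m k else 1)%:R :> R.
Proof.
elim: l => [|l IH]; first by rewrite vilenkin_base0 big_nat1.
rewrite sum_baseS.
transitivity (\sum_(0 <= b < m l) (((l == k) || (digit x l == b))%:R *
    \sum_(0 <= e < M l) (agree_off k l x e)%:R) : R).
  rewrite !big_nat; apply: eq_bigr => b /= bl; rewrite mulr_sumr !big_nat.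
  apply: eq_bigr => e /= el; rewrite agree_offS // -natrM mulnb.
  by rewrite andbC.
rewrite IH -mulr_suml.
have [<-|lk] := eqVneq l k.
  by rewrite ltnn ltnSn mulr1 sumr_const_nat subn0.
rewrite [X in X * _](_ : _ = 1) ?mul1r; last first.
  rewrite big_mkord (bigD1 (Ordinal (vilenkin_digit_lt m_ge2 x l))) //= eqxx.
  rewrite big1 ?addr0 // => i ix; case: eqP => // e; case/eqP: ix; exact/val_inj.
by rewrite ltnS [in RHS]leq_eqVlt eq_sym (negbTE lk).
Qed.

Lemma level_mean_agree_off B k l x : (l <= N)%N -> (forall c, (m c <= B)%N) ->
  mean (fun y => (agree_off k l x y)%:R : R) <= B%:R / (M l)%:R.
Proof.
move=> lN mB; rewrite (@level_mean_of_level _ N l) //; last first.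
  by move=> y z yz; rewrite (agree_off_near _ _ yz).
rewrite /level_mean agree_off_card mulrC ler_wpM2r ?invr_ge0 ?ler0n //.
rewrite ler_nat; case: ifP => // _.
by apply: leq_trans (mB 0%N); apply: leq_trans (m_ge2 0%N).
Qed.

End RealMean.
End Averages.


(** * Characters and Noerlund means *)

Section UnitCircle.
Variable R : realType.
Local Notation nrm := (@Normc.normc R).

Definition cis (t : R) : R[i] := (cos t +i* sin t)%C.

Lemma cisD a b : cis (a + b) = cis a * cis b.
Proof. by rewrite /cis cosD sinD; apply/eqP; rewrite eq_complex /= [X in _ && (X == _)]addrC !eqxx. Qed.

Lemma cisN a : cis (- a) = (cis a)^*%C.
Proof. by rewrite /cis cosN sinN. Qed.

Lemma cis0 : cis 0 = 1.
Proof. by rewrite /cis cos0 sin0. Qed.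

Lemma cis_norm a : nrm (cis a) = 1.
Proof. by rewrite /cis /Normc.normc cos2Dsin2 sqrtr1. Qed.

Lemma cisX a n : cis a ^+ n = cis (a *+ n).
Proof.
elim: n => [|n IH]; first by rewrite expr0 mulr0n cis0.
by rewrite exprS IH mulrS cisD.
Qed.

Lemma cis_2pi n : cis (2 * pi * n%:R) = 1.
Proof.
rewrite mulr_natr -cisX mulr_natl /cis cos2pi sin2pi.
by rewrite -[(1 +i* 0)%C]/(1 : R[i]) expr1n.
Qed.

Lemma cis_eq1 (k n : nat) : (0 < k < n)%N -> cis (2 * pi * k%:R / n%:R) != 1.
Proof.
move=> /andP[k0 kn]; apply/eqP => -[].
have nn : (0 < n)%N by exact: ltn_trans kn.
have n0 : 0 < n%:R :> R by rewrite ltr0n.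
(* The half angle lies strictly between 0 and pi, where the sine is positive, so the cosine of the
   full angle is not 1. *)
have -> : 2 * pi * k%:R / n%:R = (pi * k%:R / n%:R) *+ 2 :> R.
  by rewrite -[RHS]mulr_natl; ring.
rewrite cos_mulr2n => e _.
have : 0 < sin (pi * k%:R / n%:R : R).
  apply: sin_gt0_pi; rewrite divr_gt0 ?mulr_gt0 ?pi_gt0 ?ltr0n //=.
  by rewrite ltr_pdivrMr // ltr_pM2l ?pi_gt0 // ltr_nat.
move=> s0; have := mulr_gt0 s0 s0; rewrite -expr2; have := cos2Dsin2 (pi * k%:R / n%:R : R); lra.
Qed.

End UnitCircle.

Section Noerlund.
Variables (R : realType) (m : nat -> nat).
Hypothesis m_ge2 : forall n, (2 <= m n)%N.
Local Notation nrm := (@Normc.normc R).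
Local Notation M := (vilenkin_base m).
Local Notation digit := (vilenkin_digit m).

Definition vroot x c : R[i] := cis (2 * pi * (digit x c)%:R / (m c)%:R).

Lemma m_neq0 c : (m c)%:R != 0 :> R.
Proof. by rewrite pnatr_eq0 -lt0n (leq_trans _ (m_ge2 c)). Qed.

Lemma vrootX x c : vroot x c ^+ m c = 1.
Proof. by rewrite cisX -[X in cis X]mulr_natr divfK ?m_neq0 // cis_2pi. Qed.

Lemma vroot_conj x c : vroot x c * (vroot x c)^*%C = 1.
Proof. by rewrite -cisN -cisD subrr cis0. Qed.

Lemma vroot_ratioX x y c : (vroot x c * (vroot y c)^*%C) ^+ m c = 1.
Proof. by rewrite exprMn vrootX mul1r -rmorphXn /= vrootX rmorph1. Qed.

Lemma vroot_ratio_norm x y c : nrm (vroot x c * (vroot y c)^*%C) = 1.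
Proof. by rewrite Normc.normcM -cisN !cis_norm mulr1. Qed.

Lemma vroot_ratio_eq1 x y c : vroot x c * (vroot y c)^*%C = 1 -> digit x c = digit y c.
Proof.
wlog le : x y / (digit y c <= digit x c)%N => [H|].
  move=> e; case/orP: (leq_total (digit y c) (digit x c)) => h; first exact: H.
  apply/esym/H => //.
  by rewrite -[vroot x c]mulr1 -(vroot_conj y c) mulrCA e mulr1 vroot_conj.
rewrite leq_eqVlt in le; case/orP: le => [/eqP -> //|lt].
rewrite -cisN -cisD => e; exfalso.
have := @cis_eq1 R (digit x c - digit y c) (m c).
rewrite subn_gt0 lt (leq_ltn_trans (leq_subr _ _)) ?vilenkin_digit_lt //.
move=> /(_ isT)/eqP; apply; rewrite -[RHS]e natrB ?(ltnW lt) //; congr cis.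
by ring.
Qed.

Definition vchar N j x : R[i] := root_char m (vroot x) N j.

Lemma vchar_ratio N j x y :
  vchar N j x * (vchar N j y)^*%C = root_char m (fun c => vroot x c * (vroot y c)^*%C) N j.
Proof.
rewrite /vchar /root_char rmorph_prod -big_split /=; apply: eq_bigr => c _.
by rewrite rmorphXn exprMn.
Qed.

Lemma vchar_of_level N j k : (j < M k)%N -> of_level m k (vchar N j).
Proof.
move=> jk x y /eq_modnP xy; apply: eq_bigr => c _.
case: (ltnP c k) => ck; first by rewrite /vroot xy.
by rewrite (digit_small_le m_ge2 jk ck).
Qed.

Lemma vchar_of_levelN N j : of_level m N (vchar N j).
Proof.
by move=> x y /eq_modnP xy; apply: eq_bigr => c _; rewrite /vroot xy.
Qed.

(** The top nonzero digit of [j] has an index [c >= n]. Averaging over digit [c] of the point alone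
    already gives 0, and by the tower property it suffices to average at level [c]. *)
Lemma vchar_expect0 N j n x : (M n <= j < M N)%N -> level_expect m N n (vchar N j) x = 0.
Proof.
move=> /andP[nj jN].
have ex : exists c, (M c <= j)%N by exists n.
have bnd c : (M c <= j)%N -> (c <= N)%N.
  move=> h; rewrite leqNgt; apply/negP => /ltnW/(leq_vilenkin_base m_ge2).
  by move=> /leq_trans/(_ h); rewrite leqNgt jN.
case: (ex_maxnP ex bnd) => c cj max.
have nc : (n <= c)%N by exact: max.
have jc : (j < M c.+1)%N by rewrite ltnNge; apply/negP => /max; rewrite ltnn.
have cN : (c < N)%N.
  rewrite ltnNge; apply/negP => /(leq_vilenkin_base m_ge2) /leq_trans/(_ cj).
  by rewrite leqNgt jN.
rewrite /level_expect -(level_expect_class_sum _ _ _ nc (ltnW cN)) // big1 ?mulr0 //.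
move=> y _; rewrite /level_expect class_sum ?(ltnW cN) //.
have -> : (M N %/ M c = M N %/ M c.+1 * m c)%N.
  have /dvdnP[d ->] := dvdn_vilenkin_base m cN.
  rewrite mulnK ?vilenkin_base_gt0 // vilenkin_baseS [(M c * _)%N]mulnC mulnA.
  by rewrite mulnK ?vilenkin_base_gt0.
rewrite sum_blocks big1 ?mulr0 // => t _.
pose r := (y %% M c)%N.
have rc : (r < M c)%N by rewrite ltn_mod vilenkin_base_gt0.
(* Within a block only digit [c] of the point varies below level [c.+1], and the digits from [c.+1]
   on do not matter as [j < M c.+1]. What remains is a sum of powers of a nontrivial root of
   unity. *)
rewrite (eq_big_nat _ _ (F2 := fun b =>
   vchar N j r * (cis (2 * pi * (digit j c)%:R / (m c)%:R)) ^+ b)) => [|b /= bm].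
  rewrite -mulr_sumr (@sum_unity_root _ m (fun c => cis (2 * pi * (digit j c)%:R / (m c)%:R))) ?mulr0 //.
    by move=> c'; exact: vrootX.
  apply: cis_eq1; rewrite vilenkin_digit_lt // andbT.
  have := modn_vilenkin_baseS m j c; rewrite modn_small // => e.
  rewrite lt0n; apply/eqP => d; move: e; rewrite d mul0n addn0 => e.
  by move: cj; rewrite e leqNgt ltn_mod vilenkin_base_gt0.
rewrite (@vchar_of_level _ _ _ jc _ (b * M c + r)); last first.
  by rewrite /near_level -/r mulnDl -mulnA [(m c * _)%N]mulnC -vilenkin_baseS -addnA modnMDl.
rewrite /vchar /root_char (bigD1 (Ordinal cN)) //= [in RHS](bigD1 (Ordinal cN)) //=.
rewrite {1}/vroot digit_rec // {2}/vroot (digit_small rc) mulr0 mul0r cis0 expr1n mul1r.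
rewrite mulrC; congr (_ * _).
  apply: eq_bigr => i ic; case: (ltnP i c) => ci.
    by rewrite /vroot (@digitD_lt _ _ _ c) // dvdn_mull.
  have -> : digit j i = 0%N; last by rewrite !expr0.
  rewrite (digit_small_le m_ge2 jc) // ltn_neqAle ci andbT.
  by apply: contraNneq ic => e; apply/eqP/val_inj.
rewrite !cisX; congr cis; rewrite -2!mulr_natl; ring.
Qed.

End Noerlund.


Lemma le_sum_nat (R : realType) (F : nat -> R) a b i : (forall j, 0 <= F j) ->
  (a <= i < b)%N -> F i <= \sum_(a <= j < b) F j.
Proof.
move=> F0 /andP[ai ib].
rewrite (big_cat_nat _ (n := i)) //=; last exact: ltnW.
by rewrite [X in _ + X]big_ltn // addrCA lerDl addr_ge0 ?sumr_ge0.
Qed.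

(** * The estimate on atoms *)

Section AtomEstimate.
Variables (R : realType) (m : nat -> nat) (B : nat).
Hypothesis m_ge2 : forall n, (2 <= m n)%N.
Hypothesis m_le : forall n, (m n <= B)%N.
Variables (alpha : R) (q : nat -> R) (Cq : R).
Hypothesis alpha01 : 0 < alpha < 1.
Hypothesis q_ge0 : forall n, 0 <= q n.
Hypothesis q_ni : nonincreasing_seq q.
Hypothesis q0_gt0 : 0 < q 0%N.
Hypothesis Cq_ge0 : 0 <= Cq.
Hypothesis ratio : forall a n : nat, (0 < a)%N -> (a <= n)%N ->
  weight_sum q a <= Cq * (a%:R / n%:R) `^ alpha * weight_sum q n.
Local Notation nrm := (@Normc.normc R).
Local Notation M := (vilenkin_base m).
Local Notation digit := (vilenkin_digit m).
Local Notation Q := (weight_sum q).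
Local Notation p := ((1 + alpha)^-1).

Lemma exponent_bounds : 0 < p <= 1.
Proof.
case/andP: alpha01 => a0 a1.
by rewrite invr_gt0 invf_le1 ?addr_gt0 //= lerDl ltW.
Qed.

Lemma exponent_gt0 : 0 < p. Proof. by case/andP: exponent_bounds. Qed.

Definition base_pow (b : R) l : R := (M l)%:R `^ b.

Lemma base_pow_gt0 b l : 0 < base_pow b l.
Proof. by rewrite powR_gt0 // ltr0n vilenkin_base_gt0. Qed.

Lemma base_pow_ge0 b l : 0 <= base_pow b l.
Proof. exact/ltW/base_pow_gt0. Qed.

Lemma base_powD a b l : base_pow (a + b) l = base_pow a l * base_pow b l.
Proof. by rewrite /base_pow powRD // (base_neq0 m_ge2) implybT. Qed.

Lemma base_pow1 l : base_pow 1 l = (M l)%:R.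
Proof. by rewrite /base_pow powRr1 ?ler0n. Qed.

Lemma two_le_baseS l : 2 * (M l)%:R <= (M l.+1)%:R :> R.
Proof. by rewrite -natrM ler_nat vilenkin_baseS mulnC leq_mul2l m_ge2 orbT. Qed.

Lemma base_pow_growth b l : 0 < b -> base_pow b l <= 2 `^ (- b) * base_pow b l.+1.
Proof.
move=> b0; rewrite powRN mulrC ler_pdivlMr ?powR_gt0 // mulrC -powRM ?ler0n //.
by rewrite ge0_ler_powR ?nnegrE ?mulr_ge0 ?ler0n ?(ltW b0) // two_le_baseS.
Qed.

Lemma base_pow_decay b l : b < 0 -> base_pow b l.+1 <= 2 `^ b * base_pow b l.
Proof.
move=> b0; rewrite /base_pow -powRM ?ler0n // -[b]opprK powRN [leRHS]powRN.
rewrite lef_pV2 ?posrE ?powR_gt0 ?mulr_gt0 ?ltr0n ?vilenkin_base_gt0 //.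
rewrite ge0_ler_powR ?nnegrE ?mulr_ge0 ?ler0n ?oppr_ge0 ?(ltW b0) //.
exact: two_le_baseS.
Qed.

(** The ratio 2 comes from [m l >= 2]. The absolute value lets one constant serve both growing and
    decaying powers of [M l]. *)
Definition geom_const (b : R) : R := (1 - 2 `^ (- `|b|))^-1.

Lemma geom_ratio (b : R) : b != 0 -> 0 <= 2 `^ (- `|b|) < 1.
Proof.
move=> b0; rewrite powR_ge0 /= powRN invf_lt1 ?powR_gt0 //.
rewrite -[ltLHS](powRr0 2) /powR pnatr_eq0 /= ltr_expR ltr_pM2r ?ln_gt0 ?ltr1n //.
by rewrite normr_gt0.
Qed.

Lemma geom_const_ge0 b : b != 0 -> 0 <= geom_const b.
Proof.
by move=> /geom_ratio/andP[_ h]; rewrite invr_ge0 subr_ge0 ltW.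
Qed.

Lemma base_pow_sum b n : 0 < b ->
  \sum_(0 <= l < n.+1) base_pow b l <= geom_const b * base_pow b n.
Proof.
move=> b0; apply: sum_geometric_increasing => [|l|l].
- by apply: geom_ratio; rewrite gt_eqF.
- exact: base_pow_ge0.
- by rewrite gtr0_norm //; exact: base_pow_growth.
Qed.

Lemma base_pow_sum_tail b k n : b < 0 ->
  \sum_(k <= l < n) base_pow b l <= geom_const b * base_pow b k.
Proof.
move=> b0; apply: sum_geometric_decreasing => [|l|l].
- by apply: geom_ratio; rewrite lt_eqF.
- exact: base_pow_ge0.
- by rewrite ltr0_norm // opprK; exact: base_pow_decay.
Qed.

Variable N : nat.
Local Notation mean := (level_mean m N).

(** The kernel after summation by parts: the character of index [j] occurs in the partial sums of
    order above [j], whose weights add up to [Q (n - j)]. *)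
Definition noerlund_kernel n x y : R[i] := ((Q n)^-1)%:C%C *
  \sum_(0 <= j < n) (Q (n - j)%N)%:C%C * (vchar R m N j x * (vchar R m N j y)^*%C).

Definition noerlund n (g : nat -> R[i]) x : R[i] :=
  level_mean m N (fun y => g y * noerlund_kernel n x y).

Definition maxfun (g : nat -> R[i]) x : R :=
  \big[Order.max/0]_(i < N.+1) nrm (level_expect m N i g x).

(** The range ends at [M N] so that it splits into complete blocks [M s <= k < M s.+1]. *)
Definition log_mean (g : nat -> R[i]) : R :=
  \sum_(1 <= k < M N) k%:R^-1 * mean (fun x => maxfun (noerlund k g) x `^ p).

Lemma maxfun_ge0 g x : 0 <= maxfun g x.
Proof. by rewrite /maxfun; elim/big_rec: _ => // i y _ y0; rewrite le_max y0 orbT. Qed.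

Lemma maxfun_le g x K : 0 <= K ->
  (forall i, (i <= N)%N -> nrm (level_expect m N i g x) <= K) -> maxfun g x <= K.
Proof.
move=> K0 h; apply/bigmax_leP; split => // i _; apply: h.
by rewrite -ltnS.
Qed.

Lemma maxfun_ge g x i : (i <= N)%N -> nrm (level_expect m N i g x) <= maxfun g x.
Proof.
by move=> iN; apply: (le_bigmax 0 (fun i : 'I_N.+1 => nrm (level_expect m N i g x)) (Ordinal (iN : (i < N.+1)%N))).
Qed.

Definition kernel_const : R := (5 * B ^ 2)%:R * Cq.

Lemma kernel_const_ge0 : 0 <= kernel_const.
Proof. by rewrite mulr_ge0. Qed.

(** The indices given by [kernel_bound] depend on [x] and [y]; summing over all admissible pairs
    removes this dependence, all terms being nonnegative. The hypothesis [ratio] turns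
    [Q (M l) / Q n] into (M l / M s)^alpha. *)
Lemma kernel_majorant n s x y : (M s <= n < M s.+1)%N -> (n <= M N)%N ->
  nrm (noerlund_kernel n x y) <= kernel_const *
    \sum_(0 <= l < s.+1) \sum_(0 <= k < l.+1)
      (M k)%:R * (base_pow alpha l / base_pow alpha s) * (agree_off m k l x y)%:R.
Proof.
move=> sn nN; case/andP: alpha01 => a0 a1.
have [k [l [/andP[kl ls] agr bnd]]] := kernel_bound m_ge2 (vroot_ratioX R m_ge2 x y)
   (vroot_ratio_norm R m x y) q_ge0 q_ni m_le sn nN.
have n0 : (0 < n)%N.
  by case/andP: sn => /(leq_trans _) h _; apply: h; exact: vilenkin_base_gt0.
have Qn := weight_sum_gt0 q_ge0 q0_gt0 n0.
rewrite /noerlund_kernel Normc.normcM normc_real ger0_norm ?invr_ge0 ?(ltW Qn) //.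
under eq_bigr => j _ do rewrite vchar_ratio.
rewrite mulrC ler_pdivrMr //; apply: le_trans bnd _.
have Ml : (M l <= n)%N.
  by case/andP: sn => h _; apply: leq_trans h; exact: leq_vilenkin_base.
have rt : Q (M l) <= Cq * (base_pow alpha l / base_pow alpha s) * Q n.
  apply: le_trans (ratio (vilenkin_base_gt0 m_ge2 l) Ml) _.
  rewrite ler_wpM2r ?(ltW Qn) // ler_wpM2l // powRM ?invr_ge0 ?ler0n //.
  rewrite ler_wpM2l ?powR_ge0 //.
  have -> : (n%:R^-1 : R) `^ alpha = (n%:R `^ alpha)^-1.
    by rewrite -powR_inv1 ?ler0n // -powRrM mulN1r powRN.
  rewrite lef_pV2 ?posrE ?powR_gt0 ?base_pow_gt0 ?ltr0n ?vilenkin_base_gt0 //.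
  rewrite ge0_ler_powR ?nnegrE ?ler0n ?(ltW a0) // ler_nat.
  by case/andP: sn.
apply: le_trans (ler_wpM2l _ rt) _; first by rewrite mulr_ge0.
have agr' : agree_off m k l x y.
  by apply/agree_offP => c cl ck; apply: (@vroot_ratio_eq1 R _ m_ge2); exact: agr.
pose T l k := (M k)%:R * (base_pow alpha l / base_pow alpha s) * (agree_off m k l x y)%:R.
have T0 l' k' : 0 <= T l' k'.
  by rewrite !mulr_ge0 ?invr_ge0 ?base_pow_ge0 ?ler0n.
have le1 : T l k <= \sum_(0 <= l < s.+1) \sum_(0 <= k < l.+1) T l k.
  apply: le_trans (le_sum_nat (F := fun l => \sum_(0 <= k < l.+1) T l k) (i := l) _ _).
  - by apply: le_sum_nat => //; rewrite ltnS.
  - by move=> j; exact: sumr_ge0.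
  - by rewrite ltnS.
have := ler_wpM2r (ltW Qn) (ler_wpM2l kernel_const_ge0 le1).
apply: le_trans; rewrite /T agr' mulr1 /kernel_const.
by rewrite le_eqVlt; apply/orP; left; apply/eqP; ring.
Qed.

(** * Norlund means of one atom *)

Section Atom.
Variables (h e : nat) (a : nat -> R[i]) (A : R).
Hypothesis hN : (h <= N)%N.
Hypothesis A_ge0 : 0 <= A.
Hypothesis a_supp : forall y, ~~ near_level m h e y -> a y = 0.
Hypothesis a_bound : forall y, nrm (a y) <= A.

Lemma atom_overlap_low k l x : (l <= h)%N ->
  mean (fun y => (near_level m h e y)%:R * (agree_off m k l x y)%:R : R) =
  (M h)%:R^-1 * (agree_off m k l x e)%:R.
Proof.
move=> lh; rewrite -(level_mean_indicator m_ge2 R e hN) mulrC -level_meanZ //.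
congr (level_mean m N _); apply/funext => y; rewrite mulrC.
have [ey|] := boolP (near_level m h e y); last by rewrite !mulr0.
by rewrite (agree_off_near k x (near_level_le lh ey)).
Qed.

(** On the cylinder of the atom, agreement with [y] up to [l] forces agreement with [e] up to [h].
    This splits off a factor of level [h], and the rest is the measure of an [agree_off] set. *)
Lemma atom_overlap_high k l x : (h <= l)%N -> (l <= N)%N ->
  mean (fun y => (near_level m h e y)%:R * (agree_off m k l x y)%:R : R) <=
  B%:R / (M l)%:R * (agree_off m k h x e)%:R.
Proof.
move=> hl lN.
apply: le_trans (_ : _ <= mean (fun y => (agree_off m k h x e)%:R * (agree_off m k l x y)%:R)) _.
  apply: level_mean_le => y; have [ey|] := boolP (near_level m h e y); last first.
    by rewrite mul0r mulr_ge0 ?ler0n.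
  have [xy|] := boolP (agree_off m k l x y); last by rewrite !mulr0.
  have := agree_off_le hl xy; rewrite -(agree_off_near k x ey) => ->.
  by rewrite mul1r.
rewrite level_meanZ mulrC ler_wpM2r ?ler0n //.
exact: level_mean_agree_off.
Qed.

(** The first term is the indicator of the cylinder of the atom, written through [agree_off]. The
    double sum stops at [l = h] because the kernel terms with larger [l] are dominated by what is
    listed; this keeps the majorant measurable at level [h]. *)
Definition atom_majorant s x : R := (agree_off m h h x e)%:R +
  \sum_(0 <= l < h.+1) \sum_(0 <= k < l.+1)
    (M k)%:R * (base_pow alpha l / base_pow alpha s) * ((M h)%:R^-1 * (agree_off m k l x e)%:R).

Lemma atom_majorant_ge0 s x : 0 <= atom_majorant s x.
Proof.
rewrite addr_ge0 ?ler0n // sumr_ge0 // => l _; rewrite sumr_ge0 // => k _.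
by rewrite !mulr_ge0 ?invr_ge0 ?base_pow_ge0 ?ler0n.
Qed.

Lemma atom_majorant_level s : of_level m h (atom_majorant s).
Proof.
move=> x y xy; rewrite /atom_majorant (agree_off_nearl _ _ xy); congr (_ + _).
apply: eq_big_nat => l /andP[_ lh]; apply: eq_bigr => k _.
by rewrite (agree_off_nearl _ _ (near_level_le (lh : (l <= h)%N) xy)).
Qed.

(** The three summands come from the kernel terms with [l <= h], with [k <= h < l], and with
    [h < k <= l]. *)
Definition pointwise_const : R :=
  1 + B%:R * geom_const (alpha - 1) + B%:R * (geom_const 1 * geom_const alpha).

Lemma double_sum_bound s x : (h <= s)%N -> (s <= N)%N ->
  \sum_(0 <= l < s.+1) \sum_(0 <= k < l.+1)
    (M k)%:R * (base_pow alpha l / base_pow alpha s) *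
      mean (fun y => (near_level m h e y)%:R * (agree_off m k l x y)%:R) <=
  pointwise_const * atom_majorant s x.
Proof.
move=> hs sN; case/andP: alpha01 => a0 a1.
rewrite (big_cat_nat _ (n := h.+1)) //=.
pose I0 : R := (agree_off m h h x e)%:R.
pose S := \sum_(0 <= k < h.+1) (M k)%:R * (agree_off m k h x e)%:R : R.
pose D := \sum_(0 <= l < h.+1) \sum_(0 <= k < l.+1)
    (M k)%:R * (base_pow alpha l / base_pow alpha s) * ((M h)%:R^-1 * (agree_off m k l x e)%:R).
have I00 : 0 <= I0 by rewrite ler0n.
have S0 : 0 <= S by rewrite sumr_ge0 // => k _; rewrite mulr_ge0 ?ler0n.
have D0 : 0 <= D.
  rewrite sumr_ge0 // => l _; rewrite sumr_ge0 // => k _.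
  by rewrite !mulr_ge0 ?invr_ge0 ?base_pow_ge0 ?ler0n.
have g1 : alpha - 1 < 0 by rewrite subr_lt0.
have G1 : 0 <= geom_const (alpha - 1) by rewrite geom_const_ge0 // lt_eqF.
have G2 : 0 <= geom_const alpha by rewrite geom_const_ge0 // gt_eqF.
have G3 : 0 <= geom_const 1 by rewrite geom_const_ge0 // oner_eq0.
have low : \sum_(0 <= l < h.+1) \sum_(0 <= k < l.+1)
    (M k)%:R * (base_pow alpha l / base_pow alpha s) *
      mean (fun y => (near_level m h e y)%:R * (agree_off m k l x y)%:R) = D.
  apply: eq_big_nat => l /andP[_ lh]; apply: eq_bigr => k _.
  by rewrite atom_overlap_low.
(* For [k <= h < l] the terms decay like M_l^(alpha-1), so their sum over [l] is comparable to the
   value at [l = h], which is already part of [D]. *)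
have SD : (base_pow alpha h / base_pow alpha s) / (M h)%:R * S <= D.
  have := le_sum_nat (F := fun l => \sum_(0 <= k < l.+1)
    (M k)%:R * (base_pow alpha l / base_pow alpha s) * ((M h)%:R^-1 * (agree_off m k l x e)%:R))
    (a := 0) (b := h.+1) (i := h) _ _.
  rewrite /= ltnSn => le1; apply: le_trans (le1 _ isT); last first.
    move=> l; rewrite sumr_ge0 // => k _.
    by rewrite !mulr_ge0 ?invr_ge0 ?base_pow_ge0 ?ler0n.
  rewrite /S mulr_sumr; apply: ler_sum => k _.
  by rewrite le_eqVlt; apply/orP; left; apply/eqP; ring.
have high : \sum_(h.+1 <= l < s.+1) \sum_(0 <= k < l.+1)
    (M k)%:R * (base_pow alpha l / base_pow alpha s) *
      mean (fun y => (near_level m h e y)%:R * (agree_off m k l x y)%:R) <=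
  \sum_(h.+1 <= l < s.+1) (B%:R * S / base_pow alpha s * base_pow (alpha - 1) l +
      B%:R * geom_const 1 * I0 / base_pow alpha s * base_pow alpha l).
  rewrite big_nat [leRHS]big_nat; apply: ler_sum => l /andP[hl ls].
  apply: (@le_trans _ _ (B%:R / base_pow alpha s * base_pow (alpha - 1) l *
      \sum_(0 <= k < l.+1) (M k)%:R * (agree_off m k h x e)%:R)).
    rewrite mulr_sumr; apply: ler_sum => k _.
    have := @atom_overlap_high k l x (ltnW hl) (leq_trans (ls : (l <= s)%N) sN).
    move=> /(ler_wpM2l (_ : 0 <= (M k)%:R * (base_pow alpha l / base_pow alpha s))) le1.
    apply: le_trans (le1 _) _; first by rewrite !mulr_ge0 ?invr_ge0 ?base_pow_ge0 ?ler0n.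
    have -> : base_pow (alpha - 1) l = base_pow alpha l / (M l)%:R.
      by rewrite base_powD -[in RHS](base_pow1 l) /base_pow powRN.
    by rewrite le_eqVlt; apply/orP; left; apply/eqP; ring.
  (* For [k > h] the set no longer depends on [k]: it is the cylinder of the atom, and the sum of
     the [M k] is of order [M l]. *)
  have inner : \sum_(0 <= k < l.+1) (M k)%:R * (agree_off m k h x e)%:R <=
      S + I0 * (geom_const 1 * (M l)%:R).
    rewrite (big_cat_nat _ (n := h.+1)) //=; last by rewrite ltnS ltnW.
    rewrite lerD2l.
    apply: (@le_trans _ _ (I0 * \sum_(h.+1 <= k < l.+1) (M k)%:R)).
      rewrite mulr_sumr big_nat [leRHS]big_nat; apply: ler_sum => k /andP[hk _].
      by rewrite mulrC /I0 !agree_off_ge // ltnW.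
    rewrite ler_wpM2l // -(base_pow1 l) (le_trans _ (base_pow_sum l ltr01)) //.
    rewrite [leRHS](big_cat_nat _ (n := h.+1)) //=; last by rewrite ltnS ltnW.
    under eq_bigr => k _ do rewrite -base_pow1.
    by rewrite lerDr sumr_ge0 // => k _; exact: base_pow_ge0.
  apply: le_trans (ler_wpM2l _ inner) _.
    by rewrite !mulr_ge0 ?invr_ge0 ?base_pow_ge0 ?ler0n.
  have -> : base_pow alpha l = base_pow (alpha - 1) l * (M l)%:R.
    by rewrite -base_pow1 -base_powD subrK.
  by rewrite le_eqVlt; apply/orP; left; apply/eqP; ring.
rewrite low; apply: le_trans (lerD (lexx D) high) _.
rewrite big_split /= -!mulr_sumr.
have t1 : \sum_(h.+1 <= l < s.+1) base_pow (alpha - 1) l <=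
    geom_const (alpha - 1) * base_pow (alpha - 1) h.
  apply: le_trans (base_pow_sum_tail h s.+1 g1).
  by rewrite [leRHS]big_ltn ?ltnS // lerDr base_pow_ge0.
have t2 : \sum_(h.+1 <= l < s.+1) base_pow alpha l <= geom_const alpha * base_pow alpha s.
  apply: le_trans (base_pow_sum s a0).
  rewrite [leRHS](big_cat_nat _ (n := h.+1)) //= lerDr sumr_ge0 // => k _.
  exact: base_pow_ge0.
have c1 : B%:R * S / base_pow alpha s * \sum_(h.+1 <= l < s.+1) base_pow (alpha - 1) l <=
    B%:R * geom_const (alpha - 1) * D.
  apply: le_trans (ler_wpM2l _ t1) _; first by rewrite !mulr_ge0 ?invr_ge0 ?base_pow_ge0.
  have := ler_wpM2l (_ : 0 <= B%:R * geom_const (alpha - 1)) SD.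
  rewrite mulr_ge0 ?ler0n // => /(_ isT); apply: le_trans.
  have -> : base_pow (alpha - 1) h = base_pow alpha h / (M h)%:R.
    by rewrite base_powD -[in RHS](base_pow1 h) /base_pow powRN.
  by rewrite le_eqVlt; apply/orP; left; apply/eqP; ring.
have c2 : B%:R * geom_const 1 * I0 / base_pow alpha s *
    \sum_(h.+1 <= l < s.+1) base_pow alpha l <= B%:R * (geom_const 1 * geom_const alpha) * I0.
  apply: le_trans (ler_wpM2l _ t2) _; first by rewrite divr_ge0 ?base_pow_ge0 // !mulr_ge0 ?ler0n.
  rewrite le_eqVlt; apply/orP; left; apply/eqP; field.
  by rewrite gt_eqF // base_pow_gt0.
apply: le_trans (lerD (lexx D) (lerD c1 c2)) _.
rewrite /pointwise_const /atom_majorant -/I0 -/D.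
have z1 : 0 <= B%:R * geom_const (alpha - 1) * I0 by rewrite !mulr_ge0 ?ler0n.
have z2 : 0 <= B%:R * (geom_const 1 * geom_const alpha) * D by rewrite !mulr_ge0 ?ler0n.
by lra.
Qed.

Lemma pointwise_const_ge0 : 0 <= pointwise_const.
Proof.
case/andP: alpha01 => a0 a1.
have g1 : alpha - 1 != 0 by rewrite subr_eq0 lt_eqF.
by rewrite /pointwise_const !addr_ge0 ?mulr_ge0 ?geom_const_ge0 ?oner_eq0 ?(gt_eqF a0).
Qed.

Lemma atom_noerlund_bound n s x : (M s <= n < M s.+1)%N -> (n <= M N)%N -> (h <= s)%N ->
  nrm (noerlund n a x) <= A * kernel_const * pointwise_const * atom_majorant s x.
Proof.
move=> sn nN hs.
have sN : (s <= N)%N.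
  rewrite leqNgt; apply/negP => /(ltn_vilenkin_base m_ge2); case/andP: sn; lia.
have K0 := kernel_const_ge0.
rewrite /noerlund /level_mean Normc.normcM.
have -> : (M N)%:R^-1 = ((M N)%:R^-1 : R)%:C%C by rewrite fmorphV rmorph_nat.
rewrite normc_real ger0_norm ?invr_ge0 ?ler0n //.
apply: le_trans (ler_wpM2l _ (normc_sum _ _ _)) _; first by rewrite invr_ge0.
pose G y : R := \sum_(0 <= l < s.+1) \sum_(0 <= k < l.+1)
      (M k)%:R * (base_pow alpha l / base_pow alpha s) * (agree_off m k l x y)%:R.
have G0 y : 0 <= G y.
  rewrite sumr_ge0 // => l _; rewrite sumr_ge0 // => k _.
  by rewrite !mulr_ge0 ?invr_ge0 ?base_pow_ge0 ?ler0n.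
apply: (@le_trans _ _ (mean (fun y => A * kernel_const * ((near_level m h e y)%:R * G y)))).
  rewrite -/(mean (fun y => nrm (a y * noerlund_kernel n x y))).
  apply: level_mean_le => y; rewrite Normc.normcM.
  have [ey|ney] := boolP (near_level m h e y); last first.
    by rewrite (a_supp ney) Normc.normc0 !mul0r mulr0.
  by rewrite mul1r -mulrA ler_pM ?normc_ge0 // kernel_majorant.
rewrite level_meanZ -[leRHS]mulrA ler_wpM2l ?mulr_ge0 //.
apply: le_trans (double_sum_bound x hs sN).
rewrite /G; under [X in level_mean m N X]eq_fun => y do rewrite mulr_sumr.
rewrite level_mean_sum ler_sum // => l _.
under [X in level_mean m N X]eq_fun => y do rewrite mulr_sumr.
rewrite level_mean_sum ler_sum // => k _.
by rewrite -level_meanZ; apply: level_mean_le => y; rewrite mulrCA.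
Qed.

Lemma powR_bool (b : bool) : (b%:R : R) `^ p = b%:R.
Proof. by case: b; rewrite ?powR1 // powR0 // gt_eqF // exponent_gt0. Qed.

Lemma base_powM b c l : base_pow b l `^ c = base_pow (b * c) l.
Proof. by rewrite /base_pow powRrM. Qed.

Lemma atom_majorant_pow s x : atom_majorant s x `^ p <=
  (agree_off m h h x e)%:R + \sum_(0 <= l < h.+1) \sum_(0 <= k < l.+1)
    base_pow p k * (base_pow (alpha * p) l / base_pow (alpha * p) s) *
      (base_pow (- p) h * (agree_off m k l x e)%:R).
Proof.
have T0 l k : 0 <= (M k)%:R * (base_pow alpha l / base_pow alpha s) *
    ((M h)%:R^-1 * (agree_off m k l x e)%:R).
  by rewrite !mulr_ge0 ?invr_ge0 ?base_pow_ge0 ?ler0n.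
apply: le_trans (ge0_powRD exponent_bounds (ler0n _ _) _) _.
  by rewrite sumr_ge0 // => l _; rewrite sumr_ge0.
rewrite powR_bool lerD2l.
apply: le_trans (ge0_powR_sum _ _ exponent_bounds _) _.
  by move=> l; rewrite sumr_ge0.
apply: ler_sum => l _.
apply: le_trans (ge0_powR_sum _ _ exponent_bounds _) _; first by move=> k; exact: T0.
apply: ler_sum => k _.
rewrite powRM; last 2 first.
- by rewrite !mulr_ge0 ?invr_ge0 ?base_pow_ge0 ?ler0n.
- by rewrite !mulr_ge0 ?invr_ge0 ?ler0n.
rewrite powRM ?ler0n ?divr_ge0 ?base_pow_ge0 // powRM ?base_pow_ge0 ?invr_ge0 ?base_pow_ge0 //.
rewrite [(_^-1 * _) `^ p]powRM ?invr_ge0 ?ler0n // powR_bool base_powM.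
have -> : (base_pow alpha s)^-1 `^ p = (base_pow (alpha * p) s)^-1.
  by rewrite -base_powM -powR_inv1 ?base_pow_ge0 // -powRrM mulN1r powRN.
have -> : ((M h)%:R^-1 : R) `^ p = base_pow (- p) h.
  by rewrite -powR_inv1 ?ler0n // -powRrM mulN1r.
exact: lexx.
Qed.

Definition moment_const : R := 1 + B%:R * geom_const p.

Lemma moment_const_ge0 : 0 <= moment_const.
Proof.
by rewrite addr_ge0 // mulr_ge0 // geom_const_ge0 // gt_eqF // exponent_gt0.
Qed.

Lemma agree_offC k l x y : agree_off m k l x y = agree_off m k l y x.
Proof. by apply: eq_all => c; congr (_ || _); exact: eq_sym. Qed.

(** The sum over [k <= l] is geometric, but the one over [l] is not: by the choice of [p] all its
    [h.+1] terms are equal. This is the source of the factor [h.+1]. *)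
Lemma mean_atom_majorant s : (h <= s)%N ->
  mean (fun x => atom_majorant s x `^ p) <= moment_const * (M h)%:R^-1 *
    (1 + h.+1%:R * (base_pow (alpha * p) h / base_pow (alpha * p) s)).
Proof.
move=> hs; have p0 := exponent_gt0; case/andP: (alpha01) => a0 a1.
have G0 : 0 <= geom_const p by rewrite geom_const_ge0 // gt_eqF.
apply: le_trans (level_mean_le m N (atom_majorant_pow s)) _.
rewrite level_meanD.
have -> : mean (fun x => (agree_off m h h x e)%:R : R) = (M h)%:R^-1.
  rewrite -(level_mean_indicator m_ge2 R e hN); congr (level_mean m N _).
  by apply/funext => x; rewrite agree_offC agree_off_ge.
set r := base_pow (alpha * p) h / base_pow (alpha * p) s.
have r0 : 0 <= r by rewrite divr_ge0 ?base_pow_ge0.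
have Mh0 : 0 <= (M h)%:R^-1 :> R by rewrite invr_ge0.
suff dbl : mean (fun x => \sum_(0 <= l < h.+1) \sum_(0 <= k < l.+1)
    base_pow p k * (base_pow (alpha * p) l / base_pow (alpha * p) s) *
      (base_pow (- p) h * (agree_off m k l x e)%:R)) <=
    (M h)%:R^-1 * (B%:R * geom_const p * (h.+1%:R * r)).
  apply: le_trans (lerD (lexx _) dbl) _; rewrite /moment_const.
  have z1 : 0 <= (M h)%:R^-1 * (h.+1%:R * r) by rewrite mulr_ge0 // mulr_ge0 ?ler0n.
  have z2 : 0 <= (M h)%:R^-1 * (B%:R * geom_const p) by rewrite !mulr_ge0.
  by lra.
rewrite level_mean_sum.
(* The endpoint identity: M_l^(alpha p) * M_l^p cancels the measure 1 / M_l exactly. *)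
have e1 : alpha * p + p = 1.
  by rewrite -{2}[p]mul1r -mulrDl addrC mulfV // gt_eqF // addr_gt0.
have hp : base_pow (- p) h = base_pow (alpha * p) h / (M h)%:R.
  have -> : (M h)%:R = base_pow (alpha * p) h * base_pow p h.
    by rewrite -base_powD e1 base_pow1.
  rewrite invfM mulrA divff ?mul1r; first by rewrite /base_pow powRN.
  by rewrite gt_eqF // base_pow_gt0.
apply: (@le_trans _ _ (\sum_(0 <= l < h.+1) (M h)%:R^-1 * (B%:R * geom_const p * r))).
  rewrite big_nat [leRHS]big_nat; apply: ler_sum => l /andP[_ lh].
  rewrite level_mean_sum.
  apply: (@le_trans _ _ (\sum_(0 <= k < l.+1) base_pow p k *
     (base_pow (alpha * p) l / base_pow (alpha * p) s * base_pow (- p) h * (B%:R / (M l)%:R)))).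
    apply: ler_sum => k _.
    have -> : (fun x => base_pow p k * (base_pow (alpha * p) l / base_pow (alpha * p) s) *
      (base_pow (- p) h * (agree_off m k l x e)%:R)) = (fun x => (base_pow p k *
      (base_pow (alpha * p) l / base_pow (alpha * p) s * base_pow (- p) h)) * (agree_off m k l e x)%:R).
      by apply/funext => x; rewrite agree_offC; ring.
    rewrite level_meanZ -[leLHS]mulrA ler_wpM2l ?base_pow_ge0 // ler_wpM2l //.
      by rewrite !mulr_ge0 ?invr_ge0 ?base_pow_ge0.
    by apply: level_mean_agree_off => //; exact: leq_trans hN.
  rewrite -mulr_suml; apply: le_trans (ler_wpM2r _ (base_pow_sum l p0)) _.
    by rewrite !mulr_ge0 ?invr_ge0 ?base_pow_ge0.
  have -> : geom_const p * base_pow p l * (base_pow (alpha * p) l / base_pow (alpha * p) s *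
     base_pow (- p) h * (B%:R / (M l)%:R)) = geom_const p * (base_pow (alpha * p) l * base_pow p l) *
      (B%:R / (M l)%:R) * (base_pow (- p) h / base_pow (alpha * p) s) by ring.
  rewrite -base_powD e1 base_pow1 hp /r.
  rewrite le_eqVlt; apply/orP; left; apply/eqP; field.
  by rewrite !(base_neq0 m_ge2) gt_eqF // base_pow_gt0.
rewrite sumr_const_nat subn0 -[X in X <= _]mulr_natl.
by rewrite le_eqVlt; apply/orP; left; apply/eqP; ring.
Qed.

Section Cancellation.
Hypothesis a_mean0 : \sum_(0 <= y < M N) a y = 0.

Lemma atom_coef0 j : (j < M h)%N ->
  level_mean m N (fun y => a y * (vchar R m N j y)^*%C) = 0.
Proof.
move=> jh; rewrite /level_mean (eq_bigr (fun y => a y * (vchar R m N j e)^*%C)).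
  by rewrite -mulr_suml a_mean0 mul0r mulr0.
move=> y _; have [ey|ney] := boolP (near_level m h e y); last by rewrite a_supp ?mul0r.
by rewrite (vchar_of_level R m_ge2 N jh ey).
Qed.

Lemma noerlund_expansion n x : noerlund n a x =
  \sum_(0 <= j < n) ((Q n)^-1 * Q (n - j)%N)%:C%C *
    level_mean m N (fun y => a y * (vchar R m N j y)^*%C) * vchar R m N j x.
Proof.
rewrite /noerlund /level_mean /noerlund_kernel.
under eq_bigr => y _ do rewrite mulr_sumr mulr_sumr.
rewrite exchange_big /= mulr_sumr; apply: eq_bigr => j _.
transitivity (((Q n)^-1 * Q (n - j)%N)%:C%C * (M N)%:R^-1 * vchar R m N j x *
  \sum_(0 <= y < M N) a y * (vchar R m N j y)^*%C); last by ring.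
have -> : ((Q n)^-1 * Q (n - j)%N)%:C%C = ((Q n)^-1)%:C%C * (Q (n - j)%N)%:C%C :> R[i].
  exact: rmorphM.
by rewrite !mulr_sumr; apply: eq_bigr => y _; ring.
Qed.

Lemma atom_noerlund0 n x : (n <= M h)%N -> noerlund n a x = 0.
Proof.
move=> nh; rewrite noerlund_expansion big_nat big1 // => j /andP[_ jn].
by rewrite atom_coef0 ?mulr0 ?mul0r // (leq_trans jn).
Qed.

(** Characters of index below [M h] are constant on the cylinder of the atom and get coefficient 0;
    the others have mean 0 on every class of level [i <= h]. *)
Lemma atom_expect0 i n x : (i <= h)%N -> (n <= M N)%N ->
  level_expect m N i (noerlund n a) x = 0.
Proof.
move=> ih nN.
rewrite (_ : noerlund n a = fun x => \sum_(0 <= j < n) ((Q n)^-1 * Q (n - j)%N)%:C%C *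
    level_mean m N (fun y => a y * (vchar R m N j y)^*%C) * vchar R m N j x); last first.
  by apply/funext => z; exact: noerlund_expansion.
rewrite level_expect_sum big_nat big1 // => j /andP[_ jn].
rewrite level_expectZ; case: (ltnP j (M h)) => jh.
  by rewrite atom_coef0 // mulr0 mul0r.
rewrite (vchar_expect0 R m_ge2) ?mulr0 //.
by rewrite (leq_trans (leq_vilenkin_base m_ge2 ih) jh) (leq_trans jn).
Qed.

End Cancellation.

Hypothesis a_cancel : h = 0%N \/ \sum_(0 <= y < M N) a y = 0.

(** At levels [i >= h] one averages over a set where the majorant is constant, so the pointwise
    bound survives. Levels [i < h] vanish by cancellation, and there are none when [h = 0]. *)
Lemma atom_maxfun n s x : (M s <= n < M s.+1)%N -> (n <= M N)%N -> (h <= s)%N ->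
  maxfun (noerlund n a) x <= A * kernel_const * pointwise_const * atom_majorant s x.
Proof.
move=> sn nN hs.
have K0 := kernel_const_ge0; have K1 := pointwise_const_ge0.
have W0 := atom_majorant_ge0 s.
apply: maxfun_le => [|i iN]; first by rewrite !mulr_ge0.
case: (leqP h i) => hi.
  apply: level_expect_norm => // y xy.
  rewrite (atom_majorant_level s (near_level_le hi xy)).
  exact: atom_noerlund_bound.
case: a_cancel => [h0|a0]; first by rewrite h0 in hi.
by rewrite atom_expect0 ?(ltnW hi) // Normc.normc0 !mulr_ge0.
Qed.

Definition atom_const : R := B%:R * ((kernel_const * pointwise_const) `^ p) *
  moment_const * (1 + geom_const (alpha * p)).

Lemma atom_const_ge0 : 0 <= atom_const.
Proof.
have ap : alpha * p != 0.
  by case/andP: alpha01 => a0 _; rewrite mulf_neq0 ?gt_eqF // exponent_gt0.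
by rewrite /atom_const !mulr_ge0 ?powR_ge0 ?moment_const_ge0 ?addr_ge0 ?geom_const_ge0.
Qed.

(** A block has at most [M s * m s] indices, each of weight at most 1 / M s, hence total weight at
    most [B]. *)
Lemma log_sum_blocks (F b : nat -> R) S : (forall k, 0 <= F k) ->
  (forall s k, (s < S)%N -> (M s <= k < M s.+1)%N -> F k <= b s) ->
  \sum_(1 <= k < M S) k%:R^-1 * F k <= B%:R * \sum_(0 <= s < S) b s.
Proof.
move=> F0; elim: S => [|S IH] hb; first by rewrite vilenkin_base0 !big_geq // mulr0.
rewrite (big_cat_nat _ (n := M S)) ?vilenkin_base_gt0 ?leq_vilenkin_base //=.
rewrite big_nat_recr //= mulrDr lerD //.
  by apply: IH => s k sS; apply: hb; exact: ltnW.
have b0 : 0 <= b S.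
  apply: le_trans (F0 (M S)) (hb S (M S) (ltnSn _) _).
  by rewrite leqnn (ltn_vilenkin_base m_ge2).
apply: (@le_trans _ _ (\sum_(M S <= k < M S.+1) (M S)%:R^-1 * b S)).
  rewrite big_nat [leRHS]big_nat; apply: ler_sum => k kS.
  have k0 : (0 < k)%N by case/andP: kS => /(leq_trans _) H _; apply: H; exact: vilenkin_base_gt0.
  rewrite ler_pM ?invr_ge0 ?ler0n ?hb // lef_pV2 ?posrE ?ltr0n ?vilenkin_base_gt0 //.
  by rewrite ler_nat; case/andP: kS.
rewrite sumr_const_nat -[_ *+ _]mulr_natl mulrA ler_wpM2r //.
rewrite ler_pdivrMr ?ltr0n ?vilenkin_base_gt0 // -natrM ler_nat.
apply: leq_trans (leq_subr _ _) _; rewrite vilenkin_baseS mulnC.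
by rewrite leq_mul2r m_le orbT.
Qed.

Lemma atom_log_mean : log_mean a <= atom_const * N.+1%:R * (A `^ p / (M h)%:R).
Proof.
have [a0 a1] := andP alpha01; have p0 := exponent_gt0.
have ap : 0 < alpha * p by rewrite mulr_gt0.
have ap0 : alpha * p != 0 by rewrite gt_eqF.
have K0 := kernel_const_ge0; have K1 := pointwise_const_ge0.
have K2 := moment_const_ge0.
pose X : R := (A * kernel_const * pointwise_const) `^ p * (moment_const * (M h)%:R^-1).
pose r s : R := base_pow (alpha * p) h / base_pow (alpha * p) s.
have X0 : 0 <= X by rewrite !mulr_ge0 ?powR_ge0 ?invr_ge0.
have r0 s : 0 <= r s by rewrite divr_ge0 ?base_pow_ge0.
apply: le_trans (log_sum_blocks (b := fun s => if (h <= s)%N then X * (1 + h.+1%:R * r s) else 0) _ _) _.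
- by move=> k; apply: level_mean_ge0 => x; exact: powR_ge0.
- move=> s k sN ks.
  have kN : (k <= M N)%N.
    by case/andP: ks => _ /ltnW/leq_trans; apply; exact: leq_vilenkin_base.
  (* In a block below the level of the atom every index is at most [M h], so all the means
     vanish. *)
  case: (leqP h s) => hs; last first.
    case: a_cancel => [h0|am]; first by rewrite h0 in hs.
    have kh : (k <= M h)%N.
      by case/andP: ks => _ /ltnW/leq_trans; apply; exact: leq_vilenkin_base.
    rewrite (_ : (fun x => maxfun (noerlund k a) x `^ p) = fun=> 0).
      by rewrite /level_mean big1 ?mulr0.
    apply/funext => x; have -> : maxfun (noerlund k a) x = 0; last by rewrite powR0 ?gt_eqF.
    apply/eqP; rewrite eq_le maxfun_ge0 andbT; apply: maxfun_le => // i iN.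
    rewrite (_ : noerlund k a = fun=> 0); last by apply/funext => z; exact: atom_noerlund0.
    by rewrite /level_expect big1 ?mulr0 ?Normc.normc0.
  apply: (@le_trans _ _ (mean (fun x => (A * kernel_const * pointwise_const) `^ p *
      atom_majorant s x `^ p))).
    apply: level_mean_le => x.
    rewrite -powRM ?mulr_ge0 ?atom_majorant_ge0 //.
    rewrite ge0_ler_powR ?(ltW p0) ?nnegrE ?maxfun_ge0 ?mulr_ge0 ?atom_majorant_ge0 //.
    exact: atom_maxfun.
  rewrite level_meanZ /X -[leRHS]mulrA ler_wpM2l ?powR_ge0 //.
  exact: mean_atom_majorant.
have g0 : 0 <= geom_const (alpha * p) by exact: geom_const_ge0.
have sumr : \sum_(h <= s < N) r s <= geom_const (alpha * p).
  have lt0 : - (alpha * p) < 0 by rewrite oppr_lt0.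
  have := base_pow_sum_tail h N lt0; rewrite {1}/geom_const normrN -/(geom_const _) => t1.
  have e1 s : r s = base_pow (alpha * p) h * base_pow (- (alpha * p)) s.
    by rewrite /r /base_pow powRN.
  under eq_bigr => s _ do rewrite e1.
  rewrite -mulr_sumr; apply: le_trans (ler_wpM2l (base_pow_ge0 _ _) t1) _.
  rewrite mulrCA -base_powD subrr /base_pow powRr0 mulr1.
  exact: lexx.
(* The factor [h.+1], at most [N.+1], multiplies a convergent geometric sum and is paid once; the
   constant term is paid at most [N] times. *)
have bsum : \sum_(0 <= s < N) (if (h <= s)%N then X * (1 + h.+1%:R * r s) else 0) <=
    X * (N.+1%:R * (1 + geom_const (alpha * p))).
  rewrite (big_cat_nat _ (n := h)) //= big_nat big1 ?add0r => [|s /andP[_ sh]]; last first.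
    by rewrite leqNgt sh.
  rewrite big_nat (eq_bigr (fun s => X * (1 + h.+1%:R * r s))) => [|s /andP[-> //]].
  rewrite -big_nat -mulr_sumr ler_wpM2l // big_split /= -mulr_sumr.
  rewrite sumr_const_nat mulrDr mulr1 lerD //.
    by rewrite ler_nat (leq_trans (leq_subr _ _)).
  by rewrite ler_pM ?ler0n ?sumr_ge0 // ler_nat ltnS.
apply: le_trans (ler_wpM2l _ bsum) _ => //.
have eA : (A * kernel_const * pointwise_const) `^ p =
    A `^ p * (kernel_const * pointwise_const) `^ p.
  by rewrite -powRM ?mulr_ge0 // mulrA.
rewrite /X eA /atom_const.
by rewrite le_eqVlt; apply/orP; left; apply/eqP; ring.
Qed.

End Atom.
End AtomEstimate.


(** * Atomic decomposition *)

Section AtomicDecomposition.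
Variables (R : realType) (m : nat -> nat) (B N : nat) (p : R).
Hypothesis m_ge2 : forall n, (2 <= m n)%N.
Hypothesis m_le : forall n, (m n <= B)%N.
Hypothesis p01 : 0 < p <= 1.
Local Notation nrm := (@Normc.normc R).
Local Notation M := (vilenkin_base m).
Local Notation mean := (level_mean m N).
Local Notation maxfun := (maxfun m N).

Variables (Psi : (nat -> R[i]) -> R) (L : R).
Hypothesis L_ge0 : 0 <= L.
Hypothesis PsiD : forall g h, Psi (fun x => g x + h x) <= Psi g + Psi h.
Hypothesis Psi_atom : forall h e a A, (h <= N)%N -> 0 <= A ->
  (forall y, ~~ near_level m h e y -> a y = 0) -> (forall y, nrm (a y) <= A) ->
  h = 0%N \/ \sum_(0 <= y < M N) a y = 0 -> Psi a <= L * (A `^ p / (M h)%:R).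

Lemma Psi0 : Psi (fun=> 0) <= 0.
Proof.
have p0 : p != 0 by rewrite gt_eqF //; case/andP: p01.
have -> : 0 = L * (0 `^ p / (M 0)%:R) :> R by rewrite powR0 // mul0r mulr0.
apply: (@Psi_atom 0 0) => // [y|]; first by rewrite Normc.normc0.
by left.
Qed.

Lemma Psi_sum (I : Type) (r : seq I) (G : I -> nat -> R[i]) :
  Psi (fun x => \sum_(i <- r) G i x) <= \sum_(i <- r) Psi (G i).
Proof.
elim: r => [|i r IH].
  by rewrite big_nil; under [X in Psi X]eq_fun => x do rewrite big_nil; exact: Psi0.
rewrite big_cons; under [X in Psi X]eq_fun => x do rewrite big_cons.
by rewrite (le_trans (PsiD _ _)) // lerD2l.
Qed.

Variable g : nat -> R[i].
Hypothesis g_level : of_level m N g.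
Local Notation phi i := (level_expect m N i g).

(* Taking the maximum over the class of [x] at level [i.-1] rather than [i] makes
   the majorant of [phi n.+1] measurable at level [n]; boundedness of [m] keeps its
   distribution comparable with that of the maximal function. *)
Definition predictable_max n x : R :=
  \big[Order.max/0]_(i < N.+1 | (i <= n.+1)%N)
    \big[Order.max/0]_(y < M N | near_level m i.-1 x y) nrm (phi i y).
Local Notation lam := predictable_max.

Lemma expect_mod i y : (i <= N)%N -> phi i (y %% M N)%N = phi i y.
Proof.
move=> iN; apply: (level_expect_level N g); apply: near_level_le iN _.
exact: near_level_mod.
Qed.

Lemma predictable_max_ge n x i y : (i <= n.+1)%N -> (i <= N)%N ->
  near_level m i.-1 x y -> nrm (phi i y) <= lam n x.
Proof.
move=> in1 iN xy.
have yN : (y %% M N < M N)%N by rewrite ltn_mod vilenkin_base_gt0.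
apply: le_trans (le_bigmax_cond 0 (fun i : 'I_N.+1 =>
   \big[Order.max/0]_(y < M N | near_level m i.-1 x y) nrm (phi i y))
   (j := Ordinal (iN : (i < N.+1)%N)) in1) => /=.
rewrite -(expect_mod y iN).
apply: (le_bigmax_cond 0 (fun y : 'I_(M N) => nrm (phi i y)) (j := Ordinal yN)) => /=.
apply: near_level_trans xy _; rewrite near_level_sym.
by apply: near_level_le (near_level_mod m N y); exact: leq_trans (leq_pred _) iN.
Qed.

Lemma predictable_max_le n x K : 0 <= K ->
  (forall i y, (i <= n.+1)%N -> (i <= N)%N -> near_level m i.-1 x y -> nrm (phi i y) <= K) ->
  lam n x <= K.
Proof.
move=> K0 h; apply/bigmax_leP; split => // i iN; apply/bigmax_leP; split => // y xy.
by apply: h => //; rewrite -ltnS.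
Qed.

Lemma predictable_max_ge0 n x : 0 <= lam n x.
Proof. by apply: le_trans (@predictable_max_ge n x 0 x _ _ _); rewrite ?normc_ge0 // near_level_refl. Qed.

Lemma predictable_max_level n : of_level m n (lam n).
Proof.
suff H x y : near_level m n x y -> lam n x <= lam n y.
  by move=> x y xy; apply/eqP; rewrite eq_le !H // near_level_sym.
move=> xy; apply: predictable_max_le (predictable_max_ge0 _ _) _ => i z i1 iN xz.
apply: predictable_max_ge => //; apply: near_level_trans xz.
by rewrite near_level_sym; apply: near_level_le xy; case: i i1 {iN}.
Qed.

Lemma predictable_max_mono n k x : (n <= k)%N -> lam n x <= lam k x.
Proof.
move=> nk; apply: predictable_max_le (predictable_max_ge0 _ _) _ => i z i1 iN xz.
by apply: predictable_max_ge => //; exact: leq_trans i1 _.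
Qed.

Lemma predictable_max_gtP n x t : 0 <= t -> t < lam n x ->
  exists i y, [/\ (i <= n.+1)%N, (i <= N)%N, near_level m i.-1 x y & t < nrm (phi i y)].
Proof.
move=> t0; apply: contraPP => h; apply/negP; rewrite -leNgt.
apply: predictable_max_le => // i y i1 iN xy; rewrite leNgt; apply/negP => ty.
by apply: h; exists i, y.
Qed.

Local Notation f' := (maxfun g).
Local Notation mu := (mean (fun x => f' x `^ p)).

Lemma expect_le_maxfun i x y : (i <= N)%N -> near_level m i y x -> nrm (phi i y) <= f' x.
Proof. by move=> iN yx; rewrite (level_expect_level N g yx); exact: maxfun_ge. Qed.

(* The lowest threshold is chosen so large that stopping there never happens at
   level 0, yet its contribution is controlled by the norm of [g]. *)
Variable t0 : R.
Hypothesis t0_gt0 : 0 < t0.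
Hypothesis t0_pow : t0 `^ p = B%:R * mu.

(** A Chebyshev argument: only the levels 0 and 1 enter, whose cylinders have measure at least 1 /
    B, and on such a cylinder the maximal function is at least the modulus of the conditional
    expectation. *)
Lemma predictable_max0 x : lam 0 x <= t0.
Proof.
have [p0 p1] := andP p01.
apply: predictable_max_le (ltW t0_gt0) _ => i y i1 iN _.
rewrite leNgt; apply/negP => lt.
have : t0 `^ p < nrm (phi i y) `^ p.
  by rewrite gt0_ltr_powR // ?nnegrE ?normc_ge0 // ltW.
apply/negP; rewrite -leNgt t0_pow.
have MB : (M i)%:R <= B%:R :> R.
  rewrite ler_nat; case: i i1 {iN lt} => [|[|//]] _.
    by rewrite vilenkin_base0; apply: leq_trans (m_le 0%N); apply: leq_trans (m_ge2 0%N).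
  by rewrite vilenkin_baseS vilenkin_base0 mul1n.
have le : nrm (phi i y) `^ p * (M i)%:R^-1 <= mu.
  rewrite -(level_mean_indicator m_ge2 R y iN) -level_meanZ.
  apply: level_mean_le => z; have [yz|_] := boolP (near_level m i y z); last first.
    by rewrite mulr0 powR_ge0.
  rewrite mulr1 ge0_ler_powR ?nnegrE ?normc_ge0 ?maxfun_ge0 ?(ltW p0) //.
  exact: expect_le_maxfun.
have mu0 : 0 <= mu by apply: level_mean_ge0 => z; exact: powR_ge0.
apply: le_trans (ler_wpM2r mu0 MB); rewrite mulrC -ler_pdivrMr ?base_gt0 //.
Qed.

Definition threshold j : R := 2 ^+ j * t0.
Local Notation th := threshold.

Lemma threshold_gt0 j : 0 < th j.
Proof. by rewrite mulr_gt0 // exprn_gt0. Qed.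

Lemma thresholdS j : th j.+1 = 2 * th j.
Proof. by rewrite /threshold exprS mulrA. Qed.

Lemma threshold_le j k : (j <= k)%N -> th j <= th k.
Proof. by move=> jk; rewrite ler_wpM2r ?(ltW t0_gt0) // ler_weXn2l // ler1n. Qed.

(* The majorant is nondecreasing in [n], so that the increments kept here form an
   initial segment: this is the martingale stopped before it exceeds [th j]. *)
Definition stopped_upto j t x : R[i] :=
  phi 0%N x + \sum_(0 <= n < t) (lam n x <= th j)%R%:R * (phi n.+1 x - phi n x).

Lemma stopped_eq j t x : (forall n, (n < t)%N -> lam n x <= th j) ->
  stopped_upto j t x = phi t x.
Proof.
move=> h; rewrite /stopped_upto big_nat (eq_bigr (fun n => phi n.+1 x - phi n x)).
  by rewrite -big_nat telescope_sumr // addrC subrK.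
by move=> n /andP[_ /h ->]; rewrite mul1r.
Qed.

(** Predictability excludes overshoot: an increment is added only if [lam t x <= th j], and
    [lam t x] already bounds [phi t.+1 x]. *)
Lemma stopped_bound j t x : (t <= N)%N -> nrm (stopped_upto j t x) <= th j.
Proof.
elim: t => [|t IH] tN.
  rewrite /stopped_upto big_geq // addr0; apply: le_trans (threshold_le (leq0n j)).
  rewrite /threshold expr0 mul1r; apply: le_trans (predictable_max0 x).
  exact: predictable_max_ge (near_level_refl _ _ _).
have [lt|lt] := boolP (lam t x <= th j).
  rewrite stopped_eq => [|n nt]; last first.
    by apply: le_trans (predictable_max_mono x _) lt; rewrite -ltnS.
  by apply: le_trans lt; exact: predictable_max_ge (near_level_refl _ _ _).
have -> : stopped_upto j t.+1 x = stopped_upto j t x; last exact: IH (ltnW tN).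
by rewrite /stopped_upto big_nat_recr //= (negbTE lt) mul0r addr0.
Qed.

Definition stopped j x : R[i] := stopped_upto j N x.

Lemma stopped_top : exists K, stopped K = g.
Proof.
pose T : R := \sum_(0 <= i < N.+1) \sum_(0 <= y < M N) nrm (phi i y).
have S0 i : 0 <= \sum_(0 <= y < M N) nrm (phi i y).
  by rewrite sumr_ge0 // => y _; exact: normc_ge0.
have T0 : 0 <= T by rewrite sumr_ge0.
have lamT n x : lam n x <= T.
  apply: predictable_max_le => // i y _ iN _; rewrite -(expect_mod y iN).
  apply: (@le_trans _ _ (\sum_(0 <= y < M N) nrm (phi i y))).
    apply: (@le_sum_nat R (fun y => nrm (phi i y)) 0 (M N)) => [z|].
      exact: normc_ge0.
    by rewrite ltn_mod vilenkin_base_gt0.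
  exact: (@le_sum_nat R (fun i => \sum_(0 <= y < M N) nrm (phi i y))).
have [K hK] : exists K, T <= th K.
  pose K := Num.trunc (T / t0); exists K.+1.
  rewrite /threshold -ler_pdivrMr //.
  have := truncnS_gt (T / t0); rewrite -/K => /ltW/le_trans; apply.
  by rewrite -natrX ler_nat ltnW // ltn_expl.
exists K; apply/funext => x; rewrite /stopped stopped_eq => [|n _]; last first.
  exact: le_trans (lamT _ _) hK.
by rewrite level_expect_id.
Qed.

Definition piece j x : R[i] := stopped j.+1 x - stopped j x.

Lemma pieceE j x : piece j x = \sum_(0 <= n < N)
  ((lam n x <= th j.+1)%R%:R - (lam n x <= th j)%R%:R) * (phi n.+1 x - phi n x).
Proof.
rewrite /piece /stopped /stopped_upto opprD addrACA subrr add0r -sumrB.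
by apply: eq_bigr => n _; rewrite mulrBl.
Qed.

(** The event that the stopping time of threshold [j] equals [h]. As [lam] is nondecreasing in time,
    comparing with the preceding value is enough; at [h = 0] the predecessor would be 0 again,
    whence the disjunct. *)
Definition first_exceed j h x : bool :=
  (th j < lam h x) && ((h == 0%N) || (lam h.-1 x <= th j)).

Lemma first_exceed_level j h : of_level m h (first_exceed j h).
Proof.
move=> x y xy; rewrite /first_exceed (predictable_max_level xy).
by rewrite (predictable_max_level (near_level_le (leq_pred h) xy)).
Qed.

Lemma first_exceed_sum (F : nzRingType) j t x : \sum_(0 <= h < t) (first_exceed j h x)%:R =
  ((0 < t)%N && (th j < lam t.-1 x))%:R :> F.
Proof.
elim: t => [|t IH]; first by rewrite big_geq.
rewrite big_nat_recr //= IH /first_exceed; case: t {IH} => [|t] /=.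
  by rewrite add0r andbT.
have := predictable_max_mono x (leqnSn t).
case: (ltP (th j) (lam t x)) => h1 h2; last by rewrite andbT add0r.
by rewrite (lt_le_trans h1 h2) andbF addr0.
Qed.

Definition cylinder_atom j h e x : R[i] :=
  (near_level m h e x && first_exceed j h e)%:R * piece j x.

(** A point determines at most one stopping time and one cylinder of that level. If it never exceeds
    [th j], all truncation indicators equal 1 and the piece vanishes there. *)
Lemma piece_decomposition j : piece j =
  fun x => \sum_(0 <= h < N) \sum_(0 <= e < M h) cylinder_atom j h e x.
Proof.
apply/funext => x.
have -> : \sum_(0 <= h < N) \sum_(0 <= e < M h) cylinder_atom j h e x =
    (\sum_(0 <= h < N) (first_exceed j h x)%:R) * piece j x.
  rewrite mulr_suml; apply: eq_bigr => h _; rewrite -mulr_suml; congr (_ * _).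
  have xh : (x %% M h < M h)%N by rewrite ltn_mod vilenkin_base_gt0.
  rewrite big_mkord (bigD1 (Ordinal xh)) //= near_level_mod big1 => [|e ne].
    by rewrite addr0 (first_exceed_level j (near_level_mod m h x)).
  rewrite /near_level [(e %% _)%N]modn_small //.
  by case: eqP => // ex; case/eqP: ne; exact/val_inj.
rewrite first_exceed_sum; case: ltnP => N0 /=; last first.
  by rewrite pieceE big_geq // mulr0.
case: ltP => h; first by rewrite mul1r.
rewrite mul0r pieceE big_nat big1 // => n /andP[_ nN].
have h' : lam n x <= th j.
  by apply: le_trans (predictable_max_mono x _) h; rewrite -ltnS prednK.
by rewrite h' (le_trans h' (threshold_le (leqnSn _))) subrr mul0r.
Qed.

(** A martingale transform has mean 0: the multiplier is known at level [n], so against it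
    [phi n.+1] and [phi n] both have the same sum as [g]. *)
Lemma transform_sum0 h n e (k : nat -> R[i]) : (h <= n)%N -> (n < N)%N -> of_level m n k ->
  \sum_(0 <= y < M N | near_level m h e y) k y * (phi n.+1 y - phi n y) = 0.
Proof.
move=> hn nN kl.
have E i : (n <= i)%N -> (i <= N)%N ->
   \sum_(0 <= y < M N | near_level m h e y) k y * phi i y =
   \sum_(0 <= y < M N | near_level m h e y) k y * g y.
  move=> ni iN; rewrite -[RHS](level_expect_class_sum m_ge2 _ _ (leq_trans hn ni) iN).
  apply: eq_bigr => y _; rewrite /level_expect mulrCA; congr (_ * _).
  rewrite mulr_sumr; apply: eq_bigr => z yz; congr (_ * _).
  exact: kl (near_level_le ni yz).
under eq_bigr => y _ do rewrite mulrBr.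
by rewrite sumrB !E ?subrr // ltnW.
Qed.

(** Increments before time [h] cancel because neither threshold has been passed on the cylinder;
    those from time [h] on have mean 0 by [transform_sum0]. *)
Lemma cylinder_atom_mean0 j h e : (h < N)%N ->
  \sum_(0 <= y < M N) cylinder_atom j h e y = 0.
Proof.
move=> hN; have [fe|nfe] := boolP (first_exceed j h e); last first.
  by rewrite big1 // => y _; rewrite /cylinder_atom (negbTE nfe) andbF mul0r.
transitivity (\sum_(0 <= y < M N | near_level m h e y) piece j y).
  rewrite [RHS]big_mkcond; apply: eq_bigr => y _.
  by rewrite /cylinder_atom fe andbT; case: ifP; rewrite ?mul1r ?mul0r.
under eq_bigr => y _ do rewrite pieceE.
rewrite exchange_big /= big_nat big1 // => n /andP[_ nN].
case: (leqP h n) => hn.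
  apply: (@transform_sum0 h n e (fun y => (lam n y <= th j.+1)%R%:R - (lam n y <= th j)%R%:R)) => //.
  by move=> x y xy; rewrite (predictable_max_level xy).
rewrite big1 // => y ey.
have h' : lam n y <= th j.
  have : first_exceed j h y by rewrite -(first_exceed_level j ey).
  case/andP => _ /orP[/eqP h0|]; first by rewrite h0 in hn.
  by apply: le_trans; apply: predictable_max_mono; case: h hn {hN fe ey}.
by rewrite h' (le_trans h' (threshold_le (leqnSn _))) subrr mul0r.
Qed.

(** The height [3 * th j] is [th j.+1 + th j], from the two stopped martingales. *)
Lemma cylinder_atom_Psi j h e : (h < N)%N ->
  Psi (cylinder_atom j h e) <= L * (3 * th j) `^ p * ((first_exceed j h e)%:R / (M h)%:R).
Proof.
move=> hN; have [fe|nfe] := boolP (first_exceed j h e); last first.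
  rewrite mul0r mulr0 (_ : cylinder_atom j h e = fun=> 0); first exact: Psi0.
  by apply/funext => x; rewrite /cylinder_atom (negbTE nfe) andbF mul0r.
rewrite mul1r -mulrA; apply: (@Psi_atom h e) => //.
- exact: ltnW.
- by rewrite mulr_ge0 // ltW // threshold_gt0.
- by move=> y /negbTE ney; rewrite /cylinder_atom ney mul0r.
- move=> y; rewrite /cylinder_atom Normc.normcM.
  apply: (@le_trans _ _ (nrm (piece j y))).
    rewrite ler_piMl ?normc_ge0 //.
    by case: (_ && _); rewrite ?Normc.normc1 ?Normc.normc0.
  rewrite /piece (le_trans (le_normcD _ _)) // normcN.
  have := stopped_bound j y (leqnn N); have := stopped_bound j.+1 y (leqnn N).
  by rewrite thresholdS /stopped; lra.
- by right; exact: cylinder_atom_mean0.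
Qed.

(** If the threshold is first passed at time [h], some [phi i] with [i <= h.+1] exceeds it at a
    point [y] of the cylinder. On the subcylinder of level [h.+1] around [y] the maximal function
    exceeds it too, and that subcylinder carries at least the fraction 1 / B. *)
Lemma first_exceed_measure j h : (h < N)%N ->
  \sum_(0 <= e < M h) ((first_exceed j h e)%:R / (M h)%:R) <=
  B%:R * mean (fun x => (first_exceed j h x)%:R * (th j < f' x)%R%:R) :> R.
Proof.
move=> hN; rewrite /level_mean (class_sum_range m_ge2 _ (ltnW hN)) mulrA mulr_sumr.
rewrite big_nat [leRHS]big_nat; apply: ler_sum => e _.
have [fe|nfe] := boolP (first_exceed j h e); last first.
  by rewrite mul0r mulr_ge0 ?mulr_ge0 ?invr_ge0 ?sumr_ge0.
have [i [y [i1 iN ey ty]]] : exists i y, [/\ (i <= h.+1)%N, (i <= N)%N,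
    near_level m h e y & th j < nrm (phi i y)].
  case/andP: (fe) => /(predictable_max_gtP (ltW (threshold_gt0 j))).
  move=> [i [y [i1 iN ey ty]]] hh; exists i, y; split => //.
  case: (posnP h) => [->|h0]; first exact: near_level0.
  (* A level [i <= h] would have made [lam h.-1] exceed the threshold, so [i = h.+1] and [y] is near
     [e] at level [h]. *)
  move: i1; rewrite leq_eqVlt => /orP[/eqP ei|ih]; first by rewrite ei in ey.
  case/orP: hh => [/eqP h00|le]; first by rewrite h00 in h0.
  have : nrm (phi i y) <= lam h.-1 e by apply: predictable_max_ge => //; rewrite prednK.
  by move=> /(lt_le_trans ty)/lt_le_trans/(_ le); rewrite ltxx.
apply: (@le_trans _ _ (B%:R * (M N)%:R^-1 * \sum_(0 <= z < M N | near_level m h.+1 y z) 1)).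
  rewrite (class_sum_level m_ge2 (g := fun=> 1)) // (base_div m_ge2 R) // mulrA divfK ?base_neq0 //.
  rewrite ler_pdivrMr ?base_gt0 // mulrAC ler_pdivlMr ?base_gt0 // mul1r.
  by rewrite -natrM ler_nat vilenkin_baseS mulnC leq_mul2r m_le orbT.
rewrite ler_wpM2l ?mulr_ge0 ?invr_ge0 // big_mkcond [leRHS]big_mkcond.
apply: ler_sum => z _; case: ifPn => yz; last first.
  by case: ifP => // _; rewrite mulr_ge0.
have ez : near_level m h e z.
  by apply: near_level_trans ey _; exact: near_level_le yz.
rewrite ez -(first_exceed_level j ez) fe mul1r.
rewrite (lt_le_trans ty) //; apply: expect_le_maxfun => //.
exact: near_level_le yz.
Qed.

(** A dyadic layer-cake estimate: the powers of the thresholds below [v] grow geometrically, so the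
    largest one dominates. *)
Lemma threshold_sum K v : 0 <= v ->
  \sum_(0 <= j < K) th j `^ p * (th j < v)%R%:R <= (1 - 2 `^ (- p))^-1 * v `^ p.
Proof.
move=> v0; have [p0 p1] := andP p01.
have c01 : 0 <= (2 : R) `^ (- p) < 1.
  by have := geom_ratio (lt0r_neq0 p0); rewrite gtr0_norm.
have g0 : 0 <= (1 - 2 `^ (- p))^-1 :> R.
  by rewrite invr_ge0 subr_ge0 ltW //; case/andP: c01.
elim: K => [|K IH]; first by rewrite big_geq // mulr_ge0 ?powR_ge0.
have [lt|le] := ltP (th K) v; last first.
  by rewrite big_nat_recr //= ltNge le mulr0 addr0.
apply: (@le_trans _ _ (\sum_(0 <= j < K.+1) th j `^ p)).
  apply: ler_sum => j _; rewrite ler_piMr ?powR_ge0 //.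
  by case: (_ < _).
apply: le_trans (sum_geometric_increasing K c01 _ _) _.
- by move=> l; exact: powR_ge0.
- move=> l; rewrite thresholdS powRM ?(ltW (threshold_gt0 l)) // mulrA -powRD.
    by rewrite addNr powRr0 mul1r.
  by rewrite pnatr_eq0 implybT.
rewrite ler_wpM2l // ge0_ler_powR ?nnegrE ?(ltW p0) ?(ltW lt) //.
exact/ltW/threshold_gt0.
Qed.

(** The 1 accounts for the martingale stopped at the lowest threshold, the fraction for all the
    pieces. *)
Definition decomposition_const : R := B%:R * (1 + 3 `^ p / (1 - 2 `^ (- p))).

Lemma atomic_bound_pos : Psi g <= L * decomposition_const * mu.
Proof.
have [p0 p1] := andP p01.
have [K gK] := stopped_top.
have gE : g = fun x => stopped 0 x + \sum_(0 <= j < K) piece j x.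
  rewrite -[LHS]gK; apply/funext => x.
  by rewrite /piece telescope_sumr // addrC subrK.
rewrite [X in Psi X]gE; apply: le_trans (PsiD _ _) _.
have b0 : Psi (stopped 0) <= L * (B%:R * mu).
  have -> : B%:R * mu = t0 `^ p / (M 0)%:R by rewrite vilenkin_base0 divr1.
  apply: (@Psi_atom 0 0) => // [|y|y|].
  - exact: ltW.
  - by rewrite near_level0.
  - apply: le_trans (stopped_bound 0 y (leqnn N)) _.
    by rewrite /threshold expr0 mul1r.
  - by left.
have b1 j : Psi (piece j) <= L * 3 `^ p * B%:R *
    (th j `^ p * mean (fun x => (th j < f' x)%R%:R)).
  rewrite piece_decomposition.
  apply: le_trans (Psi_sum _ _) _.
  apply: (@le_trans _ _ (\sum_(0 <= h < N) \sum_(0 <= e < M h)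
      L * (3 * th j) `^ p * ((first_exceed j h e)%:R / (M h)%:R))).
    rewrite big_nat [leRHS]big_nat; apply: ler_sum => h /andP[_ hN].
    apply: le_trans (Psi_sum _ _) _.
    by apply: ler_sum => e _; exact: cylinder_atom_Psi.
  under eq_bigr => h _ do rewrite -mulr_sumr.
  rewrite -mulr_sumr powRM ?(ltW (threshold_gt0 j)) //.
  have -> : L * 3 `^ p * B%:R * (th j `^ p * mean (fun x => (th j < f' x)%R%:R)) =
    L * (3 `^ p * th j `^ p) * (B%:R * mean (fun x => (th j < f' x)%R%:R)) by ring.
  rewrite ler_wpM2l ?mulr_ge0 ?powR_ge0 //.
  apply: (@le_trans _ _ (\sum_(0 <= h < N)
      B%:R * mean (fun x => (first_exceed j h x)%:R * (th j < f' x)%R%:R))).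
    rewrite big_nat [leRHS]big_nat; apply: ler_sum => h /andP[_ hN].
    exact: first_exceed_measure.
  rewrite -mulr_sumr ler_wpM2l // -level_mean_sum.
  apply: level_mean_le => x; rewrite -mulr_suml ler_piMl //.
  by rewrite first_exceed_sum; case: (_ && _).
have b2 : Psi (fun x => \sum_(0 <= j < K) piece j x) <=
    L * 3 `^ p * B%:R * ((1 - 2 `^ (- p))^-1 * mu).
  apply: le_trans (Psi_sum _ _) _.
  apply: le_trans (ler_sum _ (fun j _ => b1 j)) _.
  rewrite -mulr_sumr ler_wpM2l ?mulr_ge0 ?powR_ge0 //.
  under eq_bigr => j _ do rewrite -level_meanZ.
  rewrite -level_mean_sum -level_meanZ; apply: level_mean_le => x.
  exact/threshold_sum/maxfun_ge0.
apply: le_trans (lerD b0 b2) _; rewrite /decomposition_const.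
by rewrite le_eqVlt; apply/orP; left; apply/eqP; ring.
Qed.

End AtomicDecomposition.

Lemma decomposition_const_ge0 (R : realType) B (p : R) : 0 < p -> 0 <= decomposition_const B p.
Proof.
move=> p0; have := geom_ratio (lt0r_neq0 p0); rewrite gtr0_norm // => /andP[_ h].
by rewrite mulr_ge0 // addr_ge0 // divr_ge0 ?powR_ge0 // subr_ge0 ltW.
Qed.

Theorem atomic_bound (R : realType) (m : nat -> nat) (B N : nat) (p : R)
    (Psi : (nat -> R[i]) -> R) (L : R) (g : nat -> R[i]) :
  (forall n, (2 <= m n)%N) -> (forall n, (m n <= B)%N) -> 0 < p <= 1 -> 0 <= L ->
  (forall g h, Psi (fun x => g x + h x) <= Psi g + Psi h) ->
  (forall h e a A, (h <= N)%N -> 0 <= A ->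
    (forall y, ~~ near_level m h e y -> a y = 0) ->
    (forall y, Normc.normc (a y) <= A) ->
    h = 0%N \/ \sum_(0 <= y < vilenkin_base m N) a y = 0 ->
    Psi a <= L * (A `^ p / (vilenkin_base m h)%:R)) ->
  of_level m N g ->
  Psi g <= L * decomposition_const B p *
    level_mean m N (fun x => maxfun m N g x `^ p).
Proof.
move=> m2 mB p01 L0 PsiD Psia gl; have [p0 p1] := andP p01.
set mu := level_mean _ _ _.
have mu0 : 0 <= mu by apply: level_mean_ge0 => x; exact: powR_ge0.
have B0 : 0 < B%:R :> R.
  by rewrite ltr0n; apply: leq_trans (mB 0%N); apply: leq_trans (m2 0%N).
(* The lowest threshold is the p-th root of [B * mu] and must be positive; when [mu = 0] the
   function itself is 0. *)
have [z|nz] := eqVneq mu 0; last first.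
  have pos : 0 < B%:R * mu by rewrite mulr_gt0 // lt_neqAle eq_sym nz.
  apply: (@atomic_bound_pos R m B N p m2 mB p01 Psi L L0 PsiD Psia g gl
      ((B%:R * mu) `^ p^-1)).
    by rewrite powR_gt0.
  by rewrite -powRrM mulVf ?gt_eqF // powRr1 // ltW.
have g0 y : g y = 0.
  have gy : g y = g (y %% vilenkin_base m N)%N.
    by apply: gl; rewrite near_level_sym near_level_mod.
  apply: Normc.eq0_normc; apply/eqP; rewrite eq_le normc_ge0 andbT.
  rewrite gy -(level_expect_id m2 (leqnn N) gl).
  apply: le_trans (maxfun_ge m _ _ (leqnn N)) _.
  set x := (y %% _)%N.
  have s0 : \sum_(0 <= y < vilenkin_base m N) maxfun m N g y `^ p = 0.
    move/eqP: z; rewrite mulf_eq0 invr_eq0 (negbTE (base_neq0 m2 R N)) /=.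
    by move/eqP.
  have le0 : maxfun m N g x `^ p <= 0.
    rewrite -s0; apply: (@le_sum_nat R (fun x => maxfun m N g x `^ p)).
      by move=> j; exact: powR_ge0.
    by rewrite ltn_mod vilenkin_base_gt0.
  have /eqP : maxfun m N g x `^ p = 0 by apply/eqP; rewrite eq_le le0 powR_ge0.
  by rewrite powR_eq0 => /andP[/eqP -> _].
rewrite (_ : g = fun=> 0); last by apply/funext.
apply: le_trans (@Psi0 R m N p p01 Psi L Psia) _.
apply: mulr_ge0 => //; apply: mulr_ge0 => //; exact: decomposition_const_ge0.
Qed.


(** * The logarithmic estimate on a finite quotient *)

Section FiniteTheorem.
Variables (R : realType) (m : nat -> nat) (B : nat).
Hypothesis m_ge2 : forall n, (2 <= m n)%N.
Hypothesis m_le : forall n, (m n <= B)%N.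
Variables (alpha : R) (q : nat -> R) (Cq : R).
Hypothesis alpha01 : 0 < alpha < 1.
Hypothesis q_ge0 : forall n, 0 <= q n.
Hypothesis q_ni : nonincreasing_seq q.
Hypothesis q0_gt0 : 0 < q 0%N.
Hypothesis Cq_ge0 : 0 <= Cq.
Hypothesis ratio : forall a n : nat, (0 < a)%N -> (a <= n)%N ->
  weight_sum q a <= Cq * (a%:R / n%:R) `^ alpha * weight_sum q n.
Local Notation p := ((1 + alpha)^-1).

Lemma maxfunD N (g h : nat -> R[i]) x :
  maxfun m N (fun y => g y + h y) x <= maxfun m N g x + maxfun m N h x.
Proof.
apply: maxfun_le => [|i iN]; first by rewrite addr_ge0 ?maxfun_ge0.
rewrite level_expectD (le_trans (le_normcD _ _)) // lerD //; exact: maxfun_ge.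
Qed.

Lemma noerlundD N n (g h : nat -> R[i]) :
  noerlund m q N n (fun y => g y + h y) =
  fun x => noerlund m q N n g x + noerlund m q N n h x.
Proof.
apply/funext => x; rewrite /noerlund /level_mean -mulrDr -big_split /=.
by congr (_ * _); apply: eq_bigr => y _; rewrite mulrDl.
Qed.

Lemma log_meanD N (g h : nat -> R[i]) :
  log_mean m alpha q N (fun y => g y + h y) <=
  log_mean m alpha q N g + log_mean m alpha q N h.
Proof.
have p01 := exponent_bounds alpha01; have [p0 p1] := andP p01.
rewrite /log_mean -big_split /=; apply: ler_sum => k _; rewrite -mulrDr.
rewrite ler_wpM2l ?invr_ge0 // -level_meanD; apply: level_mean_le => x.
apply: le_trans (ge0_powRD p01 (maxfun_ge0 _ _ _ _) (maxfun_ge0 _ _ _ _)).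
rewrite noerlundD ge0_ler_powR ?(ltW p0) ?nnegrE ?addr_ge0 ?maxfun_ge0 //.
exact: maxfunD.
Qed.

Definition total_const : R :=
  atom_const B alpha Cq * decomposition_const B p.

Lemma total_const_ge0 : 0 <= total_const.
Proof.
apply: mulr_ge0; first exact: atom_const_ge0.
by apply: decomposition_const_ge0; exact: exponent_gt0.
Qed.

Lemma log_mean_bound N (g : nat -> R[i]) : of_level m N g ->
  log_mean m alpha q N g <= total_const * N.+1%:R *
    level_mean m N (fun x => maxfun m N g x `^ p).
Proof.
move=> gl; have p01 := exponent_bounds alpha01.
have K0 : 0 <= atom_const B alpha Cq by exact: atom_const_ge0.
apply: le_trans (atomic_bound (B := B) m_ge2 m_le p01
   (L := atom_const B alpha Cq * N.+1%:R) _ (@log_meanD N) _ gl) _.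
- exact: mulr_ge0.
- move=> h e a A hN A0 supp bnd canc.
  exact: (atom_log_mean m_ge2 m_le alpha01 q_ge0 q_ni q0_gt0 Cq_ge0 ratio hN A0 supp bnd canc).
by rewrite /total_const le_eqVlt; apply/orP; left; apply/eqP; ring.
Qed.

End FiniteTheorem.

(** * From the group to residue classes *)

Section Points.
Variable m : nat -> nat.
Hypothesis m_ge2 : forall n, (2 <= m n)%N.
Local Notation M := (vilenkin_base m).
Local Notation digit := (vilenkin_digit m).

Definition point_of (j : nat) : vilenkin_group m := fun k => inZp (digit j k).

Definition index_of n (x : vilenkin_group m) : nat := (\sum_(k < n) x k * M k)%N.

Lemma point_ofE j k : (point_of j k : nat) = digit j k.
Proof. by rewrite /= Zp_cast ?modn_small ?vilenkin_digit_lt. Qed.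

Lemma coord_lt (x : vilenkin_group m) k : (x k < m k)%N.
Proof. by rewrite -[X in (_ < X)%N](Zp_cast (m_ge2 k)). Qed.

Lemma index_ofS n x : index_of n.+1 x = (x n * M n + index_of n x)%N.
Proof. by rewrite /index_of big_ord_recr addnC. Qed.

Lemma index_of_lt n x : (index_of n x < M n)%N.
Proof.
elim: n => [|n IH]; first by rewrite /index_of big_ord0 vilenkin_base0.
rewrite index_ofS vilenkin_baseS.
have : ((x n).+1 * M n <= m n * M n)%N by rewrite leq_mul2r coord_lt orbT.
by rewrite mulSn [(M n * m n)%N]mulnC; lia.
Qed.

Lemma digit_index n x k : (k < n)%N -> digit (index_of n x) k = x k.
Proof.
elim: n => [//|n IH]; rewrite ltnS leq_eqVlt => /orP[/eqP ->|kn]; rewrite index_ofS.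
  by rewrite digit_rec // ?index_of_lt // coord_lt.
by rewrite (@digitD_lt _ _ _ n) ?dvdn_mull // IH.
Qed.

Lemma cylinder_pointP n i j :
  cylinder n (point_of i) (point_of j) <-> near_level m n i j.
Proof.
split=> [h|/eq_modnP h k kn].
  apply/eq_modnP => k kn; have := congr1 (@nat_of_ord _) (h k kn).
  by rewrite !point_ofE => ->.
by apply: val_inj; change (point_of j k = point_of i k :> nat); rewrite !point_ofE h.
Qed.

Lemma cylinder_sym n (x y : vilenkin_group m) : cylinder n x y -> cylinder n y x.
Proof. by move=> h k kn; rewrite h. Qed.

Lemma cylinder_trans n (x y z : vilenkin_group m) :
  cylinder n x y -> cylinder n y z -> cylinder n x z.
Proof. by move=> h h' k kn; rewrite h' // h. Qed.

Lemma cylinder_le n k (x y : vilenkin_group m) : (n <= k)%N ->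
  cylinder k x y -> cylinder n x y.
Proof. by move=> nk h c cn; rewrite h // (leq_trans cn). Qed.

Lemma cylinder_index n x : cylinder n (point_of (index_of n x)) x.
Proof. by move=> k kn; apply: val_inj; change (x k = point_of (index_of n x) k :> nat); rewrite point_ofE digit_index. Qed.

Lemma index_point n j : index_of n (point_of j) = (j %% M n)%N.
Proof.
have := @cylinder_index n (point_of j); move/cylinder_pointP => /eqP.
by rewrite modn_small ?index_of_lt.
Qed.

Definition saturated n (A : set (vilenkin_group m)) :=
  forall x y, cylinder n x y -> A x -> A y.

Lemma cylinder_saturated n k x : (n <= k)%N -> saturated k (cylinder n x).
Proof.
by move=> nk y z yz xy; exact: cylinder_trans xy (cylinder_le nk yz).
Qed.

Lemma saturated_bigcup n A : saturated n A ->
  A = \bigcup_j (if `[< A (point_of j) >] then cylinder n (point_of j) else set0).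
Proof.
move=> sA; apply/seteqP; split => [x Ax|x [j _]].
  exists (index_of n x) => //; case: asboolP => [_|]; first exact: cylinder_index.
  by case; apply: sA Ax; apply: cylinder_sym; exact: cylinder_index.
by case: asboolP => // Aj /sA; apply.
Qed.

Lemma sigma_saturated n : sigma_algebra setT (saturated n).
Proof.
split => [//|A sA x y xy|A sA x y xy [i _ Ai]].
  by rewrite !setTD => nAx Ay; apply: nAx; apply: sA Ay; exact: cylinder_sym.
by exists i => //; exact: sA xy Ai.
Qed.

(** Saturated sets form a sigma-algebra containing the generators. Conversely a saturated set is a
    countable union of cylinders around encoded points, repetitions being harmless. *)
Lemma filtrationP n (A : set (vilenkin_group m)) : filtration n A <-> saturated n A.
Proof.
split=> [h|sA].
  apply: (smallest_sub (sigma_saturated n) _ h) => _ [x _ <-].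
  exact: cylinder_saturated.
rewrite (saturated_bigcup sA); apply: sigma_algebra_bigcup => j.
case: asboolP => _; last exact: sigma_algebra0.
by apply: sub_sigma_algebra; exists (point_of j).
Qed.

Lemma saturated_measurable n (A : set (vilenkin_space m)) : saturated n A -> measurable A.
Proof.
move=> sA; rewrite (saturated_bigcup sA).
apply: bigcup_measurable => j _; case: asboolP => _; last exact: measurable0.
by apply: sub_sigma_algebra; exists n => //; exists (point_of j).
Qed.

Definition level_fun (V : Type) n (F : vilenkin_group m -> V) :=
  forall x y, cylinder n x y -> F x = F y.

Lemma level_fun_le V n k (F : vilenkin_group m -> V) : (n <= k)%N ->
  level_fun n F -> level_fun k F.
Proof. by move=> nk h x y xy; apply: h; exact: cylinder_le xy. Qed.

Lemma level_fun_of_level V n (F : vilenkin_group m -> V) :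
  level_fun n F -> of_level m n (F \o point_of).
Proof. by move=> h i j /cylinder_pointP; exact: h. Qed.

Lemma level_fun_index V n (F : vilenkin_group m -> V) x :
  level_fun n F -> F (point_of (index_of n x)) = F x.
Proof. by move=> h; apply: h; exact: cylinder_index. Qed.

Lemma index_level_fun V n (G : nat -> V) : level_fun n (G \o index_of n).
Proof.
move=> x y xy /=; congr G; apply: eq_bigr => k _.
by rewrite (xy k (ltn_ord k)).
Qed.

Lemma level_fun_measurable d (V : measurableType d) n (F : vilenkin_space m -> V) :
  level_fun n F -> measurable_fun setT F.
Proof.
move=> lF _ Y mY; rewrite setTI; apply: (@saturated_measurable n) => x y xy /=.
by rewrite (lF x y xy).
Qed.

End Points.


(** * Integrals, conditional expectations and Hardy norms *)

Section Measure.
Variables (R : realType) (m : nat -> nat) (mu : probability (vilenkin_space m) R).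
Hypothesis m_ge2 : forall n, (2 <= m n)%N.
Hypothesis mu_product : product_uniform mu.
Local Notation M := (vilenkin_base m).
Local Notation digit := (vilenkin_digit m).
Local Notation X := (vilenkin_space m).
Local Notation pt := (@point_of m).
Local Notation idx := (@index_of m).

Lemma cylinder_measure n x : mu (cylinder n x) = ((M n)%:R^-1)%:E.
Proof.
have := mu_product n (fun k => [set x k]%SET).
rewrite (_ : [set y | _] = cylinder n x); last first.
  apply/seteqP; split => y h k kn; first by apply/eqP; have := h k kn; rewrite finset.in_set1.
  by rewrite h // finset.in_set1.
move=> ->; congr (_%:E); rewrite /vilenkin_base.
under eq_bigr => k _ do rewrite cards1 mul1r.
by rewrite prodfV natr_prod.
Qed.

Lemma measurable_cylinder n x : measurable (cylinder n x : set X).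
Proof. by apply: (@saturated_measurable m m_ge2 n); exact: cylinder_saturated. Qed.

Lemma cylinder_cover n :
  [set: X] = \big[setU/set0]_(j <- index_iota 0 (M n)) cylinder n (pt j).
Proof.
rewrite -bigcup_seq; apply/seteqP; split => // x _.
exists (idx n x); last exact: cylinder_index.
by rewrite /= mem_index_iota index_of_lt.
Qed.

Lemma cylinder_trivIset n :
  trivIset [set` index_iota 0 (M n)] (fun j => cylinder n (pt j)).
Proof.
apply/trivIsetP => i j /=; rewrite !mem_index_iota /= => iM jM ij.
apply/seteqP; split => // x [ix jx]; case/eqP: ij.
have : near_level m n i j.
  by apply/cylinder_pointP => //; apply: cylinder_trans ix (cylinder_sym jx).
by rewrite /near_level !modn_small // => /eqP.
Qed.

Lemma integral_level n (F : X -> R) : level_fun n F ->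
  (\int[mu]_x (F x)%:E = (level_mean m n (F \o pt))%:E)%E.
Proof.
move=> lF; have mF : @measurable_fun _ _ X (\bar R) setT (EFin \o F).
  by apply: (@level_fun_measurable m m_ge2 _ _ n) => x y /lF /= ->.
have := @integral_bigsetU_EFin _ _ _ mu _ _ F _
  (fun j => @measurable_cylinder n (pt j)) (iota_uniq _ _) (@cylinder_trivIset n).
rewrite -cylinder_cover => /(_ mF) ->.
rewrite /level_mean mulr_sumr -sumEFin; apply: eq_bigr => j _.
rewrite (eq_integral (cst (F (pt j))%:E)); last first.
  by move=> x; rewrite inE => /lF ->.
rewrite integral_cst; last exact: measurable_cylinder.
transitivity ((F (pt j))%:E * ((M n)%:R^-1)%:E)%E; last by rewrite -EFinM mulrC.
by congr (_ * _)%E; exact: cylinder_measure.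
Qed.

Lemma integrable_level n (F : X -> R) : level_fun n F ->
  mu.-integrable setT (EFin \o F).
Proof.
move=> lF; apply/integrableP; split.
  by apply: (@level_fun_measurable m m_ge2 _ _ n) => x y /lF /= ->.
rewrite (_ : (fun x => _) = fun x => (`|F x|)%:E)%E //.
rewrite (@integral_level n (fun x => `|F x|)) ?ltry // => x y /lF -> //.
Qed.

Lemma Rintegral_level n (A : set X) (F : X -> R) : level_fun n F -> saturated n A ->
  Rintegral mu A F = level_mean m n (fun j => (\1_A (pt j) : R) * F (pt j)).
Proof.
move=> lF sA; rewrite /Rintegral integral_mkcond.
rewrite (_ : (_ \_ A) = fun x => (\1_A x * F x)%:E); last first.
  apply/funext => x; rewrite /patch indicE; case: ifP => _; first by rewrite mul1r.
  by rewrite mul0r.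
rewrite (@integral_level n (fun x => \1_A x * F x)) // => x y xy.
rewrite (lF x y xy) !indicE; congr (_%:R * _); congr nat_of_bool.
by apply/idP/idP; rewrite !inE; apply: sA => //; exact: cylinder_sym.
Qed.

Lemma complexE (z : R[i]) : z = (complex.Re z +i* complex.Im z)%C.
Proof. by case: z. Qed.

Lemma sum_complex (I : Type) (r : seq I) (F G : I -> R) :
  \sum_(i <- r) (F i +i* G i)%C = ((\sum_(i <- r) F i) +i* (\sum_(i <- r) G i))%C :> R[i].
Proof.
elim: r => [|i r IH]; first by rewrite !big_nil.
by rewrite !big_cons IH.
Qed.

Lemma level_mean_complex n (F G : nat -> R) :
  level_mean m n (fun j => (F j +i* G j)%C : R[i]) =
  (level_mean m n F +i* level_mean m n G)%C.
Proof.
rewrite /level_mean sum_complex.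
have -> : (M n)%:R^-1 = ((M n)%:R^-1 : R)%:C%C by rewrite fmorphV rmorph_nat.
by apply/eqP; rewrite eq_complex /= !mul0r addr0 subr0 !eqxx.
Qed.

Lemma cintegral_level n (A : set X) (g : X -> R[i]) : level_fun n g -> saturated n A ->
  cintegral mu A g = level_mean m n (fun j => (\1_A (pt j) : R)%:C%C * g (pt j)).
Proof.
move=> lg sA; rewrite /cintegral.
rewrite (@Rintegral_level n) // => [|x y /lg -> //].
rewrite (@Rintegral_level n) // => [|x y /lg -> //].
rewrite -level_mean_complex; congr (level_mean m n _); apply/funext => j.
by case: (g (pt j)) => a b /=; apply/eqP; rewrite eq_complex /= !mul0r addr0 subr0 !eqxx.
Qed.

Lemma filtration_measurable_level n (g : X -> R[i]) :
  filtration_measurable n g <-> level_fun n g.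
Proof.
split=> [h x y xy|lg A _]; last first.
  by split; apply/filtrationP => // x y xy /=; rewrite (lg _ _ xy).
have [hr _] := h _ (measurable_set1 (complex.Re (g x))).
have [_ hi] := h _ (measurable_set1 (complex.Im (g x))).
move/(filtrationP m_ge2): hr => /(_ x y xy erefl) /= er.
move/(filtrationP m_ge2): hi => /(_ x y xy erefl) /= ei.
by rewrite (complexE (g x)) -er -ei -complexE.
Qed.

Lemma level_mean_cylinder n N x (G : nat -> R[i]) : (n <= N)%N ->
  level_mean m N (fun j => (\1_(cylinder n (pt x)) (pt j) : R)%:C%C * G j) =
  (M n)%:R^-1 * level_expect m N n G x.
Proof.
move=> nN; rewrite /level_mean /level_expect mulrA [(M n)%:R^-1 * _]mulrA mulVf ?base_neq0 //.
rewrite mul1r; congr (_ * _); rewrite [RHS]big_mkcond; apply: eq_bigr => j _.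
rewrite indicE; have [xj|nxj] := boolP (near_level m n x j).
  by rewrite mem_set ?mul1r //; apply/cylinder_pointP.
rewrite memNset ?mul0r // => /cylinder_pointP h; move/negP: nxj; apply.
exact: h.
Qed.

(** Measurability at level [n] makes [h] constant on cylinders of positive measure, so testing on a
    single cylinder determines its value there. *)
Lemma cond_exp_unique n N (g h : X -> R[i]) : (n <= N)%N -> level_fun N g ->
  is_cond_exp mu n g h -> h = level_expect m N n (g \o pt) \o idx n.
Proof.
move=> nN lg [_ /filtration_measurable_level lh hA]; apply/funext => x /=.
have sA : saturated n (cylinder n (pt (idx n x))) by exact: cylinder_saturated.
have := hA _ ((filtrationP m_ge2 _ _).2 sA).
have sAN : saturated N (cylinder n (pt (idx n x))) by exact: cylinder_saturated.
rewrite !(@cintegral_level N) //; last exact: level_fun_le nN lh.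
have iM : (M n)%:R^-1 != 0 :> R[i] by rewrite invr_eq0 base_neq0.
rewrite !level_mean_cylinder // => /(mulfI iM) <-.
rewrite level_expect_id //; last exact: level_fun_of_level.
by rewrite /= level_fun_index.
Qed.

Lemma level_mean_expect n N (G : nat -> R[i]) : (n <= N)%N ->
  level_mean m N (level_expect m N n G) = level_mean m N G.
Proof.
move=> nN; rewrite /level_mean; congr (_ * _).
have := level_expect_class_sum m_ge2 G 0 (leq0n n) nN.
by under eq_bigl => y do rewrite near_level0; under [RHS]eq_bigl => y do rewrite near_level0.
Qed.

Lemma level_expect_pull n N (k G : nat -> R[i]) x : of_level m n k ->
  level_expect m N n (fun y => k y * G y) x = k x * level_expect m N n G x.
Proof.
move=> lk; rewrite /level_expect mulrCA; congr (_ * _); rewrite mulr_sumr.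
by apply: eq_bigr => y xy; rewrite (lk x y xy).
Qed.

Lemma is_cond_exp_expect n N (g : X -> R[i]) : (n <= N)%N -> level_fun N g ->
  is_cond_exp mu n g (level_expect m N n (g \o pt) \o idx n).
Proof.
move=> nN lg; set h := _ \o idx n.
have lh : level_fun n h by exact: index_level_fun.
split.
- by split; apply: (@integrable_level n) => x y /lh ->.
- exact/filtration_measurable_level.
- move=> A /(filtrationP m_ge2) sA.
  have sAN : saturated N A by move=> x y xy; apply: sA; exact: cylinder_le xy.
  rewrite !(@cintegral_level N) //; last exact: level_fun_le nN lh.
  rewrite -[RHS](level_mean_expect _ nN); congr (level_mean m N _).
  apply/funext => x; rewrite level_expect_pull; last first.
    apply: (level_fun_of_level m_ge2 (F := fun x => (\1_A x : R)%:C%C)) => y z yz.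
    rewrite !indicE; congr (_%:R%:C%C); congr nat_of_bool.
    by apply/idP/idP; rewrite !inE; apply: sA => //; exact: cylinder_sym.
  congr (_ * _); rewrite /h /=; apply: (level_expect_level N (g \o pt)).
  by rewrite index_point // near_level_mod.
Qed.

Lemma cond_expE n N (g : X -> R[i]) : (n <= N)%N -> level_fun N g ->
  cond_exp mu n g = level_expect m N n (g \o pt) \o idx n.
Proof.
move=> nN lg; apply: xget_unique; first exact: is_cond_exp_expect.
by move=> h; exact: cond_exp_unique.
Qed.

Section Martingale.
Variable f : nat -> X -> R[i].
Hypothesis f_mart : martingale mu f.

Lemma martingale_level n : level_fun n (f n).
Proof. by have [_ /filtration_measurable_level] := f_mart n. Qed.

Lemma martingale_integral n k (A : set X) : saturated n A ->
  cintegral mu A (f n) = cintegral mu A (f (n + k)).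
Proof.
move=> sA; elim: k => [|k IH]; first by rewrite addn0.
rewrite IH addnS; have [_ _ [_ _]] := f_mart (n + k); apply.
apply/(filtrationP m_ge2) => x y xy; apply: sA; apply: cylinder_le xy.
exact: leq_addr.
Qed.

Lemma martingale_expect n N : (n <= N)%N ->
  f n \o pt = level_expect m N n (f N \o pt).
Proof.
move=> nN; have ce : is_cond_exp mu n (f N) (f n).
  have [ci fm _] := f_mart n; split => // A /(filtrationP m_ge2) sA.
  by rewrite (martingale_integral (N - n) sA) subnKC.
rewrite (cond_exp_unique nN (@martingale_level N) ce); apply/funext => j /=.
apply: (level_expect_level N (f N \o pt)).
by rewrite index_point // near_level_mod.
Qed.

(** The two products have [i] and [N] factors. Both equal the product up to [maxn i N], since the
    additional digits of [i] are 0. *)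
Lemma vilenkin_function_point N i j : (i < M N)%N ->
  vilenkin_function R i (pt j : X) = vchar R m N i j.
Proof.
move=> iN; rewrite /vilenkin_function /vchar /root_char.
have iMi : (i < M i)%N.
  by apply: leq_trans (vilenkin_base_expn0 m_ge2 i); exact: ltn_expl.
have E k c : (i < M k)%N -> (k <= c)%N ->
   \prod_(0 <= c < c) vroot R m j c ^+ digit i c =
   \prod_(0 <= c < k) vroot R m j c ^+ digit i c.
  move=> ik kc; rewrite (big_cat_nat _ (n := k)) //= [X in _ * X]big_nat.
  rewrite [X in _ * X]big1 ?mulr1 // => l /andP[kl _].
  by rewrite (digit_small_le m_ge2 ik kl).
rewrite (eq_bigr (fun c : 'I_i => vroot R m j c ^+ digit i c)); last first.
  by move=> c _; rewrite /rademacher point_ofE.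
rewrite -(big_mkord xpredT (fun c => vroot R m j c ^+ digit i c)).
rewrite -(big_mkord xpredT (fun c => vroot R m j c ^+ digit i c)).
by rewrite -(E i (maxn i N) iMi (leq_maxl _ _)) (E N) // leq_maxr.
Qed.

Lemma vilenkin_function_level N i : (i < M N)%N ->
  level_fun N (vilenkin_function R i : X -> R[i]).
Proof.
move=> iN x y xy; rewrite /vilenkin_function; apply: eq_bigr => c _.
case: (ltnP c N) => cN; first by rewrite /rademacher (xy c cN).
by rewrite (digit_small_le m_ge2 iN cN).
Qed.

(** The sequence under the limit is constant from [k = N] on, because the character is of level [N]
    and can be pulled out of the conditional expectation. *)
Lemma fourier_coefE N i : (i < M N)%N ->
  fourier_coef mu f i =
  level_mean m N (fun y => f N (pt y) * (vchar R m N i y)^*%C).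
Proof.
move=> iN;  apply: (@lim_near_cst (R[i] : numFieldType)); first exact: norm_hausdorff.
exists N => // k /= Nk.
have iM : (i < M k)%N by apply: leq_trans iN _; exact: leq_vilenkin_base.
rewrite (@cintegral_level k) //; last first.
  move=> x y xy; rewrite (martingale_level xy).
  by rewrite (vilenkin_function_level iM xy).
under [X in level_mean m k X]eq_fun => j do
  rewrite indicE mem_set // mul1r (vilenkin_function_point _ iN).
rewrite -(level_mean_expect _ Nk).
rewrite -(level_mean_of_level m_ge2 Nk); last first.
  move=> x y xy; rewrite (vchar_of_levelN R i xy).
  by congr (_ * _); apply: (level_fun_of_level m_ge2 (@martingale_level N)).
congr (level_mean m k _); apply/funext => x.
under [X in level_expect m k N X]eq_fun => y do rewrite mulrC.
rewrite level_expect_pull; last first.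
  by move=> y z yz; rewrite (vchar_of_levelN R i yz).
rewrite mulrC; congr (_ * _).
by rewrite -[f N (pt x)]/((f N \o pt) x) (martingale_expect Nk).
Qed.

Variable q : nat -> R.

Lemma partial_sum_swap k (c : nat -> R[i]) :
  \sum_(1 <= j < k.+1) (q (k - j)%N)%:C%C * \sum_(0 <= i < j) c i =
  \sum_(0 <= i < k) (weight_sum q (k - i))%:C%C * c i.
Proof.
under eq_bigr => j _ do rewrite mulr_sumr.
rewrite big_add1 /=.
transitivity (\sum_(0 <= j < k) \sum_(0 <= i < k | (i <= j)%N) (q (k - j.+1)%N)%:C%C * c i).
  rewrite !big_nat; apply: eq_bigr => j /andP[_ jk].
  by rewrite (big_nat_widen _ _ k) //; apply: eq_bigl => i; rewrite ltnS.
rewrite (exchange_big_dep xpredT) //= !big_nat; apply: eq_bigr => i /andP[_ ik].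
rewrite -mulr_suml; congr (_ * _).
rewrite -[LHS](rmorph_sum (real_complex R)); congr (_%:C%C).
have -> : \sum_(0 <= j < k | (i <= j)%N) q (k - j.+1)%N =
    \sum_(i <= j < k) q (k - j.+1)%N by rewrite (big_nat_widenl i 0).
rewrite big_nat_rev /= -{1}(add0n i) big_addn; apply: eq_big_nat => u /andP[_ uk].
by congr q; lia.
Qed.

Lemma norlund_mean_level N k : (k <= M N)%N -> level_fun N (norlund_mean mu q f k).
Proof.
move=> kN x y xy; rewrite /norlund_mean; congr (_ * _).
rewrite [LHS]big_nat [RHS]big_nat; apply: eq_bigr => j /andP[_ jk]; congr (_ * _).
rewrite /partial_sum [LHS]big_nat [RHS]big_nat; apply: eq_bigr => i /andP[_ ij].
congr (_ * _); apply: (vilenkin_function_level _ xy).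
by apply: leq_trans kN; exact: leq_trans ij jk.
Qed.

Lemma norlund_meanE N k : (k <= M N)%N ->
  norlund_mean mu q f k \o pt = noerlund m q N k (f N \o pt).
Proof.
move=> kN; apply/funext => x /=; rewrite /norlund_mean /partial_sum partial_sum_swap.
rewrite noerlund_expansion mulr_sumr [LHS]big_nat [RHS]big_nat.
apply: eq_bigr => i /andP[_ ik]; have iN : (i < M N)%N by exact: leq_trans kN.
rewrite (fourier_coefE iN) (vilenkin_function_point _ iN).
have -> : ((weight_sum q k)^-1 * weight_sum q (k - i))%:C%C =
  ((weight_sum q k)^-1)%:C%C * (weight_sum q (k - i))%:C%C :> R[i] by exact: rmorphM.
by ring.
Qed.

End Martingale.

(** * Comparison of the Hardy norms with finite averages *)

Section HardyNorm.
Variable p : R.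
Hypothesis p_gt0 : 0 < p.

(** Beyond level [N] the conditional expectations are [g] itself, so the supremum over all levels is
    reached among those up to [N]. *)
Lemma maxfun_cond_exp_le N (g : X -> R[i]) x : level_fun N g ->
  (maximal_function (martingale_of mu g) x <= (maxfun m N (g \o pt) (idx N x))%:E)%E.
Proof.
move=> lg; apply: ge_ereal_sup => _ [n _ <-]; rewrite lee_fin /martingale_of.
have lgN : of_level m N (g \o pt) by exact: level_fun_of_level.
case: (leqP n N) => nN.
  rewrite (cond_expE nN lg) /=.
  have -> : level_expect m N n (g \o pt) (idx n x) = level_expect m N n (g \o pt) (idx N x).
    apply: (level_expect_level N (g \o pt)); apply/cylinder_pointP => //.
    apply: cylinder_trans (@cylinder_index m m_ge2 n x) _; apply: cylinder_sym.
    exact: cylinder_le nN (@cylinder_index m m_ge2 N x).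
  exact: maxfun_ge.
rewrite (cond_expE (leqnn n) (level_fun_le (ltnW nN) lg)) /=.
have lgn : of_level m n (g \o pt) by exact: of_level_le (ltnW nN) lgN.
rewrite level_expect_id //= level_fun_index //; last exact: level_fun_le (ltnW nN) lg.
have := maxfun_ge m (g \o pt) (idx N x) (leqnn N).
by rewrite level_expect_id //= level_fun_index.
Qed.

Lemma hardy_norm_pow (f : nat -> X -> R[i]) :
  (hardy_norm mu p f `^ p = \int[mu]_x (maximal_function f x `^ p))%E.
Proof.
rewrite /hardy_norm poweR_Lnorm ?gt_eqF //; apply: eq_integral => x _.
rewrite gee0_abs //; apply: ereal_sup_ge; exists (Normc.normc (f 0%N x))%:E; first by exists 0%N.
by rewrite lee_fin normc_ge0.
Qed.

Lemma maximal_function_ge0 (f : nat -> X -> R[i]) x : (0 <= maximal_function f x)%E.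
Proof.
apply: ereal_sup_ge; exists (Normc.normc (f 0%N x))%:E; first by exists 0%N.
by rewrite lee_fin normc_ge0.
Qed.

Lemma measurable_maximal_function (f : nat -> X -> R[i]) :
  (forall n, level_fun n (f n)) -> measurable_fun setT (maximal_function f).
Proof.
move=> lf; rewrite (_ : maximal_function f =
    fun x => esups (fun n => (Normc.normc (f n x))%:E) 0).
  apply: (@measurable_fun_esups _ X R setT (fun n x => (Normc.normc (f n x))%:E)) => n.
  by apply: (@level_fun_measurable m m_ge2 _ _ n) => x y /lf ->.
apply/funext => x; rewrite /maximal_function /esups /=; congr ereal_sup.
by apply/seteqP; split => _ [n _ <-]; exists n.
Qed.

(** The finite maximal function sees only the levels up to [N] of [f]; this one-sided comparison is
    enough on the right-hand side of the theorem. *)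
Lemma hardy_norm_ge (f : nat -> X -> R[i]) N : martingale mu f ->
  ((level_mean m N (fun x => maxfun m N (f N \o pt) x `^ p))%:E
   <= hardy_norm mu p f `^ p)%E.
Proof.
move=> fm; have lf := martingale_level fm.
rewrite hardy_norm_pow.
pose G x := maxfun m N (f N \o pt) (idx N x) `^ p.
have lG : level_fun N G by exact: (index_level_fun (fun j => maxfun m N (f N \o pt) j `^ p)).
have -> : level_mean m N (fun x => maxfun m N (f N \o pt) x `^ p) = level_mean m N (G \o pt).
  rewrite /level_mean [X in _ * X]big_nat [X in _ = _ * X]big_nat; congr (_ * _).
  by apply: eq_bigr => j /andP[_ jN]; rewrite /G /= index_point // modn_small.
rewrite -(integral_level lG); apply: ge0_le_integral => //.
- by move=> x _; rewrite lee_fin powR_ge0.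
- by apply: (@level_fun_measurable m m_ge2 _ _ N) => x y /lG ->.
- apply: (@measurableT_comp _ _ _ _ _ _ (fun y : \bar R => y `^ p)%E).
    exact: measurable_poweR.
  exact: measurable_maximal_function.
move=> x _; rewrite /G -poweR_EFin.
apply: gt0_ler_poweR; rewrite ?(ltW p_gt0) ?in_itv /= ?leey ?andbT ?lee_fin ?maxfun_ge0 ?maximal_function_ge0 //.
have bd n : (n <= N)%N -> ((Normc.normc (level_expect m N n (f N \o pt) (idx N x)))%:E
     <= maximal_function f x)%E.
  move=> nN; rewrite -(martingale_expect fm nN) /=.
  apply: ereal_sup_ubound; exists n => //; congr (Normc.normc _)%:E.
  by apply: lf; apply: cylinder_le nN _; apply: cylinder_sym; exact: cylinder_index.
rewrite /maxfun; elim/big_ind: _ => [|u v hu hv|i _].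
- exact: maximal_function_ge0.
- by rewrite EFin_max ge_max hu hv.
- by apply: bd; rewrite -ltnS.
Qed.

Lemma hardy_norm_le (g : X -> R[i]) N : level_fun N g ->
  (hardy_norm mu p (martingale_of mu g) `^ p <=
   (level_mean m N (fun x => maxfun m N (g \o pt) x `^ p))%:E)%E.
Proof.
move=> lg; rewrite hardy_norm_pow.
pose G x := maxfun m N (g \o pt) (idx N x) `^ p.
have lG : level_fun N G by exact: (index_level_fun (fun j => maxfun m N (g \o pt) j `^ p)).
have -> : level_mean m N (fun x => maxfun m N (g \o pt) x `^ p) = level_mean m N (G \o pt).
  rewrite /level_mean [X in _ * X]big_nat [X in _ = _ * X]big_nat; congr (_ * _).
  by apply: eq_bigr => j /andP[_ jN]; rewrite /G /= index_point // modn_small.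
rewrite -(integral_level lG); apply: ge0_le_integral => //.
- by move=> x _; exact: poweR_ge0.
- apply: (@measurableT_comp _ _ _ _ _ _ (fun y : \bar R => y `^ p)%E).
    exact: measurable_poweR.
  apply: measurable_maximal_function => n; rewrite /martingale_of.
  rewrite (cond_expE (leq_maxl n N) (level_fun_le (leq_maxr n N) lg)).
  exact: index_level_fun.
- by apply: (@level_fun_measurable m m_ge2 _ _ N) => x y /lG ->.
move=> x _; rewrite /G -poweR_EFin.
apply: gt0_ler_poweR; rewrite ?(ltW p_gt0) ?in_itv /= ?leey ?andbT ?lee_fin ?maxfun_ge0 ?maximal_function_ge0 //.
exact: maxfun_cond_exp_le.
Qed.

End HardyNorm.
End Measure.


(** * Logarithms, and the theorem on the group *)

Lemma vilenkin_base_log (R : realType) (m : nat -> nat) n : (forall k, (2 <= m k)%N) ->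
  (2 <= n)%N ->
  exists2 N, (n < vilenkin_base m N)%N & N.+1%:R <= (3 / ln 2) * ln n%:R :> R.
Proof.
move=> m2 n2.
have ex : exists N, (n < vilenkin_base m N)%N.
  by exists n; apply: leq_trans (vilenkin_base_expn0 m2 n); exact: ltn_expl.
(* Minimality gives 2^(N-1) <= M (N-1) <= n. Writing N+1 as (N-1) + 2 and using ln 2 <= ln n twice
   produces the factor 3. *)
case: (ex_minnP ex) => N nN min; exists N => //.
have N0 : (0 < N)%N.
  by case: N nN {min} => //; rewrite vilenkin_base0 ltnNge (ltnW n2).
have Nn : (2 ^ N.-1 <= n)%N.
  apply: leq_trans (vilenkin_base_expn0 m2 _) _; rewrite leqNgt; apply/negP => /min.
  by rewrite leqNgt ltn_predL N0.
have l2 : 0 < ln 2 :> R by rewrite ln_gt0 // ltr1n.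
have h1 : ln 2 <= ln n%:R :> R by rewrite ler_ln ?posrE ?ltr0n ?ler_nat // (ltn_trans _ n2).
have h2 : N.-1%:R * ln 2 <= ln n%:R :> R.
  rewrite mulr_natl -lnXn // -natrX ler_ln ?posrE ?ltr0n ?expn_gt0 ?ler_nat //.
  exact: ltn_trans n2.
rewrite mulrAC ler_pdivlMr // -(prednK N0) -natr1 -natr1.
by lra.
Qed.

Theorem theorem2 (R : realType) (m : nat -> nat)
    (mu : probability (vilenkin_space m) R) (alpha : R) (q : nat -> R)
    (m_bounded : bounded_base m)
    (mu_product : product_uniform mu)
    (alpha_gt0 : 0 < alpha) (alpha_lt1 : alpha < 1)
    (q_ge0 : forall n, 0 <= q n)
    (q_nonincreasing : nonincreasing_seq q)
    (q0_gt0 : 0 < q 0%N)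
    (Q_cvg : weight_sum q n @[n --> \oo] --> +oo)
    (Q_growth :
      (fun n : nat => n%:R `^ alpha / weight_sum q n : R^o)
        =O_\oo (fun=> 1 : R^o))
    (q_decrement :
      (fun n : nat => (q n - q n.+1) / n%:R `^ (alpha - 2) : R^o)
        =O_\oo (fun=> 1 : R^o)) :
  exists c : R,
    forall f : nat -> vilenkin_space m -> R[i],
      hardy mu (1 + alpha)^-1 f ->
    forall n : nat, (2 <= n)%N ->
      (((ln n%:R)^-1)%:E *
        \sum_(1 <= k < n.+1)
          (hardy_norm mu (1 + alpha)^-1
             (martingale_of mu (norlund_mean mu q f k)) `^ (1 + alpha)^-1
           * (k%:R^-1)%:E)
       <= c%:E * hardy_norm mu (1 + alpha)^-1 f `^ (1 + alpha)^-1)%E.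
Proof.
have [m2 [B mB]] := m_bounded.
have alpha01 : 0 < alpha < 1 by rewrite alpha_gt0.
have [Cq Cq0 ratio] :=
  weight_ratio alpha01 q_ge0 q_nonincreasing q0_gt0 Q_growth q_decrement.
have p_gt0 := exponent_gt0 alpha01.
have T0 : 0 <= total_const B alpha Cq by exact: total_const_ge0.
exists (total_const B alpha Cq * (3 / ln 2)) => f [fm _] n n2.
have [N nN logN] := vilenkin_base_log R m2 n2.
pose g := f N \o @point_of m.
pose A := level_mean m N (fun x => maxfun m N g x `^ (1 + alpha)^-1).
have A0 : 0 <= A by apply: level_mean_ge0 => x; exact: powR_ge0.
have ln0 : 0 < ln n%:R :> R by rewrite ln_gt0 // ltr1n.
have sum_le : (\sum_(1 <= k < n.+1)
    (hardy_norm mu (1 + alpha)^-1 (martingale_of mu (norlund_mean mu q f k))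
       `^ (1 + alpha)^-1 * (k%:R^-1)%:E) <= (log_mean m alpha q N g)%:E)%E.
  apply: (@le_trans _ _ (\sum_(1 <= k < n.+1) (k%:R^-1 *
      level_mean m N (fun x => maxfun m N (noerlund m q N k g) x `^ (1 + alpha)^-1))%:E)%E).
    rewrite big_nat [leRHS]big_nat; apply: lee_sum => k /andP[_ kn].
    have kN : (k <= vilenkin_base m N)%N by apply: leq_trans (ltnW nN).
    rewrite mulrC EFinM; apply: lee_wpmul2r; first by rewrite lee_fin invr_ge0.
    have := hardy_norm_le m2 mu_product p_gt0 (@norlund_mean_level R m mu m2 f q N k kN).
    by rewrite (norlund_meanE m2 mu_product fm q kN).
  (* The indices from [n.+1] up to [M N] only add nonnegative terms, so the sum can be completed to
     full blocks. *)
  rewrite sumEFin lee_fin /log_mean [leRHS](big_cat_nat _ (n := n.+1)) //=.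
  rewrite lerDl sumr_ge0 // => k _; rewrite mulr_ge0 ?invr_ge0 //.
  by apply: level_mean_ge0 => x; exact: powR_ge0.
have g_level : of_level m N g by apply: level_fun_of_level => // x y; exact: (martingale_level m2 fm).
have main := log_mean_bound m2 mB alpha01 q_ge0 q_nonincreasing q0_gt0 Cq0 ratio g_level.
apply: (@le_trans _ _ ((total_const B alpha Cq * (3 / ln 2))%:E * A%:E)%E); last first.
  apply: lee_wpmul2l; last exact: hardy_norm_ge.
  by rewrite lee_fin mulr_ge0 // divr_ge0 // ln_ge0 // ler1n.
apply: (@le_trans _ _ (((ln n%:R)^-1)%:E * (log_mean m alpha q N g)%:E)%E).
  by apply: lee_wpmul2l => //; rewrite lee_fin invr_ge0 ltW.
rewrite -!EFinM lee_fin mulrC ler_pdivrMr //; apply: le_trans main _.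
rewrite [leRHS](_ : _ = total_const B alpha Cq * (3 / ln 2 * ln n%:R) * A); last by ring.
by rewrite ler_wpM2r // ler_wpM2l.
Qed.
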